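(* Let $d\ge 1$, let $c_{ij}=c_{ji}\in L_\infty(\mathbf R^d)$ be real-valued for $i,j\in\{1,\dots,d\}$, and suppose that the $d\times d$-matrix $C(x)=(c_{ij}(x))$ is positive-definite (in the sense $C(x)\ge 0$, degeneracy being allowed) for almost every $x\in\mathbf R^d$. Let $h$ be the quadratic form with domain $D(h)=W^{1,2}(\mathbf R^d)$ given by $h(\varphi)=\sum_{i,j=1}^d(\partial_i\varphi,c_{ij}\,\partial_j\varphi)$, and let $h_0$ be the associated viscosity form, i.e. the closure $h_0=\overline{h_r}$ of the regular part $h_r$ of $h$. Then $h_0$ is a regular local Dirichlet form on $L_2(\mathbf R^d)$.
   Context: Inner products $(\cdot,\cdot)$ are those of $L_2(\mathbf R^d)$ (Lebesgue measure), linear in the second variable. Regular part: by a theorem of Simon, a positive quadratic form $h$ can be decomposed as $h=h_r+h_s$ with positive forms $h_r,h_s$, $D(h_r)=D(h_s)=D(h)$, where $h_r$ is the largest closable form majorized by $h$. The form $h_r$ is the regular part of $h$; the viscosity form is its closure $h_0=\overline{h_r}$. Equivalently (Simon), $D(h_0)$ consists of those $\varphi\in L_2(\mathbf R^d)$ for which there is a sequence $\varphi_n\in D(h)$ with $\varphi_n\to\varphi$ in $L_2$ and $\liminf_{n\to\infty}h(\varphi_n)<\infty$, and $h_0(\varphi)$ is the minimum of $\liminf_{n\to\infty}h(\varphi_n)$ over all sequences $\varphi_n\in D(h)$ with $\varphi_n\to\varphi$ in $L_2$. A Dirichlet form $\mathcal E$ on $L_2(X)$ is regular if there is a subset of $D(\mathcal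 E)\cap C_c(X)$ which is a core of $\mathcal E$, i.e. dense in $D(\mathcal E)$ with respect to the norm $\varphi\mapsto(\mathcal E(\varphi)+\|\varphi\|_2^2)^{1/2}$, and which is also dense in $C_0(X)$ (continuous functions vanishing at infinity) with respect to the supremum norm. A Dirichlet form $\mathcal E$ is local if $\mathcal E(\psi,\varphi)=0$ for all $\varphi,\psi\in D(\mathcal E)$ and $a\in\mathbf R$ such that $(\varphi+a\,1)\psi=0$ (almost everywhere), where $1$ is the constant function one. *)

(* Defs.v *)
From HB Require Import structures.
From mathcomp Require Import all_boot all_order all_algebra.
From mathcomp Require Import all_classical all_reals all_analysis.
From mathcomp Require Import complex.

Set Implicit Arguments.
Unset Strict Implicit.
Unset Printing Implicit Defensive.
Import Order.TTheory GRing.Theory Num.Theory.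
Import numFieldNormedType.Exports.

Local Open Scope classical_set_scope.
Local Open Scope complex_scope.
Local Open Scope ring_scope.

(* 'rV[R]_n carries the product sigma-algebra (generated by the coordinates),
   exactly as the library does for tuples; it is the Borel sigma-algebra of
   R^n.  Elements of L_2 and of L_oo are represented by functions that are
   measurable for this sigma-algebra, up to equality almost everywhere. *)
Definition rV_display : measure_display.
Proof. exact. Qed.

Section measurable_rV.
Context {R : realType}.
Variable n : nat.

Let coords : 'I_n -> 'rV[R]_n -> measurableTypeR R := fun i v => v ord0 i.

Let rV_set0 : g_sigma_preimage coords set0.
Proof. exact: sigma_algebra0. Qed.

Let rV_setC A : g_sigma_preimage coords A -> g_sigma_preimage coords (~` A).
Proof. exact: sigma_algebraC. Qed.

Let rV_bigcup (F : _^nat) : (forall i, g_sigma_preimage coords (F i)) ->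
  g_sigma_preimage coords (\bigcup_i (F i)).
Proof. exact: sigma_algebra_bigcup. Qed.

HB.instance Definition _ := @isMeasurable.Build rV_display
  'rV[R]_n (g_sigma_preimage coords) rV_set0 rV_setC rV_bigcup.

End measurable_rV.

Section lebesgue_rV.
Context {R : realType}.

Lemma measurable_rV_coord n (i : 'I_n) :
  measurable_fun [set: 'rV[R]_n] (fun v : 'rV[R]_n => v ord0 i).
Proof.
move=> _ Y mY; rewrite setTI; apply: sub_sigma_algebra => /=.
case: n i => [[]//|n] i.
rewrite -bigcup_mkord_ord; exists i => //=; exists Y => //.
by rewrite setTI; apply/seteqP; split=> v /=; rewrite inord_val.
Qed.

Lemma measurable_rVP d' (T : measurableType d') n (f : T -> 'rV[R]_n) :
  (forall i, measurable_fun setT (fun x => f x ord0 i)) ->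
  measurable_fun setT f.
Proof.
move=> mf; pose co (i : 'I_n) (v : 'rV[R]_n) : measurableTypeR R := v ord0 i.
apply: (@measurability _ _ _ _ setT f
  (\big[setU/set0]_(i < n) preimage_set_system setT (co i) measurable)) => //.
move=> _ [B + <-]; rewrite -bigcup_seq => -[i _ [A mA <-]].
by have := mf i measurableT A mA; rewrite !setTI.
Qed.

Definition rV_rcons n (vx : 'rV[R]_n * measurableTypeR R) : 'rV[R]_n.+1 :=
  \row_i (if unlift ord_max i is Some j then vx.1 ord0 j else vx.2).

Lemma measurable_rV_rcons n : measurable_fun setT (@rV_rcons n).
Proof.
apply: measurable_rVP => i; under eq_fun do rewrite mxE.
case: (unlift ord_max i) => [j|]; last exact: measurable_snd.
exact: (measurableT_comp (measurable_rV_coord j) measurable_fst).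
Qed.

Section lebesgue_rVS.
Variables (n : nat) (m : {measure set 'rV[R]_n -> \bar R}).
Local Open Scope ereal_scope.

Definition lebesgue_rVS : set 'rV[R]_n.+1 -> \bar R :=
  pushforward (m \x @lebesgue_measure R) (@rV_rcons n).

Let mpre A : measurable A -> measurable (@rV_rcons n @^-1` A).
Proof.
by move=> mA; rewrite -[X in measurable X]setTI; exact: measurable_rV_rcons.
Qed.

Let lebesgue_rVS0 : lebesgue_rVS set0 = 0.
Proof. by rewrite /lebesgue_rVS /pushforward preimage_set0 measure0. Qed.

Let lebesgue_rVS_ge0 A : 0 <= lebesgue_rVS A.
Proof. exact: (measure_ge0 (m \x @lebesgue_measure R)). Qed.

Let lebesgue_rVS_sigma_additive : semi_sigma_additive lebesgue_rVS.
Proof.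
move=> F mF tF mUF; rewrite /lebesgue_rVS /pushforward preimage_bigcup.
apply: measure_semi_sigma_additive.
- by move=> k; exact: mpre.
- apply/trivIsetP => /= i j _ _ ij; rewrite -preimage_setI.
  by move/trivIsetP : tF => /(_ _ _ _ _ ij) ->//; rewrite preimage_set0.
- by rewrite -preimage_bigcup; exact: mpre.
Qed.

HB.instance Definition _ := isMeasure.Build _ _ _ lebesgue_rVS
  lebesgue_rVS0 lebesgue_rVS_ge0 lebesgue_rVS_sigma_additive.

End lebesgue_rVS.

(* Lebesgue measure on R^n, as the n-fold product of that of R. *)
Fixpoint lebesgue_rV (n : nat) : {measure set 'rV[R]_n -> \bar R} :=
  match n with
  | 0 => @dirac _ 'rV[R]_0 0 R
  | n'.+1 => lebesgue_rVS (lebesgue_rV n')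
  end.

End lebesgue_rV.
Arguments lebesgue_rV {R} n.

Section complex_L2.
Context {R : realType} {d : nat}.
Notation E := 'rV[R]_d.
Notation mu := (@lebesgue_rV R d).
Notation C := R[i].
Notation Re := complex.Re.
Notation Im := complex.Im.
Implicit Types (f g : E -> C).

Definition L2 f : Prop :=
  (fun x => Re (f x)) \in Lfun mu 2%:E /\ (fun x => Im (f x)) \in Lfun mu 2%:E.

Definition cintegral f : C :=
  Complex (\int[mu]_x Re (f x)) (\int[mu]_x Im (f x)).

Definition inner f g : C := cintegral (fun x => conjc (f x) * g x).

Definition l2norm f : R := Num.sqrt (Re (inner f f)).

Definition ae_eq_L2 f g : Prop := {ae mu, forall x, f x = g x}.

Definition l2_cvg (phi : nat -> E -> C) f : Prop :=
  l2norm (phi n \- f) @[n --> \oo] --> (0 : R).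

Definition continuousC f : Prop :=
  continuous (fun x => Re (f x)) /\ continuous (fun x => Im (f x)).

(* continuous functions with compact support *)
Definition Cc f : Prop :=
  continuousC f /\ compact (closure [set x | f x != 0]).

(* continuous functions vanishing at infinity *)
Definition C0 f : Prop :=
  continuousC f /\
  forall e : R, 0 < e -> exists2 K : set E, compact K &
    forall x, ~ K x -> ComplexField.Normc.normc (f x) < e.

End complex_L2.

Section sobolev.
Context {R : realType} {d : nat}.
Notation E := 'rV[R]_d.
Notation C := R[i].

Definition partial (i : 'I_d) (eta : E -> R) : E -> R :=
  fun x => 'D_(delta_mx ord0 i) eta x.

(* C^oo: all iterated partial derivatives exist and are continuous. *)
Definition smooth (eta : E -> R) : Prop :=
  forall s : seq 'I_d, let eta_s := foldr partial eta s in
    continuous eta_s /\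
    forall (i : 'I_d) (x : E), derivable eta_s x (delta_mx ord0 i).

Definition test_function (eta : E -> R) : Prop :=
  smooth eta /\ compact (closure [set x | eta x != 0]).

(* Real test functions suffice for complex-valued f, by linearity. *)
Definition is_weak_partial (i : 'I_d) (f g : E -> C) : Prop :=
  forall eta, test_function eta ->
    cintegral (fun x => f x * (partial i eta x)%:C)
      = - cintegral (fun x => g x * (eta x)%:C).

Definition W12 (f : E -> C) : Prop :=
  L2 f /\ forall i, exists2 g, L2 g & is_weak_partial i f g.

(* weak derivatives are unique up to equality almost everywhere *)
Definition weak_partial (i : 'I_d) (f : E -> C) : E -> C :=
  xget (fun=> 0) [set g | L2 g /\ is_weak_partial i f g].

End sobolev.

(* A positive quadratic form q on L_2(R^d) is encoded as a function with values
   in [0, +oo], equal to +oo exactly off its domain D(q).  The order "t is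
   majorized by q" of forms (D(q) `<=` D(t) and t <= q on D(q)) then is the
   pointwise order, and a form is determined by its values. *)
Section forms.
Context {R : realType} {d : nat}.
Notation E := 'rV[R]_d.
Notation mu := (@lebesgue_rV R d).
Notation C := R[i].
Notation Re := complex.Re.
Notation Im := complex.Im.
Notation form := ((E -> C) -> \bar R).
Implicit Types (q t : form) (f g psi phi : E -> C) (u : nat -> E -> C).

Definition form_dom q : set (E -> C) := [set f | (q f < +oo)%E].

(* The sesquilinear form of q, antilinear in the first variable. *)
Definition polar q psi phi : C :=
  let Q f : C := (fine (q f))%:C in
  let I : C := Complex 0 1 in
  4%:R^-1 * (Q (phi \+ psi) - Q (phi \- psi)
    + I * (Q (phi \+ (I \*o psi)) - Q (phi \- (I \*o psi)))).

Record positive_form q : Prop := {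
  form_ge0 : forall f, (0 <= q f)%E ;
  form_L2 : form_dom q `<=` L2 ;
  form_ae : forall f g, L2 f -> L2 g -> ae_eq_L2 f g -> q f = q g ;
  form_dom0 : form_dom q (fun=> 0) ;
  form_domP : forall a f g,
    form_dom q f -> form_dom q g -> form_dom q ((a \*o f) \+ g) ;
  form_linr : forall a f g psi,
    form_dom q f -> form_dom q g -> form_dom q psi ->
    polar q psi ((a \*o f) \+ g) = a * polar q psi f + polar q psi g ;
  form_linl : forall a f g phi,
    form_dom q f -> form_dom q g -> form_dom q phi ->
    polar q ((a \*o f) \+ g) phi
      = conjc a * polar q f phi + polar q g phi ;
  form_diag : forall f, form_dom q f -> polar q f f = (fine (q f))%:C
}.

Definition form_le t q : Prop := forall f, (t f <= q f)%E.

(* u converges to f in L_2 and is a Cauchy sequence for q *)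
Definition form_approx q u f : Prop :=
  [/\ forall n, form_dom q (u n), L2 f, l2_cvg u f &
    forall e : R, 0 < e -> exists N : nat, forall m n : nat,
      (N <= m)%N -> (N <= n)%N -> (q (u m \- u n)%R < e%:E)%E].

Definition closable q : Prop := forall u, form_approx q u (fun=> 0) ->
  q (u n) @[n --> \oo] --> (0 : \bar R).

Definition closed_form q : Prop := forall u f, form_approx q u f ->
  form_dom q f /\ q (u n \- f) @[n --> \oo] --> (0 : \bar R).

(* is_form_closure q and is_regular_part q each hold of at most one form, so
   that xget below is a definite description. *)
Definition is_form_closure q t : Prop := forall f,
  (form_dom t f <-> exists u, form_approx q u f) /\
  forall u, form_approx q u f -> q (u n) @[n --> \oo] --> t f.

Definition form_closure q : form := xget (fun=> +oo%E) (is_form_closure q).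

Definition is_regular_part q qr : Prop :=
  [/\ positive_form qr, form_dom qr = form_dom q, closable qr,
    form_le qr q &
    forall t, positive_form t -> closable t -> form_le t q -> form_le t qr].

Definition regular_part q : form := xget (fun=> +oo%E) (is_regular_part q).

Definition viscosity_form q : form := form_closure (regular_part q).

Definition densely_defined q : Prop := forall f, L2 f ->
  forall e : R, 0 < e -> exists2 g, form_dom q g & l2norm (f \- g) < e.

Definition unit_contraction f : E -> C :=
  fun x => (Num.min (Num.max (Re (f x)) 0) 1)%:C.

(* On the complex space L_2, a Dirichlet form is the complexification of its
   restriction to real-valued functions, whence [dirichlet_real]. *)
Record dirichlet_form q : Prop := {
  dirichlet_positive : positive_form q ;
  dirichlet_dense : densely_defined q ;
  dirichlet_closed : closed_form q ;
  dirichlet_real : forall f, q (fun x => conjc (f x)) = q f ;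
  dirichlet_markov : forall f, (forall x, Im (f x) = 0) ->
    (q (unit_contraction f) <= q f)%E
}.

Definition regular_form q : Prop := exists S : set (E -> C),
  [/\ S `<=` form_dom q `&` Cc,
    (forall f, form_dom q f -> forall e : R, 0 < e -> exists2 g, S g &
      Num.sqrt (fine (q (f \- g)) + l2norm (f \- g) ^+ 2) < e) &
    (forall f, C0 f -> forall e : R, 0 < e -> exists2 g, S g &
      forall x, ComplexField.Normc.normc (f x - g x) < e)].

Definition local_form q : Prop := forall phi psi (a : R),
  form_dom q phi -> form_dom q psi ->
  {ae mu, forall x, (phi x + a%:C) * psi x = 0} -> polar q psi phi = 0.

(* h(phi) = \sum_(i, j) (d_i phi, c_ij d_j phi) on W^{1,2}; the sum is real
   when c is symmetric almost everywhere. *)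
Definition elliptic_form (c : 'I_d -> 'I_d -> E -> R) : form := fun phi =>
  if `[< W12 phi >] then
    (Re (\sum_(i < d) \sum_(j < d)
      inner (weak_partial i phi)
            (fun x => (c i j x)%:C * weak_partial j phi x)))%:E
  else +oo%E.

Definition coeff_mx (c : 'I_d -> 'I_d -> E -> R) (x : E) : 'M[R]_d :=
  \matrix_(i, j) c i j x.

End forms.

(* Main.v *)
(* The relaxation a0(f) = sup over e > 0 of the infimum of h over the tame
   functions (compactly supported, differentiable) within e of f in L_2 is a
   closed form.  The engine is an orthogonality principle: since f has an
   almost minimizing sequence u_k, a bounded-energy perturbation z_k that is
   small in L_2 cannot lower the energy, so h(u_k, z_k) tends to 0; hence
   minimizing sequences are Cauchy for h, and may be added.  The viscosity form
   h_0 is the complexification of a0: mollification gives a0 <= h on W^{1,2},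
   and a closable form t <= h satisfies t(f) <= lim t(u_k) <= lim h(u_k) = a0(f).

   The Markov property passes from smooth approximations of the unit
   contraction to the limit by lower semicontinuity.  For locality let
   (f + a) g = 0 with minimizing sequences u_k of f and v_k of g, and let
   F_a(t) = e (atan((t + a) / e) - atan(a / e)).  As F_a o u_k and F_0 o v_k are
   uniformly small with e, orthogonality leaves only the interaction of
   G_a o u_k and G_0 o v_k, where G_a(t) = t - F_a(t).  Its density carries the
   weight G_0'(v_k) G_a'(u_k) <= (|v_k - g| + |u_k - f|) / e, which tends to 0
   in L_2 with k, while the energy densities of u_k and v_k are L_1-close to
   fixed square-integrable ones. *)
Require Import Defs.
From HB Require Import structures.
From mathcomp Require Import all_boot all_order all_algebra.
From mathcomp Require Import finmap all_classical all_reals all_analysis.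
From mathcomp Require Import measurable_realfun ess_sup_inf.
From mathcomp Require Import complex ring lra.
Import Order.TTheory GRing.Theory Num.Theory.
Import numFieldNormedType.Exports.
Local Open Scope classical_set_scope.
Local Open Scope ring_scope.

Set Implicit Arguments.
Unset Strict Implicit.
Unset Printing Implicit Defensive.


(** * Relaxation of a positive quadratic form *)

(** With degenerate coefficients [h] need not be closable, so an element of D(h_0) in general
    carries no gradient and no energy density of its own. Everything about h_0 is therefore read off
    minimizing sequences, along which classical derivatives exist. This is why the relaxation runs
    over compactly supported differentiable functions, where the chain rule is pointwise, rather
    than over W^{1,2}; the same functions then provide the core that regularity asks for. Two forms
    with common values identify h_0: the restriction of a0 to W^{1,2} is the regular part, and a0 on
    its full domain is the closure of that restriction. The analysis is done for real functions,
    after a correction of the coefficients on a null set that makes them bounded, symmetric and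
    positive at every point. *)

Section relaxation.
Context {R : realType} {V : lmodType R}.
Implicit Types (L D : set V) (n : V -> R) (b : V -> V -> R).

(** [n] is only a seminorm and the laws hold only on [L] and [D], so that plain functions can stand
    for classes modulo null sets. The record is used for the energy on [tame] functions, for the
    relaxed form on its domain, and for the relaxed form on W^{1,2}. *)
Record semi_inner L D n b : Prop := {
  amb_lin : forall a x y, L x -> L y -> L (a *: x + y) ;
  amb_norm_ge0 : forall x, 0 <= n x ;
  amb_normD : forall x y, L x -> L y -> n (x + y) <= n x + n y ;
  amb_normZ : forall a x, L x -> n (a *: x) = `|a| * n x ;
  dom_amb : D `<=` L ;
  dom0 : D 0 ;
  dom_lin : forall a x y, D x -> D y -> D (a *: x + y) ;
  bil_lin : forall a x y z, D x -> D y -> D z ->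
    b (a *: x + y) z = a * b x z + b y z ;
  bil_sym : forall x y, D x -> D y -> b x y = b y x ;
  bil_ge0 : forall x, D x -> 0 <= b x x }.

Definition rdom L D n b : set V := [set f | L f /\ exists M : R,
  forall e, 0 < e -> exists g, [/\ D g, n (g - f) < e & b g g <= M]].

(** A supremum of lower bounds replaces the supremum over [e] of infima. Being a real number in all
    cases, it is meaningful only on [rdom], where one [M] valid for every [e] bounds the set. *)
Definition relax D n b (f : V) : R := sup [set m | exists2 e, 0 < e &
  forall g, D g -> n (g - f) < e -> m <= b g g].

Definition minimizing D n b f (u : nat -> V) : Prop :=
  [/\ forall k, D (u k), n (u k - f) @[k --> \oo] --> (0 : R) &
      b (u k) (u k) @[k --> \oo] --> relax D n b f].

Definition relax_bil D n b (f g : V) : R :=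
  (relax D n b (f + g) - relax D n b (f - g)) / 4.

Context {L D : set V} {n : V -> R} {b : V -> V -> R}.
Hypothesis H : semi_inner L D n b.
Notation dom := (rdom L D n b).
Notation a0 := (relax D n b).
Notation b0 := (relax_bil D n b).
Notation minseq := (minimizing D n b).

Let DL x : D x -> L x. Proof. exact: (dom_amb H). Qed.

Lemma amb0 : L 0. Proof. exact/DL/(dom0 H). Qed.

Lemma ambZ a x : L x -> L (a *: x).
Proof. by move=> Lx; rewrite -[_ *: _]addr0; apply: (amb_lin H) => //; exact: amb0. Qed.

Lemma ambD x y : L x -> L y -> L (x + y).
Proof. by move=> Lx Ly; rewrite -[x]scale1r; exact: (amb_lin H). Qed.

Lemma ambN x : L x -> L (- x).
Proof. by move=> Lx; rewrite -scaleN1r; exact: ambZ. Qed.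

Lemma ambB x y : L x -> L y -> L (x - y).
Proof. by move=> Lx Ly; apply: ambD => //; exact: ambN. Qed.

Lemma amb_normN x : L x -> n (- x) = n x.
Proof. by move=> Lx; rewrite -scaleN1r (amb_normZ H)// normrN1 mul1r. Qed.

Lemma amb_norm0 : n 0 = 0.
Proof. by rewrite -(scale0r 0) (amb_normZ H) ?normr0 ?mul0r//; exact: amb0. Qed.

Lemma amb_normBC x y : L x -> L y -> n (x - y) = n (y - x).
Proof. by move=> Lx Ly; rewrite -amb_normN ?opprB//; exact: ambB. Qed.

Lemma amb_norm_dist x y z : L x -> L y -> L z ->
  n (x - z) <= n (x - y) + n (y - z).
Proof.
move=> Lx Ly Lz; rewrite [x - z](_ : _ = (x - y) + (y - z)); last by rewrite addrA subrK.
by apply: (amb_normD H); exact: ambB.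
Qed.

Lemma domZ a x : D x -> D (a *: x).
Proof. by move=> Dx; rewrite -[_ *: _]addr0; apply: (dom_lin H) => //; exact: (dom0 H). Qed.

Lemma domD x y : D x -> D y -> D (x + y).
Proof. by move=> Dx Dy; rewrite -[x]scale1r; exact: (dom_lin H). Qed.

Lemma domN x : D x -> D (- x).
Proof. by move=> Dx; rewrite -scaleN1r; exact: domZ. Qed.

Lemma domB x y : D x -> D y -> D (x - y).
Proof. by move=> Dx Dy; apply: domD => //; exact: domN. Qed.

Local Hint Extern 0 (D _) => (solve [repeat first
  [assumption | apply: domN | apply: domD | apply: domZ | exact: (dom0 H)]]) : core.

Lemma bil0 z : D z -> b 0 z = 0.
Proof.
move=> Dz; have := bil_lin H 1 (dom0 H) (dom0 H) Dz.
by rewrite scaler0 addr0; lra.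
Qed.

Lemma bilZl a x z : D x -> D z -> b (a *: x) z = a * b x z.
Proof.
move=> Dx Dz; have := bil_lin H a Dx (dom0 H) Dz.
by rewrite addr0 bil0// addr0.
Qed.

Lemma bilDl x y z : D x -> D y -> D z -> b (x + y) z = b x z + b y z.
Proof. by move=> Dx Dy Dz; rewrite -[x]scale1r (bil_lin H)// mul1r scale1r. Qed.

Lemma bilDr x y z : D x -> D y -> D z -> b z (x + y) = b z x + b z y.
Proof.
move=> Dx Dy Dz; rewrite (bil_sym H)//.
by rewrite bilDl// !(bil_sym H _ Dz).
Qed.

Lemma bilZr a x z : D x -> D z -> b z (a *: x) = a * b z x.
Proof.
move=> Dx Dz; rewrite (bil_sym H)//.
by rewrite bilZl// (bil_sym H Dx).
Qed.

Lemma bilBl x y z : D x -> D y -> D z -> b (x - y) z = b x z - b y z.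
Proof. by move=> Dx Dy Dz; rewrite bilDl// -(scaleN1r y) bilZl// mulN1r. Qed.

Lemma bilBr x y z : D x -> D y -> D z -> b z (x - y) = b z x - b z y.
Proof. by move=> Dx Dy Dz; rewrite bilDr// -(scaleN1r y) bilZr// mulN1r. Qed.

Lemma bil_sqr a x y : D x -> D y ->
  b (a *: x + y) (a *: x + y) = a ^+ 2 * b x x + 2 * a * b x y + b y y.
Proof.
move=> Dx Dy; have Dax := domZ a Dx.
rewrite (bilDl Dax Dy (domD Dax Dy)) (bilDr Dax Dy Dax) (bilDr Dax Dy Dy).
rewrite !bilZl ?bilZr// (bil_sym H Dy Dx).
by ring.
Qed.

(** Positivity at [(t * s) *: x + y] for [s] equal to 1 and to -1, divided by [t]. It stands in for
    the Cauchy-Schwarz inequality, the weight [t] being free. *)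
Lemma bil_amgm t x y : 0 < t -> D x -> D y ->
  2 * `|b x y| <= t * b x x + t^-1 * b y y.
Proof.
move=> t0 Dx Dy.
have key s : s ^+ 2 = 1 -> 0 <= t * b x x + 2 * s * b x y + t^-1 * b y y.
  move=> s1; have := bil_ge0 H (dom_lin H (t * s) Dx Dy).
  rewrite bil_sqr// exprMn s1 => h.
  have : 0 <= t^-1 * (t ^+ 2 * 1 * b x x + 2 * (t * s) * b x y + b y y).
    by rewrite mulr_ge0// invr_ge0 ltW.
  have -> // : t^-1 * (t ^+ 2 * 1 * b x x + 2 * (t * s) * b x y + b y y) =
      t * b x x + 2 * s * b x y + t^-1 * b y y.
  by field; rewrite gt_eqF.
have [_|_] := ler0P (b x y).
  by have := key 1 (expr1n _ _); lra.
by have := key (-1) (etrans (sqrrN 1) (expr1n _ _)); lra.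
Qed.

Let msets f := [set m | exists2 e, 0 < e &
  forall g, D g -> n (g - f) < e -> m <= b g g].

Lemma relax_bounds f M :
  (forall e, 0 < e -> exists g, [/\ D g, n (g - f) < e & b g g <= M]) ->
  has_sup (msets f) /\ a0 f <= M.
Proof.
move=> HM; have ubM : ubound (msets f) M.
  by move=> m [e e0 he]; have [g [Dg ng bg]] := HM _ e0; rewrite (le_trans (he _ Dg ng)).
have ne : (msets f) !=set0.
  by exists 0; exists 1 => // g Dg _; exact: (bil_ge0 H).
by split; [split=> //; exists M|exact: ge_sup].
Qed.

Lemma rdom_sup f : dom f -> has_sup (msets f).
Proof. by move=> [_ [M HM]]; have [] := relax_bounds HM. Qed.

Lemma relax_lower f e : dom f -> 0 < e -> exists2 d, 0 < d &
  forall g, D g -> n (g - f) < d -> a0 f - e <= b g g.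
Proof.
move=> /rdom_sup hs e0; have [m [d d0 hd] am] := sup_adherent e0 hs.
by exists d => // g Dg ng; rewrite (le_trans (ltW am))// hd.
Qed.

Lemma relax_upper f e : dom f -> 0 < e -> exists g,
  [/\ D g, n (g - f) < e & b g g < a0 f + e].
Proof.
move=> df e0; apply: contrapT => h.
have : a0 f + e <= a0 f.
  apply: sup_upper_bound; first exact: rdom_sup.
  exists e => // g Dg ng; rewrite leNgt; apply/negP => bg; apply: h.
  by exists g.
by rewrite gerDl leNgt e0.
Qed.

Lemma relax_ge0 f : dom f -> 0 <= a0 f.
Proof.
move=> df; apply: sup_upper_bound; first exact: rdom_sup.
by exists 1 => // g Dg _; exact: (bil_ge0 H).
Qed.

Lemma rdom_amb f : dom f -> L f. Proof. by case. Qed.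

(** The energy excess may shrink together with the distance: approximants at precision [min e e']
    have energy at most [M + e] whatever [e'] is, so the relaxation is at most [M + e] for every
    [e]. *)
Lemma rdomP f M : L f ->
  (forall e, 0 < e -> exists g, [/\ D g, n (g - f) < e & b g g <= M + e]) ->
  dom f /\ a0 f <= M.
Proof.
move=> Lf HM.
have HM' e : 0 < e -> forall e', 0 < e' ->
    exists g, [/\ D g, n (g - f) < e' & b g g <= M + e].
  move=> e0 e' e'0.
  have : 0 < Num.min e e' by rewrite lt_min e0.
  move=> /HM[g [Dg ng bg]]; exists g; split=> //.
    by rewrite (lt_le_trans ng)// ge_min lexx orbT.
  by rewrite (le_trans bg)// lerD2l ge_min lexx.
split; first by split=> //; exists (M + 1); exact: HM'.
apply/ler_addgt0Pr => e e0.
by have [] := relax_bounds (HM' _ e0).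
Qed.

Lemma dom_rdom f : D f -> dom f /\ a0 f <= b f f.
Proof.
move=> Df; apply: rdomP => [|e e0]; first exact: DL.
by exists f; rewrite subrr amb_norm0; split=> //; rewrite lerDl ltW.
Qed.

Lemma minseq_exists f : dom f -> exists u, minseq f u.
Proof.
move=> df.
have : forall k : nat, exists g,
    [/\ D g, n (g - f) < k.+1%:R^-1 & b g g < a0 f + k.+1%:R^-1].
  by move=> k; apply: relax_upper => //; rewrite invr_gt0 ltr0n.
move=> /choice[u hu]; exists u.
have nu : n (u k - f) @[k --> \oo] --> (0 : R).
  apply: (@squeeze_cvgr _ _ _ _ (fun=> 0) (fun k => k.+1%:R^-1)).
  - by apply: nearW => k; rewrite (amb_norm_ge0 H) ltW//; case: (hu k).
  - exact: cvg_cst.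
  - exact: cvg_harmonic.
split=> //; first by move=> k; case: (hu k).
apply/cvgrPdist_le => e e0.
have [d d0 hd] := relax_lower df e0.
have /cvgrPdist_lt/(_ _ d0) nud := nu.
have /cvgrPdist_lt/(_ _ e0) hh := @cvg_harmonic R.
near=> k.
have [Dk _ bk] := hu k.
have h1 : a0 f - e <= b (u k) (u k).
  apply: hd => //; near: k; move: nud; apply: filterS => k.
  by rewrite sub0r normrN; apply: le_lt_trans; exact: ler_norm.
have h2 : k.+1%:R^-1 < e.
  near: k; move: hh; apply: filterS => k.
  by rewrite sub0r normrN; apply: le_lt_trans; exact: ler_norm.
have bk' : b (u k) (u k) < a0 f + e by apply: (lt_trans bk); rewrite ltrD2l.
rewrite ler_distl; apply/andP; split; first by rewrite lerBlDr ltW.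
by rewrite -lerBlDr.
Unshelve. all: by end_near. Qed.

Lemma minseq_cvg_rdom f u : L f -> (forall k, D (u k)) ->
  n (u k - f) @[k --> \oo] --> (0 : R) ->
  (exists M, forall k, b (u k) (u k) <= M) -> dom f.
Proof.
move=> Lf Du nu [M hM]; split=> //; exists M => e e0.
have /cvgrPdist_lt/(_ _ e0)[N _ hN] := nu.
exists (u N); split=> //.
by have := hN N (leqnn _); rewrite /= sub0r normrN; apply: le_lt_trans; exact: ler_norm.
Qed.

(* Near-minimizers are almost orthogonal to elements of small norm and bounded
   energy: perturbing by such elements cannot lower the energy much. *)
Lemma relax_orth f M e : dom f -> 0 <= M -> 0 < e -> exists2 d, 0 < d &
  forall g z, D g -> n (g - f) < d -> b g g < a0 f + d ->
    D z -> n z < d -> b z z <= M -> `|b g z| <= e.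
Proof.
move=> df M0 e0.
(* The test element is [g] moved by [t * s] along [z], with [s] a sign. Its energy differs from that
   of [g] by [2 * t * s * b z g] plus at most [t * e], because [t * M <= e]; the slack [r], used
   once below and once above [a0 f], contributes another [t * e]. *)
pose t := e / (M + 1).
have M1 : 0 < M + 1 by rewrite ltr_wpDl.
have t0 : 0 < t by rewrite divr_gt0.
pose r := t * e / 2.
have r0 : 0 < r by rewrite divr_gt0// mulr_gt0.
have [d1 d10 hd1] := relax_lower df r0.
exists (Num.min r (Num.min (d1 / 2) (d1 / 2 / t))).
  by rewrite !lt_min r0 !divr_gt0.
move=> g z Dg; rewrite !lt_min => /and3P[_ ng _].
have mr : Num.min r (Num.min (d1 / 2) (d1 / 2 / t)) <= r by rewrite ge_min lexx.
move=> bg Dz /and3P[_ _ nz] bz.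
have bg' : b g g < a0 f + r by rewrite (lt_le_trans bg)// lerD2l.
have key s : `|s| = 1 -> - (s * b z g) <= e.
  move=> s1.
  have Lf := rdom_amb df.
  have h : a0 f - r <= b ((t * s) *: z + g) ((t * s) *: z + g).
    apply: hd1; first exact: (dom_lin H).
    rewrite -addrA; apply: (le_lt_trans (amb_normD H _ _)).
      by apply: ambZ; exact: DL.
      by apply: ambB => //; exact: DL.
    rewrite (amb_normZ H); last exact: DL.
    rewrite normrM s1 mulr1 gtr0_norm//.
    have : t * n z < d1 / 2 by rewrite mulrC -ltr_pdivlMr.
    by lra.
  rewrite bil_sqr// in h.
  have ss : s ^+ 2 = 1 by rewrite -(ger0_norm (sqr_ge0 s)) normrX s1 expr1n.
  rewrite exprMn ss mulr1 in h.
  have h1 : t ^+ 2 * b z z <= t * e.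
    rewrite expr2 -mulrA ler_pM2l//.
    apply: (@le_trans _ _ (t * M)); first by rewrite ler_pM2l.
    by rewrite /t mulrAC ler_pdivrMr// ler_pM2l// lerDl.
  have h2 : t * (- (s * b z g)) <= t * e.
    by rewrite /r in h bg'; nra.
  by rewrite ler_pM2l in h2.
rewrite (bil_sym H Dg Dz) ler_norml; apply/andP; split.
  by have := key 1 (normr1 _); rewrite mul1r lerNl.
by have := key (-1) (normrN1 _); rewrite mulN1r opprK.
Qed.

Lemma minseq_near f u d : minseq f u -> 0 < d ->
  \forall k \near \oo, n (u k - f) < d /\ b (u k) (u k) < a0 f + d.
Proof.
move=> [Du nu bu] d0.
have /cvgrPdist_lt/(_ _ d0) nud := nu.
have /cvgrPdist_lt/(_ _ d0) bud := bu.
near=> k; split.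
  near: k; move: nud; apply: filterS => k.
  by rewrite sub0r normrN; apply: le_lt_trans; exact: ler_norm.
near: k; move: bud; apply: filterS => k.
by rewrite distrC ltr_distl => /andP[].
Unshelve. all: by end_near. Qed.

Lemma minseq_orth f u z M : dom f -> minseq f u -> (forall k, D (z k)) ->
  n (z k) @[k --> \oo] --> (0 : R) -> (forall k, b (z k) (z k) <= M) ->
  b (u k) (z k) @[k --> \oo] --> (0 : R).
Proof.
move=> df mu Dz nz bz.
have M0 : 0 <= M by rewrite (le_trans _ (bz 0%N))// (bil_ge0 H).
apply/cvgrPdist_le => e e0.
have [d d0 hd] := relax_orth df M0 e0.
have /cvgrPdist_lt/(_ _ d0) nzd := nz.
have mud := minseq_near mu d0.
near=> k; rewrite sub0r normrN.
have [h1 h2] : n (u k - f) < d /\ b (u k) (u k) < a0 f + d by near: k.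
apply: hd => //; first by case: mu.
near: k; move: nzd; apply: filterS => k.
by rewrite sub0r normrN; apply: le_lt_trans; exact: ler_norm.
Unshelve. all: by end_near. Qed.

Lemma cvg_bounded_above (x : nat -> R) (l : R) : x @ \oo --> l ->
  exists M, forall k, x k <= M.
Proof.
move=> /cvgP/cvg_seq_bounded[M [_ hM]].
exists (M + 1) => k; apply: le_trans (ler_norm _) _.
by apply: (hM (M + 1)) => //; rewrite ltrDl.
Qed.

Lemma minseq_bounded f u : minseq f u -> exists M, forall k, b (u k) (u k) <= M.
Proof. by case=> _ _ /cvg_bounded_above. Qed.

Lemma norm_cvg_lin a f g u v : L f -> L g -> (forall k, L (u k)) ->
  (forall k, L (v k)) -> n (u k - f) @[k --> \oo] --> (0 : R) ->
  n (v k - g) @[k --> \oo] --> (0 : R) ->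
  n (a *: u k + v k - (a *: f + g)) @[k --> \oo] --> (0 : R).
Proof.
move=> Lf Lg Lu Lv nu nv.
apply: (@squeeze_cvgr _ _ _ _ (fun=> 0)
  (fun k => `|a| * n (u k - f) + n (v k - g))); last 2 first.
- exact: cvg_cst.
- rewrite -[X in _ --> X](_ : `|a| * 0 + 0 = 0); last by rewrite mulr0 addr0.
  by apply: cvgD => //; apply: cvgMl_tmp.
apply: nearW => k; rewrite (amb_norm_ge0 H)/=.
rewrite opprD addrACA -scalerBr.
rewrite -(amb_normZ H); last exact: ambB.
by apply: (amb_normD H); [apply: ambZ|]; exact: ambB.
Qed.

Lemma bil_parallelogram x y : D x -> D y -> b (x + y) (x + y) + b (x - y) (x - y) =
  2 * b x x + 2 * b y y.
Proof.
move=> Dx Dy; rewrite -[x]scale1r bil_sqr//.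
rewrite (_ : 1 *: x - y = 1 *: x + (-1) *: y); last by rewrite scaleN1r.
by rewrite bil_sqr// !bilZl ?bilZr//; ring.
Qed.

Lemma bil_bound_lin a x y : D x -> D y ->
  b (a *: x + y) (a *: x + y) <= 2 * a ^+ 2 * b x x + 2 * b y y.
Proof.
move=> Dx Dy; have := bil_parallelogram (domZ a Dx) Dy.
have := bil_ge0 H (domB (domZ a Dx) Dy).
by rewrite bilZl ?bilZr// => h1 h2; nra.
Qed.

(** Compare [w = a *: u + v] with a genuine minimizing sequence [x] of [a *: f + g]. The difference
    [z = w - x] tends to 0 in norm with bounded energy, hence is asymptotically orthogonal to [x],
    [u] and [v], and [b w w - b x x = b w z + b x z] tends to 0. *)
Lemma minseq_lin a f g u v : dom f -> dom g -> minseq f u -> minseq g v ->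
  dom (a *: f + g) /\ minseq (a *: f + g) (fun k => a *: u k + v k).
Proof.
move=> df dg mu mv.
have [Du nu bu] := mu; have [Dv nv bv] := mv.
pose w k := a *: u k + v k.
have Lf := rdom_amb df; have Lg := rdom_amb dg.
have Dw k : D (w k) by exact: (dom_lin H).
have nw : n (w k - (a *: f + g)) @[k --> \oo] --> (0 : R).
  by apply: norm_cvg_lin => // k; exact: DL.
have [Mu hMu] := minseq_bounded mu; have [Mv hMv] := minseq_bounded mv.
have hMw k : b (w k) (w k) <= 2 * a ^+ 2 * Mu + 2 * Mv.
  apply: (le_trans (bil_bound_lin _ _ _)) => //.
  by apply: lerD; rewrite ler_wpM2l// mulr_ge0// sqr_ge0.
have Lfg : L (a *: f + g) by exact: (amb_lin H).
have dfg : dom (a *: f + g) by apply: minseq_cvg_rdom nw _ => //; exists (2 * a ^+ 2 * Mu + 2 * Mv).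
split=> //; split=> //.
have [x mx] := minseq_exists dfg; have [Dx nx bx] := mx.
have [Mx hMx] := minseq_bounded mx.
pose z k := -1 *: x k + w k.
have Dz k : D (z k) by exact: (dom_lin H).
have nz : n (z k) @[k --> \oo] --> (0 : R).
  have := norm_cvg_lin (-1) Lfg Lfg (fun k => DL (Dx k)) (fun k => DL (Dw k)) nx nw.
  by apply: cvg_trans; apply: near_eq_cvg; apply: nearW => k; rewrite /z scaleN1r scaleN1r addNr subr0.
have bz k : b (z k) (z k) <= 2 * (-1) ^+ 2 * Mx + 2 * (2 * a ^+ 2 * Mu + 2 * Mv).
  apply: (le_trans (bil_bound_lin _ _ _)) => //.
  by apply: lerD; rewrite ler_wpM2l// mulr_ge0// sqr_ge0.
have xz := minseq_orth dfg mx Dz nz bz.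
have uz := minseq_orth df mu Dz nz bz.
have vz := minseq_orth dg mv Dz nz bz.
have wz : b (w k) (z k) @[k --> \oo] --> (0 : R).
  rewrite -[X in _ --> X](_ : a * 0 + 0 = 0); last by rewrite mulr0 addr0.
  rewrite (_ : (fun k => b (w k) (z k)) = (fun k => a * b (u k) (z k) + b (v k) (z k))).
    by apply: cvgD => //; apply: cvgMl_tmp.
  by apply/funext => k; rewrite (bil_lin H).
rewrite (_ : (fun k => b _ _) = (fun k => b (x k) (x k) + (b (w k) (z k) + b (x k) (z k)))).
  rewrite -[X in _ --> X]addr0 -[X in _ + X](addr0 0).
  by apply: cvgD => //; apply: cvgD.
apply/funext => k; rewrite -/(w k).
have -> : z k = w k - x k by rewrite /z scaleN1r addrC.
have {}Dw := Dw k; have {}Dx := Dx k.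
by rewrite !bilBr// (bil_sym H Dw Dx); ring.
Qed.

Lemma rdom_lin a f g : dom f -> dom g -> dom (a *: f + g).
Proof.
move=> df dg; have [u mu] := minseq_exists df; have [v mv] := minseq_exists dg.
by have [] := minseq_lin a df dg mu mv.
Qed.

Lemma rdom0 : dom 0. Proof. by have [] := dom_rdom (dom0 H). Qed.

(** Sums and differences of minimizing sequences are minimizing, so the polarization identity passes
    to the limit. Bilinearity of [b0] is then inherited from [b]. *)
Lemma relax_bil_cvg f g u v : dom f -> dom g -> minseq f u -> minseq g v ->
  b (u k) (v k) @[k --> \oo] --> b0 f g.
Proof.
move=> df dg mu mv.
have [_ [_ _ h1]] := minseq_lin 1 df dg mu mv.
have [_ [_ _ h2]] := minseq_lin (-1) dg df mv mu.
rewrite !scale1r in h1; rewrite scaleN1r addrC in h2.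
rewrite /relax_bil.
rewrite (_ : (fun k => b (u k) (v k)) = (fun k =>
  (b (1 *: u k + v k) (1 *: u k + v k) - b (-1 *: v k + u k) (-1 *: v k + u k)) / 4)).
  by apply: cvgMr_tmp; apply: cvgB.
have [Du _ _] := mu; have [Dv _ _] := mv.
apply/funext => k; rewrite !bil_sqr// (bil_sym H (Dv k) (Du k)).
by field.
Qed.

Lemma cvg_lim_eq (x : nat -> R) (l1 l2 : R) :
  x @ \oo --> l1 -> x @ \oo --> l2 -> l1 = l2.
Proof. by move=> h1 h2; rewrite -(cvg_lim _ h1)// -(cvg_lim _ h2). Qed.

Lemma relax_bil_diag f : dom f -> b0 f f = a0 f.
Proof.
move=> df; have [u mu] := minseq_exists df.
have h := relax_bil_cvg df df mu mu; have [_ _ h'] := mu.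
exact: cvg_lim_eq h h'.
Qed.

Lemma relax_semi_inner : semi_inner L dom n b0.
Proof.
split.
- exact: (amb_lin H).
- exact: (amb_norm_ge0 H).
- exact: (amb_normD H).
- exact: (amb_normZ H).
- exact: rdom_amb.
- exact: rdom0.
- exact: rdom_lin.
- move=> a f g h df dg dh.
  have [u mu] := minseq_exists df; have [v mv] := minseq_exists dg.
  have [w mw] := minseq_exists dh.
  have [dfg mfg] := minseq_lin a df dg mu mv.
  apply: cvg_lim_eq (relax_bil_cvg dfg dh mfg mw) _.
  have [Du _ _] := mu; have [Dv _ _] := mv; have [Dw _ _] := mw.
  rewrite (_ : (fun k => _) = (fun k => a * b (u k) (w k) + b (v k) (w k))).
    by apply: cvgD; [apply: cvgMl_tmp|]; exact: relax_bil_cvg.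
  by apply/funext => k; rewrite (bil_lin H).
- move=> f g df dg.
  have [u mu] := minseq_exists df; have [v mv] := minseq_exists dg.
  apply: cvg_lim_eq (relax_bil_cvg df dg mu mv) _.
  rewrite (_ : (fun k => _) = (fun k => b (v k) (u k))); first exact: relax_bil_cvg.
  have [Du _ _] := mu; have [Dv _ _] := mv.
  by apply/funext => k; rewrite (bil_sym H).
- by move=> f df; rewrite relax_bil_diag//; exact: relax_ge0.
Qed.

Lemma relax_lsc f M : L f ->
  (forall e, 0 < e -> exists g, [/\ dom g, n (g - f) < e & a0 g <= M + e]) ->
  dom f /\ a0 f <= M.
Proof.
move=> Lf h; apply: rdomP => // e e0.
have e2 : 0 < e / 2 by rewrite divr_gt0.
have [g [dg ng ag]] := h _ e2.
have [x [Dx nx bx]] := relax_upper dg e2.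
exists x; split=> //; last by lra.
apply: (le_lt_trans (amb_norm_dist _ (rdom_amb dg) _)) => //; first exact: DL.
by lra.
Qed.

(** Lower semicontinuity is applied to [u k - u l] as [l] grows, with limit [u k - f]; this bounds
    [a0 (u k - f)] and puts [f = u k - (u k - f)] in the domain. *)
Lemma relax_closed f u : L f -> (forall k, dom (u k)) ->
  n (u k - f) @[k --> \oo] --> (0 : R) ->
  (forall e, 0 < e -> exists N, forall k l, (N <= k)%N -> (N <= l)%N ->
     a0 (u k - u l) < e) ->
  dom f /\ a0 (u k - f) @[k --> \oo] --> (0 : R).
Proof.
move=> Lf du nu cu.
have key e : 0 < e -> exists N, forall k, (N <= k)%N -> dom (u k - f) /\ a0 (u k - f) <= e.
  move=> e0; have [N hN] := cu _ e0; exists N => k Nk.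
  apply: relax_lsc; first by apply: ambB => //; exact/rdom_amb.
  move=> e' e'0; have /cvgrPdist_lt/(_ _ e'0)[N' _ hN'] := nu.
  pose l := maxn N N'; exists (u k - u l); split.
  - by rewrite -scaleN1r addrC; exact: rdom_lin.
  - have := hN' l (leq_maxr _ _); rewrite /= sub0r normrN => h.
    rewrite opprB addrC addrA subrK.
    rewrite (amb_normBC Lf (rdom_amb (du l))).
    by apply: le_lt_trans h; exact: ler_norm.
  - by rewrite (le_trans (ltW (hN _ _ Nk _)))// ?leq_maxl// lerDl ltW.
have [N hN] := key _ (@ltr01 R).
have df : dom f.
  have [+ _] := hN N (leqnn _) => dN.
  by have := rdom_lin (-1) dN (du N); rewrite scaleN1r opprB subrK.
split=> //; apply/cvgrPdist_le => e e0.
have [N' hN'] := key _ e0; exists N' => //= k Nk.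
have [dk ak] := hN' _ Nk.
by rewrite sub0r normrN ger0_norm// relax_ge0.
Qed.

(** The difference [u k - u l] is small in norm and has energy at most [4 * M] by the parallelogram
    law, so both near-minimizers [u k] and [u l] are almost orthogonal to it; subtracting the two
    relations gives its energy. *)
Lemma minseq_cauchy f u : dom f -> minseq f u -> forall e, 0 < e ->
  exists N, forall k l, (N <= k)%N -> (N <= l)%N ->
    b (u k - u l) (u k - u l) < e.
Proof.
move=> df mu e e0.
have [M hM] := minseq_bounded mu; have [Du _ _] := mu.
have M0 : 0 <= M by rewrite (le_trans _ (hM 0%N))// (bil_ge0 H).
have e4 : 0 < e / 4 by rewrite divr_gt0.
have [d d0 hd] := relax_orth df (mulr_ge0 (ler0n R 4) M0) e4.
have d2 : 0 < d / 2 by rewrite divr_gt0.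
have [N _ hN] := minseq_near mu d2.
exists N => k l Nk Nl.
have [nk bk] := hN _ Nk; have [nl bl] := hN _ Nl.
have Lf := rdom_amb df.
have Dz := domB (Du k) (Du l).
have nz : n (u k - u l) < d.
  apply: (le_lt_trans (amb_norm_dist (DL (Du k)) Lf (DL (Du l)))).
  by rewrite (amb_normBC Lf (DL (Du l))); lra.
have bz : b (u k - u l) (u k - u l) <= 4 * M.
  have := bil_parallelogram (Du k) (Du l).
  have := bil_ge0 H (domD (Du k) (Du l)).
  by have := hM k; have := hM l; lra.
have hk : `|b (u k) (u k - u l)| <= e / 4 by apply: hd => //; lra.
have hl : `|b (u l) (u k - u l)| <= e / 4 by apply: hd => //; lra.
rewrite bilBl//.
move: hk hl; rewrite !ler_norml => /andP[_ hk] /andP[hl _].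
by lra.
Qed.

(** The relaxation is at most [b] on [D], so a sequence that is Cauchy for [b] is Cauchy for [a0],
    and closedness supplies the limit. Thus [D] is a core. *)
Lemma minseq_core f u : dom f -> minseq f u ->
  a0 (u k - f) @[k --> \oo] --> (0 : R).
Proof.
move=> df mu; have [Du nu _] := mu.
apply: (proj2 (relax_closed _ _ nu _)) => //.
- exact: rdom_amb.
- by move=> k; exact: (proj1 (dom_rdom _)).
- move=> e e0; have [N hN] := minseq_cauchy df mu e0; exists N => k l Nk Nl.
  by apply: le_lt_trans (hN _ _ Nk Nl); exact: (proj2 (dom_rdom (domB _ _))).
Qed.

End relaxation.

(** * Lebesgue measure on R^n *)

Section lebesgue_rV_theory.
Context {R : realType}.

Lemma measurable_rV_rcons_preimage n (A : set 'rV[R]_n.+1) :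
  measurable A -> measurable (@rV_rcons R n @^-1` A).
Proof.
by move=> mA; rewrite -[X in measurable X]setTI; exact: measurable_rV_rcons.
Qed.

Lemma rV_rcons_forall n (P : R -> Prop) v t :
  (forall i, P (@rV_rcons R n (v, t) ord0 i)) <->
  (forall i, P (v ord0 i)) /\ P t.
Proof.
rewrite /rV_rcons; split=> [h|[hv ht] i]; last first.
  by rewrite mxE; case: unliftP.
split; last by have := h ord_max; rewrite mxE unlift_none.
by move=> i; have := h (lift ord_max i); rewrite mxE liftK.
Qed.

Definition cube n (r : R) : set 'rV[R]_n := [set x | forall i, `|x ord0 i| < r].
Arguments cube : clear implicits.

Lemma measurable_rV_forall n (A : 'I_n -> set (measurableTypeR R)) :
  (forall i, measurable (A i)) ->
  measurable [set x : 'rV[R]_n | forall i, A i (x ord0 i)].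
Proof.
move=> mA; rewrite (_ : [set _ | _] = \bigcap_(i in [set: 'I_n])
    ((fun v : 'rV[R]_n => v ord0 i) @^-1` A i)).
  apply: fin_bigcap_measurable => [|i _]; first exact: finite_finset.
  rewrite -[X in measurable X]setTI.
  exact: (measurable_rV_coord i measurableT (mA i)).
by apply/seteqP; split=> x /= h i; [move=> _|]; apply: h.
Qed.

Lemma measurable_cube n r : measurable (cube n r).
Proof.
rewrite (_ : cube n r = [set x | forall i, `]-r, r[%classic (x ord0 i)]).
  by apply: (@measurable_rV_forall n (fun=> `]-r, r[%classic)) => i; exact: measurable_itv.
by apply/seteqP; split=> x /= h i; have := h i; rewrite /= in_itv/= -ltr_norml.
Qed.

Lemma lebesgue_rV_cube n r : 0 < r ->
  lebesgue_rV n (cube n r) = ((2 * r) ^+ n)%:E.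
Proof.
move=> r0; elim: n => [|n IHn].
  rewrite /= (_ : cube 0 r = setT); first by rewrite diracT expr0.
  by apply/seteqP; split=> // x _ [].
rewrite /= /lebesgue_rVS /pushforward.
rewrite (_ : @rV_rcons R n @^-1` _ = cube n r `*` `]-r, r[%classic); last first.
  apply/seteqP; split=> -[v t] /=.
    by move=> /(@rV_rcons_forall n (fun y => `|y| < r))[hv ht]; split=> //=; rewrite in_itv/= -ltr_norml.
  case=> /= hv; rewrite in_itv/= -ltr_norml => ht.
  exact/(@rV_rcons_forall n (fun y => `|y| < r)).
rewrite product_measure1E//; last exact: measurable_cube.
rewrite IHn exprSr EFinM; congr (_ * _)%E.
have h : @lebesgue_measure R `]-r, r[%classic = (2 * r)%:E.
  by rewrite lebesgue_measure_itv/= lte_fin gtrN// -EFinB opprK mulr_natl.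
exact: h.
Qed.

Lemma lebesgue_rV_sigma_finite n : sigma_finite [set: 'rV[R]_n] (lebesgue_rV n).
Proof.
exists (fun k => cube n k.+1%:R); last first.
  by move=> k; split; [exact: measurable_cube|rewrite lebesgue_rV_cube// ltry].
apply/esym/seteqP; split=> // x _.
pose M := \sum_(i < n) `|x ord0 i|.
exists (Num.truncn M) => //= i.
apply: (@le_lt_trans _ _ M); last exact: Num.Theory.truncnS_gt.
by rewrite /M (bigD1 i)//= lerDl sumr_ge0.
Qed.

(** A synonym that carries the sigma-finiteness required by Tonelli's theorem; [lebfE] identifies it
    with [lebesgue_rV]. *)
Definition lebf n : set 'rV[R]_n -> \bar R := lebesgue_rV n.
Arguments lebf : clear implicits.

HB.instance Definition _ n := Measure.copy (lebf n) (lebesgue_rV n).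

HB.instance Definition _ n := Measure_isSigmaFinite.Build _ _ _ (lebf n)
  (lebesgue_rV_sigma_finite n).

Lemma lebfE n : (lebf n : {measure set 'rV[R]_n -> \bar R}) = lebesgue_rV n.
Proof.
have pack_class (m : {measure set 'rV[R]_n -> \bar R}) :
  Measure.Pack (Measure.class m) = m by case: m.
exact: (pack_class (lebesgue_rV n)).
Qed.

(** The image of Lebesgue measure under the translation agrees with it on half-open intervals, which
    determine it. *)
Lemma lebesgue_measure_shift (a : R) (A : set (measurableTypeR R)) : measurable A ->
  lebesgue_measure ((fun x => x + a) @^-1` A) = lebesgue_measure A.
Proof.
move=> mA.
have mf : measurable_fun [set: measurableTypeR R] (fun x : measurableTypeR R => x + a : measurableTypeR R).
  exact: measurable_funD.
pose nu := pushforward (@lebesgue_measure R) (fun x : measurableTypeR R => x + a : measurableTypeR R).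
apply/esym.
pose mfp : {mfun measurableTypeR R >-> measurableTypeR R} := HB.pack (fun x : measurableTypeR R => x + a : measurableTypeR R) (isMeasurableFun.Build _ _ _ _ _ mf).
apply: (@lebesgue_measure_unique _ (pushforward (@lebesgue_measure R) mfp)) => // X [[u v] _ <-] /=.
rewrite /pushforward /mfp/=.
rewrite (_ : _ @^-1` _ = `]u - a, v - a]%classic); last first.
  by apply/seteqP; split=> x /=; rewrite !in_itv/= ltrBlDr lerBrDr.
rewrite !lebesgue_measure_itv/= !lte_fin ltrD2r.
by case: ifP => // _; rewrite -!EFinB opprB addrA subrK.
Qed.

Lemma measurable_rV_shift n (z : 'rV[R]_n) :
  measurable_fun [set: 'rV[R]_n] (fun x : 'rV[R]_n => x + z).
Proof.
apply: measurable_rVP => i; under eq_fun do rewrite mxE.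
by apply: measurable_funD => //; exact: measurable_rV_coord.
Qed.

Lemma ge0_integral_invariant d (T : measurableType d) (mu : {measure set T -> \bar R})
    (phi : T -> T) (f : T -> \bar R) :
  measurable_fun setT phi ->
  (forall A, measurable A -> mu (phi @^-1` A) = mu A) ->
  measurable_fun setT f -> (forall x, 0 <= f x)%E ->
  (\int[mu]_x f (phi x) = \int[mu]_x f x)%E.
Proof.
move=> mphi inv mf f0.
pose mfp : {mfun T >-> T} := HB.pack phi (isMeasurableFun.Build _ _ _ _ _ mphi).
have := @ge0_integral_pushforward _ _ _ _ _ _ mphi mu setT f measurableT mf (fun _ _ => f0 _).
rewrite preimage_setT => <-.
by apply: (@eq_measure_integral _ _ _ _ _ (pushforward mu mfp)) => A mA _; rewrite -inv.
Qed.

Lemma integral_invariant d (T : measurableType d) (mu : {measure set T -> \bar R})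
    (phi : T -> T) (f : T -> \bar R) :
  measurable_fun setT phi ->
  (forall A, measurable A -> mu (phi @^-1` A) = mu A) ->
  measurable_fun setT f ->
  (\int[mu]_x f (phi x) = \int[mu]_x f x)%E.
Proof.
move=> mphi inv mf; rewrite [LHS]integralE [RHS]integralE.
rewrite -(ge0_integral_invariant mphi inv (measurable_funepos mf))//.
rewrite -(ge0_integral_invariant mphi inv (measurable_funeneg mf))//.
by congr (_ - _)%E; apply: eq_integral => x _; rewrite (funepos_comp, funeneg_comp).
Qed.

Lemma rV_rconsD n (v : 'rV[R]_n) t z :
  @rV_rcons R n (v, t) + z =
  @rV_rcons R n (v + \row_j z ord0 (lift ord_max j), t + z ord0 ord_max).
Proof.
apply/rowP => i; rewrite !mxE.
by case: unliftP => [j ->|->]/=; rewrite ?mxE.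
Qed.

(** Induction on the dimension: the sections are translated in the last coordinate by the
    one-dimensional case, and the integral over the remaining coordinates is invariant by the
    induction hypothesis. *)
Lemma lebesgue_rV_shift n (z : 'rV[R]_n) (A : set 'rV[R]_n) : measurable A ->
  lebesgue_rV n ((fun x : 'rV[R]_n => x + z) @^-1` A) = lebesgue_rV n A.
Proof.
elim: n z A => [|n IHn] z A mA.
  by congr (lebesgue_rV 0 _); apply/seteqP; split=> x /=; rewrite !thinmx0.
rewrite /= /lebesgue_rVS /pushforward /= /product_measure1.
set B := rV_rcons (n:=n) @^-1` A.
have mB : measurable B by exact: measurable_rV_rcons_preimage.
pose z' : 'rV[R]_n := \row_j z ord0 (lift ord_max j).
transitivity (\int[lebesgue_rV n]_x (lebesgue_measure \o xsection B) (x + z')%R)%E.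
  apply: eq_integral => v _ /=.
  rewrite -[RHS](lebesgue_measure_shift (z ord0 ord_max)); last exact: measurable_xsection.
  congr (lebesgue_measure _); apply/seteqP; split=> t;
    rewrite /= !xsectionE /=; by rewrite /B /= rV_rconsD.
apply: (ge0_integral_invariant (measurable_rV_shift z')) => //.
  by move=> C mC; exact: IHn.
exact: measurable_fun_xsection.
Qed.

Lemma lebf_tonelli n (f : 'rV[R]_n * 'rV[R]_n -> \bar R) :
  measurable_fun setT f -> (forall x, 0 <= f x)%E ->
  (\int[lebesgue_rV n]_x \int[lebesgue_rV n]_y f (x, y) =
   \int[lebesgue_rV n]_y \int[lebesgue_rV n]_x f (x, y))%E.
Proof.
move=> mf f0; rewrite -(lebfE n).
exact: (@fubini_tonelli _ _ _ _ _ (lebf n) (lebf n) f mf f0).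
Qed.

Lemma measurable_lebesgue_rV_integral n (f : 'rV[R]_n * 'rV[R]_n -> \bar R) :
  measurable_fun setT f -> (forall x, 0 <= f x)%E ->
  measurable_fun setT (fun x => \int[lebesgue_rV n]_y f (x, y))%E.
Proof.
move=> mf f0; rewrite -(lebfE n).
exact: (@measurable_fun_fubini_tonelli_F _ _ _ _ _ (lebf n) f mf f0).
Qed.

End lebesgue_rV_theory.
Arguments cube {R} n r.

(** * Real square-integrable functions *)

Section l2_theory.
Context {R : realType} {dis : measure_display} {T : measurableType dis}.
Variable mu : {measure set T -> \bar R}.
Implicit Types (f g u v w : T -> R^o) (a : R).

Definition integ f : Prop := mu.-integrable setT (EFin \o f).

Definition l2 f : Prop := f \in Lfun mu 2%:E.

Definition ip f g : R := \int[mu]_x (f x * g x).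

Definition nrm f : R := Num.sqrt (ip f f).

Lemma integ_measurable f : integ f -> measurable_fun setT f.
Proof. by move=> /integrableP[/measurable_EFinP]. Qed.

Lemma integ_lin a f g : integ f -> integ g -> integ (a *: f + g).
Proof.
move=> If Ig; rewrite /integ (_ : _ \o _ = ((fun x => a%:E * (EFin \o f) x) \+ (EFin \o g))%E).
  by apply: integrableD => //; exact: integrableZl.
by apply/funext => x /=; rewrite -EFinM -EFinD.
Qed.

Lemma integ_le f g : measurable_fun setT f -> integ g ->
  (forall x, `|f x| <= `|g x|) -> integ f.
Proof.
move=> mf Ig fg; apply: (le_integrable _ _ _ Ig) => //.
  exact/measurable_EFinP.
by move=> x _; rewrite /= lee_fin.
Qed.

Lemma integ0 : integ 0.
Proof. exact: integrable0. Qed.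

Lemma integD f g : integ f -> integ g -> integ (f + g).
Proof. by move=> If Ig; rewrite -[f]scale1r; exact: integ_lin. Qed.

Lemma integZ a f : integ f -> integ (a *: f).
Proof. by move=> If; rewrite -[_ *: _]addr0; apply: integ_lin => //; exact: integ0. Qed.

Lemma integB f g : integ f -> integ g -> integ (f - g).
Proof. by move=> If Ig; apply: integD => //; rewrite -scaleN1r; exact: integZ. Qed.

Lemma integ_sum I (r : seq I) (F : I -> T -> R^o) :
  (forall i, integ (F i)) -> integ (\sum_(i <- r) F i).
Proof. by move=> h; elim/big_ind : _ => //; [exact: integ0|exact: integD]. Qed.

Lemma RintegralD_integ f g : integ f -> integ g ->
  \int[mu]_x (f x + g x) = \int[mu]_x f x + \int[mu]_x g x.
Proof. by move=> If Ig; rewrite RintegralD. Qed.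

Lemma RintegralZ_integ a f : integ f -> \int[mu]_x (a *: f) x = a * \int[mu]_x f x.
Proof. by move=> If; rewrite -RintegralZl. Qed.

Lemma Rintegral_sum I (r : seq I) (F : I -> T -> R^o) : (forall i, integ (F i)) ->
  \int[mu]_x (\sum_(i <- r) F i x) = \sum_(i <- r) \int[mu]_x F i x.
Proof.
move=> h; elim: r => [|i r IHr].
  rewrite big_nil; under eq_Rintegral do rewrite big_nil.
  by rewrite /Rintegral integral0.
under eq_Rintegral do rewrite big_cons.
rewrite big_cons -IHr -RintegralD//; first exact: h.
have e : (fun x => \sum_(j <- r) F j x) = \sum_(j <- r) F j :> (T -> R^o).
  by apply/funext => x; rewrite fct_sumE.
by have := integ_sum r h; rewrite -e.
Qed.

Lemma ae_eq_Rintegral f g : measurable_fun setT f -> measurable_fun setT g ->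
  {ae mu, forall x, f x = g x} -> \int[mu]_x f x = \int[mu]_x g x.
Proof.
move=> mf mg fg; congr fine; apply: ae_eq_integral => //; try exact/measurable_EFinP.
by apply: filterS fg => x -> _.
Qed.

Lemma ae_integ f g : measurable_fun setT g ->
  {ae mu, forall x, f x = g x} -> integ f -> integ g.
Proof.
move=> mg fg If; apply/integrableP; split; first exact/measurable_EFinP.
move/integrableP : If => [mf]; apply: le_lt_trans.
rewrite le_eqVlt; apply/orP; left; apply/eqP.
apply: ae_eq_integral => //; try exact: measurableT_comp.
  by apply: measurableT_comp => //; exact/measurable_EFinP.
by apply: filterS fg => x /= -> _.
Qed.

Lemma le_ae_Rintegral f g : integ f -> integ g ->
  {ae mu, forall x, f x <= g x} -> \int[mu]_x f x <= \int[mu]_x g x.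
Proof.
move=> If Ig fg.
have mf := integ_measurable If; have mg := integ_measurable Ig.
(* [h] dominates [f] at every point and equals [g] almost everywhere, which reduces the claim to
   monotonicity under a pointwise inequality. *)
pose h : T -> R^o := fun x => Num.max (f x) (g x).
have mh : measurable_fun setT h by exact: measurable_maxr.
have hg : {ae mu, forall x, g x = h x}.
  by apply: filterS fg => x fgx; rewrite /h; apply/esym/max_idPr.
rewrite (ae_eq_Rintegral mg mh hg); apply: le_Rintegral => //.
  exact: ae_integ hg Ig.
by move=> x _; rewrite le_max lexx.
Qed.

Lemma l2P f : l2 f <-> measurable_fun setT f /\ integ (fun x => f x ^+ 2).
Proof.
split.
  move=> lf; split; last exact: Lfun2_integrable_sqr.
  by move: lf; rewrite /l2 inE => /andP[/[!inE]].
move=> [mf /integrableP[_ If]]; rewrite /l2 inE; apply/andP; rewrite !inE; split=> //.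
rewrite /= /finite_norm unlock /Lnorm poweR_lty//.
apply: le_lt_trans If; apply: ge0_le_integral => //.
- by move=> x _; exact: poweR_ge0.
- apply/measurable_EFinP; apply: (measurableT_comp (measurable_powR _)) => //.
  exact: measurableT_comp.
- do 2 apply: measurableT_comp => //; exact: measurable_funX.
- by move=> x _ /=; rewrite lee_fin powR_mulrn// normrX.
Qed.

Lemma l2_measurable f : l2 f -> measurable_fun setT f.
Proof. by move=> /l2P[]. Qed.

Lemma l2_mul f g : l2 f -> l2 g -> integ (fun x => f x * g x).
Proof. by move=> lf lg; apply/Lfun1_integrable; exact: Lfun2_mul_Lfun1. Qed.

Lemma l2_le f g : measurable_fun setT f -> l2 g -> (forall x, `|f x| <= `|g x|) -> l2 f.
Proof.
move=> mf /l2P[mg Ig] fg; apply/l2P; split=> //.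
apply: (integ_le _ Ig); first exact: measurable_funX.
by move=> x; rewrite !normrX lerXn2r// nnegrE.
Qed.

Lemma l2_lin a f g : l2 f -> l2 g -> l2 (a *: f + g).
Proof.
move=> /l2P[mf If] /l2P[mg Ig]; apply/l2P.
have m : measurable_fun setT (a *: f + g).
  by apply: measurable_funD => //; exact: measurable_funM.
split=> //.
have I2 : integ ((2 * a ^+ 2) *: (fun x => f x ^+ 2 : R^o) + 2 *: (fun x => g x ^+ 2 : R^o)).
  by apply: integ_lin => //; exact: integZ.
apply: (integ_le _ I2); first exact: measurable_funX.
move=> x; rewrite fctE /= ger0_norm ?sqr_ge0//.
rewrite (le_trans _ (ler_norm _))//.
suff : 0 <= (a * f x - g x) ^+ 2.
  by rewrite !fctE /= /GRing.scale/=; nra.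
exact: sqr_ge0.
Qed.

Lemma l2_0 : l2 0.
Proof.
apply/l2P; split; first exact: measurable_cst.
rewrite (_ : (fun _ => _) = 0); first exact: integ0.
by apply/funext => x; rewrite /= expr0n.
Qed.

Lemma l2D f g : l2 f -> l2 g -> l2 (f + g).
Proof. by move=> lf lg; rewrite -[f]scale1r; exact: l2_lin. Qed.

Lemma l2Z a f : l2 f -> l2 (a *: f).
Proof. by move=> lf; rewrite -[_ *: _]addr0; apply: l2_lin => //; exact: l2_0. Qed.

Lemma l2N f : l2 f -> l2 (- f).
Proof. by move=> lf; rewrite -scaleN1r; exact: l2Z. Qed.

Lemma l2B f g : l2 f -> l2 g -> l2 (f - g).
Proof. by move=> lf lg; apply: l2D => //; exact: l2N. Qed.

Lemma l2_mul_bounded f g K : measurable_fun setT g -> (forall x, `|g x| <= K) ->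
  l2 f -> l2 (fun x => g x * f x).
Proof.
move=> mg gK lf; apply: (@l2_le _ (K *: f)); last 2 first.
- exact: l2Z.
- move=> x; rewrite /= /GRing.scale/= !normrM ler_wpM2r//.
  by rewrite (le_trans (gK x))// ler_norm.
- by apply: measurable_funM => //; exact: l2_measurable.
Qed.

Lemma ipC f g : ip f g = ip g f.
Proof. by apply: eq_Rintegral => x _; rewrite mulrC. Qed.

Lemma ip_lin a f g h : l2 f -> l2 g -> l2 h -> ip (a *: f + g) h = a * ip f h + ip g h.
Proof.
move=> lf lg lh; rewrite /ip -RintegralZl//; last exact: l2_mul.
rewrite -RintegralD_integ; last 2 first.
- exact: (integZ a (l2_mul lf lh)).
- exact: l2_mul.
by apply: eq_Rintegral => x _; rewrite mulrDl mulrA.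
Qed.

Lemma ipBl f g h : l2 f -> l2 g -> l2 h -> ip (f - g) h = ip f h - ip g h.
Proof.
move=> lf lg lh; have -> : f - g = (-1) *: g + f by rewrite scaleN1r addrC.
by rewrite ip_lin//; ring.
Qed.

Lemma ipBr f g h : l2 f -> l2 g -> l2 h -> ip h (f - g) = ip h f - ip h g.
Proof. by move=> lf lg lh; rewrite !(ipC h) ipBl. Qed.

Lemma ip_ge0 f : 0 <= ip f f.
Proof. by apply: Rintegral_ge0 => x _; rewrite -expr2 sqr_ge0. Qed.

Lemma ip_sqr a f g : l2 f -> l2 g ->
  ip (a *: f + g) (a *: f + g) = a ^+ 2 * ip f f + 2 * a * ip f g + ip g g.
Proof.
move=> lf lg; have lfg := l2_lin a lf lg.
rewrite ip_lin// ![ip _ (_ + _)]ipC !ip_lin// (ipC g f); ring.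
Qed.

Lemma nrm_ge0 f : 0 <= nrm f.
Proof. exact: sqrtr_ge0. Qed.

Lemma nrm_sqr f : nrm f ^+ 2 = ip f f.
Proof. by rewrite sqr_sqrtr// ip_ge0. Qed.

Lemma cauchy_schwarz f g : l2 f -> l2 g -> `|ip f g| <= nrm f * nrm g.
Proof.
move=> lf lg; rewrite -(ler_pXn2r (n := 2))// ?nnegrE ?mulr_ge0 ?nrm_ge0//.
rewrite exprMn !nrm_sqr real_normK ?num_real//.
have key a : 0 <= a ^+ 2 * ip f f + 2 * a * ip f g + ip g g.
  by rewrite -ip_sqr// ip_ge0.
have f0 := ip_ge0 f.
have [f00|fn0] := eqVneq (ip f f) 0.
  have [->|n0] := eqVneq (ip f g) 0; first by rewrite expr0n/= f00 mul0r.
  (* When [ip f f = 0] the quadratic is affine in [a]; this [a] makes it equal to -1, a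
     contradiction. *)
  have := key (- (ip g g + 1) / (2 * ip f g)).
  rewrite f00 mulr0 add0r.
  rewrite (_ : 2 * (- (ip g g + 1) / (2 * ip f g)) * ip f g = - (ip g g + 1)); first by lra.
  by field.
have := key (- ip f g / ip f f).
rewrite (_ : _ + _ + _ = ip g g - ip f g ^+ 2 / ip f f); last by field.
by rewrite subr_ge0 ler_pdivrMr ?lt_neqAle ?f0 1?eq_sym ?fn0// mulrC.
Qed.

Lemma nrmD f g : l2 f -> l2 g -> nrm (f + g) <= nrm f + nrm g.
Proof.
move=> lf lg; rewrite -(ler_pXn2r (n := 2))// ?nnegrE ?addr_ge0 ?nrm_ge0//.
have h := le_trans (ler_norm _) (cauchy_schwarz lf lg).
have := ip_sqr 1 lf lg; rewrite scale1r => e.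
by rewrite nrm_sqr e sqrrD !nrm_sqr; lra.
Qed.

Lemma nrmZ a f : l2 f -> nrm (a *: f) = `|a| * nrm f.
Proof.
move=> lf; rewrite /nrm.
have := ip_sqr a lf l2_0; rewrite addr0 => ->.
have -> : ip f 0 = 0.
  by rewrite /ip; under eq_Rintegral do rewrite mulr0; rewrite /Rintegral integral0.
have -> : ip 0 0 = 0.
  by rewrite /ip; under eq_Rintegral do rewrite mulr0; rewrite /Rintegral integral0.
by rewrite mulr0 !addr0 sqrtrM ?sqr_ge0// sqrtr_sqr.
Qed.

Lemma nrm0 : nrm 0 = 0.
Proof. by rewrite -(scale0r 0) nrmZ ?normr0 ?mul0r//; exact: l2_0. Qed.

Lemma nrmN f : l2 f -> nrm (- f) = nrm f.
Proof. by move=> lf; rewrite -scaleN1r nrmZ// normrN1 mul1r. Qed.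

Lemma nrm_distC f g : l2 f -> l2 g -> nrm (f - g) = nrm (g - f).
Proof. by move=> lf lg; rewrite -nrmN ?opprB//; exact: l2B. Qed.

Lemma nrm_dist f g h : l2 f -> l2 g -> l2 h -> nrm (f - h) <= nrm (f - g) + nrm (g - h).
Proof.
move=> lf lg lh; rewrite (_ : f - h = (f - g) + (g - h)); last by rewrite addrA subrK.
by apply: nrmD; exact: l2B.
Qed.

Lemma le_nrm f g : l2 f -> l2 g -> {ae mu, forall x, `|f x| <= `|g x|} -> nrm f <= nrm g.
Proof.
move=> lf lg fg; rewrite ler_wsqrtr//; apply: le_ae_Rintegral; try exact: l2_mul.
by apply: filterS fg => x h; rewrite -!expr2 -[leLHS]real_normK ?num_real// -[leRHS]real_normK ?num_real// lerXn2r// nnegrE.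
Qed.

Lemma ae_nrm f g : l2 f -> l2 g -> {ae mu, forall x, f x = g x} -> nrm f = nrm g.
Proof.
move=> lf lg fg; congr Num.sqrt; apply: ae_eq_Rintegral.
- by apply: measurable_funM; exact: l2_measurable.
- by apply: measurable_funM; exact: l2_measurable.
- by apply: filterS fg => x ->.
Qed.

Lemma nrm_eq0 f : l2 f -> nrm f = 0 -> {ae mu, forall x, f x = 0}.
Proof.
move=> lf /(congr1 (fun x => x ^+ 2)); rewrite nrm_sqr expr0n/= => h.
have mf := l2_measurable lf.
have m2 : measurable_fun setT (fun x => (f x * f x)%:E).
  by apply/measurable_EFinP; exact: measurable_funM.
have : ae_eq mu setT (fun x => (f x * f x)%:E) (cst 0%E).
  apply/(ae_eq_integral_abs mu measurableT m2).
  rewrite (eq_integral (fun x => (f x * f x)%:E)); last first.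
    by move=> x _; rewrite gee0_abs// lee_fin -expr2 sqr_ge0.
  rewrite -[LHS]fineK ?h//; first by rewrite -[fine _]/(ip f f) h.
  exact: integrable_fin_num (l2_mul lf lf).
apply: filterS => x /(_ Logic.I) [] /eqP.
by rewrite mulf_eq0 orbb => /eqP.
Qed.

Lemma Rintegral_dominated (f_ : nat -> T -> R^o) f g :
  (forall k, measurable_fun setT (f_ k)) -> measurable_fun setT f ->
  integ g -> {ae mu, forall x, f_ k x @[k --> \oo] --> f x} ->
  (forall k x, `|f_ k x| <= g x) ->
  integ f /\ \int[mu]_x f_ k x @[k --> \oo] --> \int[mu]_x f x.
Proof.
move=> mf_ mf Ig f_f f_g.
have mE k : measurable_fun setT (EFin \o f_ k) by exact/measurable_EFinP.
have mE' : measurable_fun setT (EFin \o f) by exact/measurable_EFinP.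
have cE : {ae mu, forall x, setT x -> (EFin \o f_ k) x @[k --> \oo] --> (EFin \o f) x}.
  by apply: filterS f_f => x h _; apply: cvg_EFin => //; exact: nearW.
have [If _ h] := @dominated_convergence _ _ _ mu setT measurableT
  _ _ _ mE mE' cE Ig (aeW _ (fun x k _ => f_g k x)).
split=> //; apply: fine_cvg; rewrite fineK//; exact: integrable_fin_num If.
Qed.

Lemma nrm_dominated (f_ : nat -> T -> R^o) f g :
  (forall k, measurable_fun setT (f_ k)) -> l2 f ->
  l2 g -> {ae mu, forall x, f_ k x @[k --> \oo] --> f x} ->
  (forall k x, `|f_ k x| <= `|g x|) ->
  nrm (f_ k - f) @[k --> \oo] --> (0 : R).
Proof.
move=> mf_ lf lg f_f f_g.
have lf_ k : l2 (f_ k) by exact: l2_le (f_g k).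
have Ig : integ (2 *: (fun x => g x ^+ 2 : R^o) + 2 *: (fun x => f x ^+ 2 : R^o)).
  by apply: integ_lin; [|apply: integZ]; [move: lg => /l2P[]|move: lf => /l2P[]].
have := @Rintegral_dominated (fun k x => (f_ k x - f x) * (f_ k x - f x)) 0 _ _ _ Ig _ _.
have -> : \int[mu]_x (0 : T -> R^o) x = 0 by rewrite /Rintegral integral0.
case.
- by move=> k; apply: measurable_funM; apply: measurable_funB => //; exact: l2_measurable.
- exact: measurable_cst.
- apply: filterS f_f => x h; rewrite -[X in _ --> X](mulr0 0).
  by apply: cvgM; apply/subr_cvg0.
- move=> k x; rewrite ger0_norm -?expr2 ?sqr_ge0//.
  rewrite -[leRHS]/(2 * g x ^+ 2 + 2 * f x ^+ 2).
  have := f_g k x; rewrite -(ler_pXn2r (n := 2)) ?nnegrE// !real_normK ?num_real//.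
  by have := sqr_ge0 (f_ k x + f x); nra.
move=> _ h; rewrite -[X in _ --> X]sqrtr0.
exact: (continuous_cvg _ (@sqrt_continuous _ _) h).
Qed.

Lemma cvg_ip (f_ g_ : nat -> T -> R^o) f g : l2 f -> l2 g ->
  (forall k, l2 (f_ k)) -> (forall k, l2 (g_ k)) ->
  nrm (f_ k - f) @[k --> \oo] --> (0 : R) -> nrm (g_ k - g) @[k --> \oo] --> (0 : R) ->
  ip (f_ k) (g_ k) @[k --> \oo] --> ip f g.
Proof.
move=> lf lg lf_ lg_ hf hg.
apply/subr_cvg0; apply/cvgr0Pnorm_le => e e0 /=.
suff : (fun k => nrm (f_ k - f) * (nrm (g_ k - g) + nrm g) + nrm f * nrm (g_ k - g)) @ \oo --> (0 : R).
  move=> /cvgr0Pnorm_le/(_ _ e0); apply: filterS => k; apply: le_trans.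
  rewrite (le_trans _ (ler_norm _))//.
  have -> : ip (f_ k) (g_ k) - ip f g = ip (f_ k - f) (g_ k) + ip f (g_ k - g).
    by rewrite ipBl// ipBr//; ring.
  rewrite (le_trans (ler_normD _ _))// lerD//; last by rewrite cauchy_schwarz//; exact: l2B.
  rewrite (le_trans (cauchy_schwarz _ _))//; first exact: l2B.
  rewrite ler_wpM2l ?nrm_ge0//.
  by rewrite -[X in nrm X <= _](subrK g) nrmD//; exact: l2B.
rewrite -[X in _ --> X](_ : 0 * (0 + nrm g) + nrm f * 0 = 0); last by rewrite mul0r mulr0 addr0.
apply: cvgD; last by apply: cvgMl_tmp.
by apply: cvgM => //; apply: cvgD => //; exact: cvg_cst.
Qed.

End l2_theory.

(** * Continuity and directional derivatives on R^d *)

Section rV_analysis.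
Context {R : realType} {d : nat}.
Notation E := 'rV[R]_d.
Notation "'e_ i" := (delta_mx ord0 i : 'rV[R]_d) (at level 8, i at level 2).
Implicit Types (u : E -> R^o) (x y z v : E) (i : 'I_d).

Lemma continuous_cubeP u : continuous u <->
  forall x (e : R), 0 < e -> exists2 r, 0 < r & forall z, cube d r z -> `|u (x + z) - u x| < e.
Proof.
split=> [cu x e e0|h x].
  have /cvgrPdist_lt/(_ _ e0)/nbhs_ballP[r r0 hr] := cu x.
  exists r => // z cz; rewrite distrC; apply: hr; split=> // j i.
  by rewrite /ball /= !mxE ord1 opprD addNKr normrN.
apply/(@cvgrPdist_lt _ _ _ (nbhs x) (nbhs_filter x)) => e e0.
have [r r0 hr] := h x _ e0.
apply/nbhs_ballP; exists r => // y [_ xy].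
have -> : y = x + (y - x) by rewrite addrC subrK.
rewrite distrC; apply: hr => i; rewrite !mxE distrC.
exact: (xy ord0 i).
Qed.

Lemma cube_scale_delta i (t r : R) : `|t| < r -> cube d r (t *: 'e_ i).
Proof.
move=> tr j; rewrite !mxE eqxx /=; case: eqP => _; rewrite ?mulr1 ?mulr0 ?normr0//.
exact: le_lt_trans tr.
Qed.

Let grid (k : nat) (p : {ffun 'I_d -> int}) : E := \row_i ((p i)%:~R / k.+1%:R).

Let cell (k : nat) (p : {ffun 'I_d -> int}) : set E :=
  [set x | forall i, `[(p i)%:~R / k.+1%:R, (p i + 1)%:~R / k.+1%:R[%classic (x ord0 i)].

Let index (k : nat) x : {ffun 'I_d -> int} := [ffun i => Num.floor (x ord0 i * k.+1%:R)].

Let cellP k p x : cell k p x <-> index k x = p.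
Proof.
have k0 : 0 < k.+1%:R :> R by rewrite ltr0n.
split=> [h|<- i].
  apply/ffunP => i; rewrite ffunE; apply: floor_def.
  by have := h i; rewrite /= in_itv/= ler_pdivrMr// ltr_pdivlMr.
rewrite /= in_itv/= ffunE ler_pdivrMr// ltr_pdivlMr//.
exact: floor_itv.
Qed.

(* A continuous function is the pointwise limit of its values at the corners of
   the cells of a grid. *)
Lemma continuous_measurable_rV u : continuous u -> measurable_fun setT u.
Proof.
move=> cu.
apply: (measurable_fun_cvg (h := fun k x => u (grid k (index k x)))) => //.
  move=> k _ B mB; rewrite setTI.
  rewrite (_ : _ @^-1` _ = \bigcup_p
      (cell k p `&` [set _ | B (u (grid k p))])); last first.
    apply/seteqP; split=> x /=.
      by move=> Bx; exists (index k x) => //; split=> //; exact/cellP.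
    by move=> [p _ [/cellP -> ]].
  apply: countable_bigcupT_measurable => [|p]; first exact: countableP.
  apply: measurableI.
    by apply: (@measurable_rV_forall _ _ (fun i => `[(p i)%:~R / k.+1%:R, (p i + 1)%:~R / k.+1%:R[%classic)) => i; exact: measurable_itv.
  have [BB|nB] := pselect (B (u (grid k p))).
    rewrite (_ : [set _ | _] = setT); first exact: measurableT.
    by apply/seteqP; split.
  rewrite (_ : [set _ | _] = set0); first exact: measurable0.
  by apply/seteqP; split.
move=> x _; apply/cvgrPdist_lt => e e0.
have [r r0 hr] := (continuous_cubeP u).1 cu x _ e0.
have /cvgrPdist_lt/(_ _ r0)[N _ hN] := @cvg_harmonic R.
exists N => // k Nk; rewrite distrC.
have -> : grid k (index k x) = x + (grid k (index k x) - x) by rewrite addrC subrK.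
apply: hr => i.
have := (cellP k (index k x) x).2 erefl i.
rewrite /= in_itv/= !mxE intrD mulrDl => /andP[h1 h2].
have := hN k Nk; rewrite /= sub0r normrN => h3.
apply: (le_lt_trans _ (le_lt_trans (ler_norm _) h3)).
by rewrite distrC ger0_norm ?subr_ge0// lerBlDl ltW// -[X in _ + X]mul1r.
Qed.

Lemma derivable_lineE u x v (t : R) :
  (fun h : R => h^-1 *: ((u \o shift (x + t *: v)) (h *: v) - u (x + t *: v))) =
  (fun h : R => h^-1 *: (((fun s : R => u (x + s *: v) : R^o) \o shift t) (h *: (1 : R^o)) - u (x + t *: v))).
Proof.
apply/funext => h /=; congr (_ *: (u _ - _)).
rewrite /= -[h *: 1]/(h * 1) mulr1 scalerDl.
by rewrite [x + (_ + _)]addrCA.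
Qed.

(** Directional derivatives become derivatives on the line, so that the one-variable chain rule and
    mean value theorem apply without total differentiability. *)
Lemma is_derive_line u x v (t : R) l :
  is_derive (x + t *: v) v u l <-> is_derive t 1 (fun s : R => u (x + s *: v)) l.
Proof.
split=> -[h1 h2]; split.
- by move: h1; rewrite /derivable derivable_lineE.
- by move: h2; rewrite /derive derivable_lineE.
- by move: h1; rewrite /derivable derivable_lineE.
- by move: h2; rewrite /derive derivable_lineE.
Qed.

Lemma is_derive_line0 u x v l :
  is_derive x v u l <-> is_derive (0 : R) 1 (fun s : R => u (x + s *: v)) l.
Proof. by rewrite -is_derive_line scale0r addr0. Qed.

Lemma is_derive_rV_comp (F : R -> R) u x v (a b : R) :
  is_derive (u x) 1 F a -> is_derive x v u b -> is_derive x v (F \o u) (a * b).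
Proof.
move=> hF /is_derive_line0 hu; apply/is_derive_line0.
rewrite -[fun s => _]/(F \o (fun s : R => u (x + s *: v))).
by apply: is_derive1_comp; rewrite scale0r addr0.
Qed.

Lemma line_mvt u x v (K t : R) :
  (forall y, derivable u y v) -> (forall y, `|'D_v u y| <= K) ->
  0 < t -> `|u (x + t *: v) - u x| <= K * t.
Proof.
move=> du hK t0.
pose g : R -> R := fun s : R => u (x + s *: v).
have dg (s : R) : is_derive s 1 g ('D_v u (x + s *: v)).
  by apply/is_derive_line; split.
have cg : {within `[0, t], continuous g}.
  by apply: derivable_within_continuous => s _; case: (dg s).
have [c _ ] := MVT t0 (fun s _ => dg s) cg.
rewrite /g scale0r addr0 subr0 => ->.
by rewrite normrM (gtr0_norm t0) ler_pM2r.
Qed.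

Lemma derivable_continuous1 (F : R -> R) (t : R) : derivable F t 1 -> {for t, continuous F}.
Proof. by move=> /derivable1_diffP/differentiable_continuous. Qed.

Lemma continuous_shift_rV u z : continuous u -> continuous (fun x => u (x + z)).
Proof.
move=> /continuous_cubeP cu; apply/continuous_cubeP => x e e0.
have [r r0 hr] := cu (x + z) _ e0; exists r => // y cy.
by rewrite addrAC; exact: hr.
Qed.

Lemma is_derive_shift_rV u z x v l : is_derive (x + z) v u l ->
  is_derive x v (fun y => u (y + z)) l.
Proof.
move=> /is_derive_line0 h; apply/is_derive_line0.
rewrite (_ : (fun s => _) = (fun s : R => u (x + z + s *: v)))//.
by apply/funext => s; rewrite addrAC.
Qed.

(** Writing a derivative as the limit of a sequence of quotients is what yields measurability of
    partial derivatives and allows dominated convergence. *)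
Lemma cvg_harmonic_quotient u x v l : is_derive x v u l ->
  (k.+1%:R * (u (x + k.+1%:R^-1 *: v) - u x)) @[k --> \oo] --> (l : R).
Proof.
move=> [du <-].
have h0 : (forall k : nat, k.+1%:R^-1 != 0 :> R) /\ k.+1%:R^-1 @[k --> \oo] --> (0 : R).
  by split; [move=> k; rewrite invr_neq0|exact: cvg_harmonic].
have /cvgr_dnbhsP/(_ _ h0) := du.
apply: cvg_trans; apply: near_eq_cvg; apply: nearW => k /=.
by rewrite invrK [_ + x]addrC.
Qed.

End rV_analysis.

(** * Compactly supported functions with bounded partial derivatives *)

Section tame_functions.
Context {R : realType} {d : nat}.
Notation E := 'rV[R]_d.
Notation mu := (lebesgue_rV d : {measure set 'rV[R]_d -> \bar R}).
Notation "'e_ i" := (delta_mx ord0 i : 'rV[R]_d) (at level 8, i at level 2).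
Implicit Types (u v w : E -> R^o) (x y z : E) (i : 'I_d) (r K : R).

(** The class lies between compactly supported C^1 functions and compactly supported Lipschitz
    functions. It is stable under composition with differentiable functions of bounded derivative
    vanishing at 0, and contains cut-off mollifications of L_2 functions that have weak partial
    derivatives in L_2. *)
Record tame u : Prop := {
  tame_continuous : continuous u ;
  tame_support : exists r, forall x, ~ cube d r x -> u x = 0 ;
  tame_derivable : forall i x, derivable u x 'e_ i ;
  tame_bounded : exists K, forall x, `|u x| <= K /\ forall i, `|partial i u x| <= K }.

Lemma cubeS r (r' : R) : r <= r' -> cube d r `<=` cube d r'.
Proof. by move=> rr x cx i; exact: lt_le_trans rr. Qed.

Lemma cubeD r (r' : R) x y : cube d r x -> cube d r' y -> cube d (r + r') (x + y).
Proof.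
by move=> cx cy i; rewrite mxE (le_lt_trans (ler_normD _ _))// ltrD.
Qed.

Lemma cubeN r x : cube d r x -> cube d r (- x).
Proof. by move=> cx i; rewrite mxE normrN. Qed.

Lemma cube_exists x : exists2 r, 0 < r & cube d r x.
Proof.
exists (1 + \sum_(i < d) `|x ord0 i|); first by rewrite ltr_wpDr// sumr_ge0.
move=> i; rewrite (bigD1 i)//= addrCA ltrDl ltr_wpDr// sumr_ge0//.
Qed.

Lemma integ_indic_cube r : integ mu (\1_(cube d r) : E -> R).
Proof.
have mc := @measurable_cube R d r.
apply/integrableP; split; first by apply/measurable_EFinP; exact: measurable_indic.
rewrite (eq_integral (EFin \o (\1_(cube d r) : E -> R))); last first.
  by move=> x _; rewrite /= ger0_norm.
rewrite integral_indic// setIT.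
have r1 : 0 < Num.max r 1 by rewrite lt_max ltr01 orbT.
apply: (@le_lt_trans _ _ (mu (cube d (Num.max r 1)))).
  apply: le_measure; rewrite ?inE//; first exact: measurable_cube.
  by apply: cubeS; rewrite le_max lexx.
by rewrite lebesgue_rV_cube// ltry.
Qed.

Lemma bounded_support_integ u r K : measurable_fun setT u ->
  (forall x, ~ cube d r x -> u x = 0) -> (forall x, `|u x| <= K) -> integ mu u.
Proof.
move=> mu_ su bu.
apply: (integ_le mu_ (integZ K (integ_indic_cube r))) => x.
rewrite -[(K *: _) x]/(K * \1_(cube d r) x) indicE.
have [xr|/su ->] := pselect (cube d r x); last by rewrite normr0.
by rewrite mem_set// mulr1 (le_trans (bu x))// ler_norm.
Qed.

Lemma bounded_support_l2 u r K : measurable_fun setT u ->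
  (forall x, ~ cube d r x -> u x = 0) -> (forall x, `|u x| <= K) -> l2 mu u.
Proof.
move=> mu_ su bu; apply/l2P; split=> //.
apply: (@bounded_support_integ _ r (K ^+ 2)).
- exact: measurable_funX.
- by move=> x /su ->; rewrite expr0n.
- move=> x; rewrite normrX lerXn2r// nnegrE// (le_trans _ (bu x))//.
Qed.

(** Turns uniform smallness on a common cube into smallness in L_2; the square root is that of the
    volume of the cube. *)
Lemma bounded_support_nrm u r K : measurable_fun setT u ->
  (forall x, ~ cube d r x -> u x = 0) -> (forall x, `|u x| <= K) -> 0 < r ->
  nrm mu u <= K * Num.sqrt ((2 * r) ^+ d).
Proof.
move=> mu_ su bu r0.
have K0 : 0 <= K by rewrite (le_trans _ (bu 0)).
have mi : measurable_fun setT (\1_(cube d r) : E -> R) by apply: measurable_indic; exact: measurable_cube.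
have li : l2 mu (\1_(cube d r) : E -> R).
  apply: (@bounded_support_l2 _ r 1) => // x.
    by move=> nx; rewrite indicE memNset.
  by rewrite indicE; case: (_ \in _); rewrite ?normr1 ?normr0.
have := @le_nrm _ _ _ mu _ _ (bounded_support_l2 mu_ su bu) (l2Z K li) (aeW _ _).
rewrite nrmZ// ger0_norm// => /(_ _)/le_trans; apply.
  move=> x; rewrite -[(K *: _) x]/(K * \1_(cube d r) x) indicE.
  have [xr|/su ->] := pselect (cube d r x); last by rewrite normr0.
  by rewrite mem_set// mulr1 (le_trans (bu x))// ler_norm.
rewrite ler_wpM2l// /nrm /ip le_eqVlt; apply/orP; left; apply/eqP; congr Num.sqrt.
transitivity (\int[mu]_x (\1_(cube d r) x : R)).
  by apply: eq_Rintegral => x _; rewrite indicE; case: (_ \in _); rewrite ?mulr1 ?mulr0.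
rewrite /Rintegral integral_indic//; last exact: measurable_cube.
by rewrite setIT lebesgue_rV_cube.
Qed.

Lemma tame_measurable u : tame u -> measurable_fun setT u.
Proof. by case=> cu _ _ _; exact: continuous_measurable_rV. Qed.

Lemma tame_l2 u : tame u -> l2 mu u.
Proof.
move=> tu; have [cu [r ur] _ [K uK]] := tu.
apply: (@bounded_support_l2 _ r K) => //; first exact: tame_measurable.
by move=> x; case: (uK x).
Qed.

Lemma tame_is_derive u i x : tame u -> is_derive x 'e_ i u (partial i u x).
Proof. by case=> _ _ du _; split. Qed.

Lemma partial_val u i x l : is_derive x 'e_ i u l -> partial i u x = l.
Proof. by case. Qed.

Lemma cube_step r x i k : ~ cube d (r + 1) x -> ~ cube d r (x + k.+1%:R^-1 *: 'e_ i).
Proof.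
move=> nx cx; apply: nx => j.
have := cx j; rewrite !mxE eqxx /= => h1.
have h2 : `|k.+1%:R^-1 * (j == i)%:R : R| <= 1.
  by case: eqP => _; rewrite ?mulr1 ?mulr0 ?normr0// normfV ger0_norm// invf_le1// ler1n.
have := ler_normB (x ord0 j + k.+1%:R^-1 * (j == i)%:R) (k.+1%:R^-1 * (j == i)%:R).
by rewrite addrK; lra.
Qed.

(** The added 1 is the length of the longest step [k.+1%:R^-1] in the difference quotients: outside
    the larger cube every quotient is 0. *)
Lemma partial_support u i r : (forall x, ~ cube d r x -> u x = 0) ->
  (forall x, derivable u x 'e_ i) ->
  forall x, ~ cube d (r + 1) x -> partial i u x = 0.
Proof.
move=> su du x nx.
have h : is_derive x 'e_ i u (partial i u x) by split.
have := cvg_harmonic_quotient h.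
rewrite (_ : (fun k => _) = (fun=> 0)) => [c|].
  exact: cvg_lim_eq c (cvg_cst _).
have x0 : u x = 0 by apply: su => cx; apply: nx; apply: cubeS cx; rewrite lerDl.
apply/funext => k; rewrite x0 subr0 su ?mulr0//.
exact: cube_step.
Qed.

Lemma partial_measurable u i : measurable_fun setT u ->
  (forall x, derivable u x 'e_ i) -> measurable_fun setT (partial i u : E -> R).
Proof.
move=> mu_ du.
apply: (measurable_fun_cvg (h := fun k x => k.+1%:R * (u (x + k.+1%:R^-1 *: 'e_ i) - u x))) => //.
  move=> k; apply: measurable_funM => //; apply: measurable_funB => //.
  exact: measurableT_comp mu_ (measurable_rV_shift _).
move=> x _; apply: cvg_harmonic_quotient; split=> //.
Qed.

Lemma tame_partial_measurable u i : tame u -> measurable_fun setT (partial i u : E -> R).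
Proof.
by move=> tu; apply: partial_measurable; [exact: tame_measurable|case: tu => _ _ /(_ i)].
Qed.

Lemma tame_partial_support u : tame u ->
  exists r, (forall x, ~ cube d r x -> u x = 0) /\ forall i x, ~ cube d r x -> partial i u x = 0.
Proof.
case=> _ [r ur] du _; exists (r + 1); split=> [x nx|i]; last exact: partial_support.
by apply: ur => cx; apply: nx; apply: cubeS cx; rewrite lerDl.
Qed.

Lemma tame_partial_l2 u i : tame u -> l2 mu (partial i u : E -> R).
Proof.
move=> tu; have [r [_ ur]] := tame_partial_support tu; have [_ _ _ [K uK]] := tu.
apply: (@bounded_support_l2 _ r K); [exact: tame_partial_measurable|exact: ur|].
by move=> x; case: (uK x).
Qed.

Lemma tame_lin (a : R) u v : tame u -> tame v ->
  tame (a *: u + v) /\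
  forall i x, partial i (a *: u + v) x = a * partial i u x + partial i v x.
Proof.
move=> tu tv.
have dl i x : is_derive x 'e_ i (a *: u + v) (a * partial i u x + partial i v x).
  apply: is_deriveD; last exact: tame_is_derive.
  by apply: is_deriveZ; exact: tame_is_derive.
have pl i x : partial i (a *: u + v) x = a * partial i u x + partial i v x.
  exact: partial_val.
split=> //.
have [cu [ru hu] du [Ku uK]] := tu; have [cv [rv hv] dv [Kv vK]] := tv.
split.
- by move=> x; apply: (@continuousD _ _ _ (fun y => a * u y : R^o) v);
    [apply: (@continuousM _ _ (fun=> a) u); [exact: cst_continuous|exact: cu]|exact: cv].
- exists (Num.max ru rv) => x nx.
  rewrite -[LHS]/(a * u x + v x) hu ?hv ?mulr0 ?addr0// => cx; apply: nx;
    by apply: cubeS cx; rewrite le_max lexx ?orbT.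
- by move=> i x; case: (dl i x).
- exists (`|a| * Ku + Kv) => x; split.
    rewrite -[X in `|X|]/(a * u x + v x) (le_trans (ler_normD _ _))// normrM.
    by apply: lerD; [rewrite ler_wpM2l//; case: (uK x)|case: (vK x)].
  move=> i; rewrite pl (le_trans (ler_normD _ _))// normrM.
  by apply: lerD; [rewrite ler_wpM2l//; case: (uK x)|case: (vK x)].
Qed.

Lemma tame_mul u v : tame u -> continuous v -> (forall i x, derivable v x 'e_ i) ->
  (exists K, forall x, `|v x| <= K /\ forall i, `|partial i v x| <= K) ->
  tame (fun x => u x * v x) /\
  forall i x, partial i (fun x => u x * v x) x = partial i u x * v x + u x * partial i v x.
Proof.
move=> tu cv dv [Kv vK].
have dl i x : is_derive x 'e_ i (fun x => u x * v x) (partial i u x * v x + u x * partial i v x).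
  have h1 := tame_is_derive i x tu.
  have h2 : is_derive x 'e_ i v (partial i v x) by split.
  apply: (is_derive_eq (is_deriveM h1 h2)).
  by rewrite /GRing.scale/= addrC [v x * _]mulrC.
have pl i x : partial i (fun x => u x * v x) x = partial i u x * v x + u x * partial i v x.
  exact: partial_val.
split; last exact: pl.
have [cu [ru hu] du [Ku uK]] := tu.
have Ku0 : 0 <= Ku by rewrite (le_trans _ (proj1 (uK 0))).
split.
- by move=> x; apply: (@continuousM _ _ u v); [exact: cu|exact: cv].
- by exists ru => x nx; rewrite hu// mul0r.
- by move=> i x; case: (dl i x).
- exists (2 * (Ku * Kv)) => x.
  have [u1 u2] := uK x; have [v1 v2] := vK x.
  have h : `|u x| * `|v x| <= Ku * Kv by rewrite ler_pM.
  have h0 := mulr_ge0 (normr_ge0 (u x)) (normr_ge0 (v x)).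
  split; first by rewrite normrM; lra.
  move=> i; rewrite pl (le_trans (ler_normD _ _))// !normrM mulr_natl mulr2n.
  by apply: lerD; rewrite ler_pM.
Qed.

(** The bound on [F] by [K * |t|] forces [F 0 = 0], which preserves the compact support. *)
Lemma tame_comp (F F' : R -> R) u K : tame u -> (forall t : R, is_derive t 1 F (F' t)) ->
  (forall t, `|F t| <= K * `|t|) -> (forall t, `|F' t| <= K) ->
  tame (F \o u) /\ forall i x, partial i (F \o u) x = F' (u x) * partial i u x.
Proof.
move=> tu dF FK F'K.
have K0 : 0 <= K by rewrite (le_trans _ (F'K 0)).
have dl i x : is_derive x 'e_ i (F \o u) (F' (u x) * partial i u x).
  by apply: is_derive_rV_comp; last exact: tame_is_derive.
have pl i x : partial i (F \o u) x = F' (u x) * partial i u x by exact: partial_val.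
split=> //.
have [cu [ru hu] du [Ku uK]] := tu.
split.
- by move=> x; apply: continuous_comp; [exact: cu|apply: derivable_continuous1; case: (dF (u x))].
- exists ru => x nx; rewrite /= hu//.
  by have := FK 0; rewrite normr0 mulr0 normr_le0 => /eqP.
- by move=> i x; case: (dl i x).
- exists (K * Ku) => x; have [u1 u2] := uK x; split.
    by rewrite (le_trans (FK _))// ler_wpM2l.
  by move=> i; rewrite pl normrM ler_pM.
Qed.

Lemma tame0 : tame 0.
Proof.
have d0 i x : is_derive x 'e_ i (0 : E -> R^o) 0 by exact: is_derive_cst.
split.
- exact: cst_continuous.
- by exists 0.
- by move=> i x; case: (d0 i x).
- exists 0 => x; split; first by rewrite normr0.
  by move=> i; rewrite (partial_val (d0 i x)) normr0.
Qed.

Lemma tame_shift u z : tame u -> tame (fun x => u (x + z)) /\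
  forall i x, partial i (fun x => u (x + z)) x = partial i u (x + z).
Proof.
move=> tu.
have dl i x : is_derive x 'e_ i (fun x => u (x + z)) (partial i u (x + z)).
  by apply: is_derive_shift_rV; exact: tame_is_derive.
have pl i x : partial i (fun x => u (x + z)) x = partial i u (x + z) by exact: partial_val.
split=> //.
have [cu [ru hu] du [Ku uK]] := tu.
split.
- exact: continuous_shift_rV.
- have [r r0 cz] := cube_exists z; exists (ru + r) => x nx; apply: hu => cx; apply: nx.
  have -> : x = (x + z) + - z by rewrite addrK.
  by apply: cubeD => //; exact: cubeN.
- by move=> i x; case: (dl i x).
- exists Ku => x; split; first by case: (uK (x + z)).
  by move=> i; rewrite pl; case: (uK (x + z)).
Qed.

Lemma Rintegral_shift (f : E -> R) z : measurable_fun setT f ->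
  \int[mu]_x f (x + z) = \int[mu]_x f x.
Proof.
move=> mf; rewrite /Rintegral; congr fine.
apply: (@integral_invariant _ _ _ mu (fun x => x + z) (EFin \o f)).
- exact: measurable_rV_shift.
- by move=> A mA; exact: lebesgue_rV_shift.
- exact/measurable_EFinP.
Qed.

(* The integral of a difference quotient vanishes by translation invariance. *)
Lemma integral_partial u i : tame u -> \int[mu]_x partial i u x = 0.
Proof.
move=> tu; have [cu [ru hu] du [Ku uK]] := tu.
pose q k x := k.+1%:R * (u (x + k.+1%:R^-1 *: 'e_ i) - u x) : R^o.
have ms k : measurable_fun setT (fun x => u (x + k.+1%:R^-1 *: 'e_ i)).
  exact: measurableT_comp (tame_measurable tu) (measurable_rV_shift _).
have mq k : measurable_fun setT (q k).
  by apply: measurable_funM => //; apply: measurable_funB => //; exact: tame_measurable.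
have Iu : integ mu u.
  by apply: (@bounded_support_integ _ ru Ku) => //; [exact: tame_measurable|move=> x; case: (uK x)].
have Ishift k : integ mu (fun x => u (x + k.+1%:R^-1 *: 'e_ i)).
  apply: (@bounded_support_integ _ (ru + 1) Ku) => //.
    by move=> x nx; apply: hu; exact: cube_step.
  by move=> x; case: (uK (x + k.+1%:R^-1 *: 'e_ i)).
(* The mean value theorem along the i-th direction bounds all quotients by [Ku] on one enlarged
   cube, as dominated convergence requires. *)
have qK k x : `|q k x| <= (Ku *: (\1_(cube d (ru + 1)) : E -> R^o)) x.
  rewrite -[leRHS]/(Ku * \1_(cube d (ru + 1)) x) indicE.
  have [cx|ncx] := pselect (cube d (ru + 1) x).
    rewrite mem_set// mulr1 normrM ger0_norm// mulrC -ler_pdivlMr ?ltr0n//.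
    apply: line_mvt => //.
    by move=> y; case: (uK y) => _ /(_ i).
  rewrite memNset// mulr0 /q hu; last exact: cube_step.
  rewrite hu ?subrr ?mulr0 ?normr0// => cx; apply: ncx.
  by apply: cubeS cx; rewrite lerDl.
have [_] := Rintegral_dominated mq (tame_partial_measurable i tu)
  (integZ Ku (integ_indic_cube _))
  (aeW _ (fun x => cvg_harmonic_quotient (tame_is_derive i x tu))) qK.
rewrite (_ : (fun k => _) = (fun=> 0)).
  by move=> /(cvg_lim_eq (cvg_cst 0))/esym.
apply/funext => k; rewrite RintegralZl//; last exact: integB (Ishift k) Iu.
rewrite (RintegralB measurableT (Ishift k) Iu).
by rewrite Rintegral_shift ?subrr ?mulr0//; exact: tame_measurable.
Qed.

End tame_functions.

(** * Compact supports and smooth bump functions *)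

Section flat_functions.
Context {R : realType}.
Implicit Types (p : {poly R}) (s t : R).

Lemma poly_expR_bound p (k : R) : 0 < k ->
  exists2 C, 0 <= C & forall s, 0 <= s -> `|p.[s]| <= C * expR (k * s).
Proof.
elim/poly_ind: p k => [|p c IHp] k k0.
  by exists 0 => // s _; rewrite horner0 normr0 mul0r.
have k2 : 0 < k / 2 by rewrite divr_gt0.
have [C C0 hC] := IHp _ k2.
exists (C * (2 / k) + `|c|); first by rewrite addr_ge0// mulr_ge0// divr_ge0// ltW.
move=> s s0; rewrite hornerMXaddC (le_trans (ler_normD _ _))// mulrDl.
apply: lerD; last first.
  rewrite ler_peMr// -expR0 ler_expR mulr_ge0// ltW//.
rewrite normrM (ger0_norm s0).
have -> : k * s = k / 2 * s + k / 2 * s by rewrite -mulrDl -splitr.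
rewrite expRD mulrACA; apply: ler_pM => //; first exact: hC.
have h : 2 / k * (k / 2 * s) <= 2 / k * expR (k / 2 * s).
  by rewrite ler_pM2l ?divr_gt0//; have := expR_ge1Dx (k / 2 * s); lra.
by move: h; rewrite mulrA (_ : 2 / k * (k / 2) = 1) ?mul1r//; field; rewrite gt_eqF.
Qed.

(** Cauchy's function exp(-1/t), flat at 0, with a polynomial factor in 1/t. Allowing every
    polynomial makes the family stable under differentiation, so all iterated derivatives are known
    to exist at once. *)
Definition flat p t : R := if 0 < t then p.[t^-1] * expR (- t^-1) else 0.

Lemma flat_le0 p t : t <= 0 -> flat p t = 0.
Proof. by move=> t0; rewrite /flat ltNge t0. Qed.

Lemma flat_bounded p : exists2 C, 0 <= C & forall t, `|flat p t| <= C.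
Proof.
have [C C0 hC] := poly_expR_bound p ltr01.
exists C => // t; rewrite /flat; case: ltP => [t0|_]; last by rewrite normr0.
rewrite normrM (ger0_norm (expR_ge0 _)) expRN ler_pdivrMr ?expR_gt0//.
by have := hC t^-1; rewrite mul1r; apply; rewrite invr_ge0 ltW.
Qed.

Lemma flat_mulX p t : 0 < t -> flat p t = t * flat ('X * p) t.
Proof.
move=> t0; rewrite /flat t0 hornerM hornerX !mulrA divff ?mul1r//.
by rewrite gt_eqF.
Qed.

Lemma is_derive_flat p t : is_derive t 1 (flat p) (flat ('X^2 * (p - p^`())) t).
Proof.
have [t0|t0|->] := ltgtP t 0.
- rewrite flat_le0 ?ltW//.
  apply: (near_eq_is_derive (f := fun=> 0)).
  near=> s; rewrite flat_le0// ltW//; near: s.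
  exact: lt_nbhsl.
- have tn0 : t != 0 by rewrite gt_eqF.
  apply: (near_eq_is_derive (f := fun t => p.[t^-1] * expR (- t^-1))).
    near=> s; rewrite /flat ifT//; near: s.
    exact: lt_nbhsr.
  have hV : is_derive t 1 (fun t : R => t^-1) (- t ^- 2).
    by apply: (is_derive_eq (is_deriveV tn0 (is_derive_id t 1))); rewrite /GRing.scale/= mulr1.
  have h1 : is_derive t 1 (fun t : R => p.[t^-1]) (p^`().[t^-1] * - t ^- 2).
    exact: (is_derive1_comp (is_derive_poly p t^-1) hV).
  have h2 : is_derive t 1 (fun t : R => expR (- t^-1)) (expR (- t^-1) * t ^- 2).
    have hN : is_derive t 1 (fun t : R => - t^-1) (t ^- 2).
      by rewrite -[t ^- 2]opprK; exact: is_deriveN hV.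
    exact: (@is_derive1_comp _ expR (fun t : R => - t^-1) t _ _ (is_derive_expR _) hN).
  apply: (is_derive_eq (is_deriveM h1 h2)).
  rewrite /flat t0 /GRing.scale/= hornerM hornerXn hornerD hornerN exprVn.
  by ring.
- rewrite flat_le0//.
  (* Two powers of [h] are extracted from [flat p h]: one cancels the denominator of the quotient,
     the other makes it tend to 0 against the bound [C]. *)
  have [C C0 hC] := flat_bounded ('X * ('X * p)).
  suff h : h^-1 *: ((flat p \o shift (0 : R)) (h *: (1 : R)) - flat p 0) @[h --> 0^'] --> (0 : R).
    by split; [exact: cvgP h|exact: cvg_lim h].
  apply/cvgr0Pnorm_le => e e0; near=> h.
  have hn0 : h != 0 by near: h; exact: nbhs_dnbhs_neq.
  rewrite /= addr0 [flat p 0]flat_le0// subr0.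
  rewrite -[h *: 1]/(h * 1) mulr1 -[_ *: _]/(h^-1 * flat p h).
  have [h0|h0] := leP h 0; first by rewrite flat_le0// mulr0 normr0 ltW.
  rewrite flat_mulX// mulrA mulVf// mul1r flat_mulX// normrM (gtr0_norm h0).
  apply: (@le_trans _ _ (h * (C + 1))).
    by rewrite ler_pM2l// (le_trans (hC h))// lerDl.
  rewrite -ler_pdivlMr; last by rewrite ltr_wpDl.
  rewrite (le_trans (ler_norm _))//.
  near: h; apply: dnbhs0_le; by rewrite divr_gt0// ltr_wpDl.
Unshelve. all: by end_near. Qed.

Lemma flat1_gt0 t : 0 < t -> 0 < flat 1 t.
Proof. by move=> t0; rewrite /flat t0 hornerC mul1r expR_gt0. Qed.

Lemma flat1_ge0 t : 0 <= flat 1 t.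
Proof. by have [t0|/flat1_gt0/ltW//] := leP t 0; rewrite flat_le0. Qed.

Lemma flat1_le1 t : flat 1 t <= 1.
Proof.
rewrite /flat; case: ltP => // t0.
by rewrite hornerC mul1r expR_le1 oppr_le0 invr_ge0 ltW.
Qed.

(** Each [flat] factor equals exp(-1) at the origin, so the factor exp(2) normalizes the value there
    to 1. *)
Definition bump1 t : R := flat 1 (1 + t) * flat 1 (1 - t) * expR 2.

Lemma bump1_0 : bump1 0 = 1.
Proof.
rewrite /bump1 addr0 subr0 /flat ltr01 hornerC mul1r invr1 -!expRD.
by rewrite (_ : _ + _ + _ = 0) ?expR0//; ring.
Qed.

Lemma bump1_ge0 t : 0 <= bump1 t.
Proof. by rewrite /bump1 !mulr_ge0 ?flat1_ge0 ?expR_ge0. Qed.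

Lemma bump1_eq0 t : 1 <= `|t| -> bump1 t = 0.
Proof.
rewrite ler_normr => /orP[h|h]; rewrite /bump1.
  by rewrite (flat_le0 _ (t := 1 - t)) ?mulr0 ?mul0r//; lra.
by rewrite (flat_le0 _ (t := 1 + t)) ?mulr0 ?mul0r//; lra.
Qed.

End flat_functions.

(** * Compactness in R^d and smooth bumps on cubes *)

Section smooth_bumps.
Context {R : realType} {d : nat}.
Notation E := 'rV[R]_d.
Notation "'e_ i" := (delta_mx ord0 i : 'rV[R]_d) (at level 8, i at level 2).
Implicit Types (u : E -> R^o) (x y z : E) (i : 'I_d) (r s : R).

Lemma coord_norm_bounded (A : set E) : compact A -> exists2 r, 0 < r & A `<=` cube d r.
Proof.
move=> cA.
have h i : exists M : R, forall x, A x -> `|x ord0 i| <= M.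
  have : compact ((fun x : E => x ord0 i) @` A).
    apply: continuous_compact cA; apply: continuous_subspaceT.
    exact: coord_continuous.
  move=> /(@compact_bounded R R^o)[M [_ hM]]; exists (M + 1) => x Ax.
  by apply: (hM (M + 1)); [rewrite ltrDl|exists x].
have [M hM] := choice h.
exists (1 + \sum_i `|M i|); first by rewrite ltr_wpDr// sumr_ge0.
move=> x Ax i; rewrite (le_lt_trans (hM i x Ax))//.
rewrite (bigD1 i)//= (le_lt_trans (ler_norm _))//.
by rewrite addrCA ltrDl ltr_wpDr// sumr_ge0.
Qed.

Definition closed_cube r : set E := [set x | forall i, x ord0 i \in `[- r, r]].

Lemma closed_cube_compact r : compact (closed_cube r).
Proof.
apply: (@rV_compact _ _ (fun=> `[- r, r]%classic)) => _; exact: segment_compact.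
Qed.

Lemma cube_closed_cube r : cube d r `<=` closed_cube r.
Proof. by move=> x cx i; rewrite in_itv/= -ler_norml ltW. Qed.

Lemma closed_closed_cube r : closed (closed_cube r).
Proof.
rewrite (_ : closed_cube r = \bigcap_(i in [set: 'I_d])
    ((fun x : E => x ord0 i) @^-1` `[- r, r]%classic)); last first.
  by apply/seteqP; split=> x /= h i; [move=> _|]; exact: h.
apply: closed_bigI => i _; apply: preimage_closed; last exact: interval_closed.
by move=> x _; exact: coord_continuous.
Qed.

Lemma support_compact (P : set E) r : P `<=` cube d r -> compact (closure P).
Proof.
move=> Pr; apply: (subclosed_compact _ (@closed_cube_compact r)); first exact: closed_closure.
rewrite [X in _ `<=` X](_ : _ = closure (closed_cube r)).
  by apply: closureS; apply: subset_trans Pr _; exact: cube_closed_cube.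
by apply/closure_id; exact: closed_closed_cube.
Qed.

Lemma continuous_vanish_bounded u r : continuous u -> (forall x, ~ cube d r x -> u x = 0) ->
  exists2 K, 0 <= K & forall x, `|u x| <= K.
Proof.
move=> cu su.
have : compact (u @` closed_cube r).
  by apply: continuous_compact (@closed_cube_compact r); exact: continuous_subspaceT.
move=> /(@compact_bounded R R^o)[M [_ hM]].
exists (`|M| + 1); first by rewrite addr_ge0.
move=> x; have [cx|ncx] := pselect (cube d r x); last by rewrite su// normr0 addr_ge0.
apply: (hM (`|M| + 1)); first by rewrite ltr_pwDr// ler_norm.
by exists x => //; exact: cube_closed_cube.
Qed.

(** Compactness of the closed cube of radius [r + 1] gives a uniform [t]. Taking also [t < 1]
    ensures that a point outside this cube stays outside the support after the displacement. *)
Lemma uniformly_continuous u r e : continuous u -> (forall x, ~ cube d r x -> u x = 0) ->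
  0 < e -> exists2 t : R, 0 < t & forall x z, cube d t z -> `|u (x + z) - u x| < e.
Proof.
move=> cu su e0.
have cK := @closed_cube_compact (r + 1).
pose P (t : R) (x : E) := forall z, cube d t z -> `|u (x + z) - u x| < e.
have : \forall t \near (0:R)^'+, closed_cube (r + 1) `<=` P t.
  apply: (proj1 (compact_near_coveringP _) cK) => x _.
  have e2 : 0 < e / 2 by rewrite divr_gt0.
  have [q q0 hq] := (continuous_cubeP u).1 cu x _ e2.
  have q2 : 0 < q / 2 by rewrite divr_gt0.
  exists ([set y | cube d (q / 2) (y - x)], [set t | t < q / 2]).
    split=> /=.
      by apply/nbhs_ballP; exists (q / 2) => // y [_ xy] i; rewrite !mxE distrC; exact: (xy ord0 i).
    exact: nbhs_right_lt.
  move=> [y t] /= [cy tq] z cz.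
  have h1 := hq _ (cubeS (ltW (_ : q / 2 < q)) cy).
  have cz' : cube d (q / 2) z by apply: cubeS cz; exact: ltW.
  have h2 := hq _ (cubeS (_ : q / 2 + q / 2 <= q) (cubeD cy cz')).
  have := h1 (_ : q / 2 < q); have := h2 (_ : q / 2 + q / 2 <= q).
  rewrite addrA ![x + (y - x)]addrC !subrK => {}h2 {}h1.
  have {}h1 : `|u y - u x| < e / 2 by apply: h1; lra.
  have {}h2 : `|u (y + z) - u x| < e / 2 by apply: h2; lra.
  rewrite (_ : u (y + z) - u y = (u (y + z) - u x) - (u y - u x)); last by ring.
  by rewrite (le_lt_trans (ler_normB _ _))//; lra.
move=> h.
have [t [t0 [t1 ht]]] : exists t : R, 0 < t /\ t < 1 /\ closed_cube (r + 1) `<=` P t.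
  near (0:R)^'+ => t; exists t; split; [|split].
  - by near: t; exact: nbhs_right_gt.
  - by near: t; exact: nbhs_right_lt.
  - by near: t.
exists t => // x z cz.
have [cx|ncx] := pselect (closed_cube (r + 1) x); first exact: ht.
have nc : ~ cube d (r + 1) x by move=> /cube_closed_cube.
rewrite (su x); last by move=> cx; apply: nc; apply: cubeS cx; rewrite lerDl.
rewrite su ?subrr ?normr0// => cxz; apply: nc.
rewrite (_ : x = (x + z) + - z); last by rewrite addrK.
by apply: cubeD => //; apply: cubeN; apply: cubeS cz; exact: ltW.
Unshelve. all: by end_near. Qed.

Lemma test_function_tame (eta : E -> R) : test_function eta -> tame eta.
Proof.
move=> [seta ceta].
have [ce de] := seta [::].
have [r r0 hr] := coord_norm_bounded ceta.
have se x : ~ cube d r x -> eta x = 0.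
  move=> nx; apply/eqP; apply: contrapT => /negP ex; apply: nx; apply: hr.
  exact: subset_closure.
have [K K0 hK] := continuous_vanish_bounded ce se.
have hp i : exists M : R, 0 <= M /\ forall x, `|partial i eta x| <= M.
  have [cp _] := seta [:: i].
  have [M M0 hM] := continuous_vanish_bounded cp (partial_support se (de i)).
  by exists M.
have [M hM] := choice hp.
split=> //; first by exists r.
exists (K + \sum_i M i) => x; split.
  by rewrite (le_trans (hK x))// lerDl sumr_ge0// => i _; case: (hM i).
move=> i; have [_ h] := hM i; rewrite (le_trans (h x))// (bigD1 i)//= addrCA lerDl.
by rewrite addr_ge0// sumr_ge0// => j _; case: (hM j).
Qed.

(** A syntactic class stable under partial derivatives: C^oo regularity of the bumps follows by
    structural induction, with no formula for iterated derivatives. *)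
Inductive smooth_gen : (E -> R) -> Prop :=
| smooth_cst (c : R) : smooth_gen (fun=> c)
| smooth_flat (p : {poly R}) (s a : R) i : smooth_gen (fun x => flat p (s * x ord0 i + a))
| smooth_mul (f g : E -> R) : smooth_gen f -> smooth_gen g -> smooth_gen (fun x => f x * g x)
| smooth_add (f g : E -> R) : smooth_gen f -> smooth_gen g -> smooth_gen (fun x => f x + g x).

Lemma smooth_gen_continuous (f : E -> R) : smooth_gen f -> continuous f.
Proof.
elim=> [c|p s a i|{}f g _ cf _ cg|{}f g _ cf _ cg].
- exact: cst_continuous.
- move=> x; apply: (@continuous_comp _ _ _ (fun x : E => s * x ord0 i + a) (flat p)).
    apply: (@continuousD _ _ _ (fun x : E => s * x ord0 i : R^o) (fun=> a : R^o)); last exact: cst_continuous.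
    by apply: (@continuousM _ _ (fun=> s) (fun x : E => x ord0 i)); [exact: cst_continuous|exact: coord_continuous].
  by apply: derivable_continuous1; case: (is_derive_flat p (s * x ord0 i + a)).
- by move=> x; apply: (@continuousM _ _ f g); [exact: cf|exact: cg].
- by move=> x; apply: (@continuousD _ _ _ (f : E -> R^o) g); [exact: cf|exact: cg].
Qed.

Lemma is_derive_affine (A B : R) : is_derive (0 : R) 1 (fun t : R => A * t + B) A.
Proof.
have h1 : is_derive (0 : R) 1 (fun t : R => A * t) A.
  apply: (is_derive_eq (@is_deriveZ R R^o R^o id A (0 : R) 1 1 _)).
  by rewrite -[_ *: _]/(_ * 1) mulr1.
apply: (is_derive_eq (@is_deriveD R R^o R^o (fun t : R => A * t) (fun=> B) (0 : R) 1 A 0 h1 _)).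
by rewrite addr0.
Qed.

Lemma smooth_gen_derive (f : E -> R) j : smooth_gen f ->
  exists2 g, smooth_gen g & forall x, is_derive x 'e_ j (f : E -> R^o) (g x).
Proof.
elim=> [c|p s a i|{}f g sf [f' sf' df] sg [g' sg' dg]|{}f g sf [f' sf' df] sg [g' sg' dg]].
- by exists (fun=> 0); [exact: smooth_cst|move=> x; exact: is_derive_cst].
- exists (fun x => (s * (j == i)%:R) * flat ('X^2 * (p - p^`())) (s * x ord0 i + a)).
    exact: smooth_mul (smooth_cst _) (smooth_flat _ _ _ _).
  move=> x; apply/is_derive_line0.
  pose A : R := s * (j == i)%:R; pose B : R := s * x ord0 i + a.
  have h := is_derive_affine A B.
  rewrite (_ : (fun _ => _) = flat p \o (fun t : R => A * t + B)); last first.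
    by apply/funext => t /=; rewrite !mxE eqxx /= (eq_sym i j); congr flat; rewrite /A /B; ring.
  rewrite mulrC; apply: is_derive1_comp h.
  by rewrite mulr0 add0r; exact: is_derive_flat.
- exists (fun x => f x * g' x + g x * f' x).
    by apply: smooth_add; apply: smooth_mul.
  by move=> x; exact: is_deriveM.
- by exists (fun x => f' x + g' x); [exact: smooth_add|move=> x; exact: is_deriveD].
Qed.

Lemma smooth_gen_partial (f : E -> R) j : smooth_gen f -> smooth_gen (partial j f).
Proof.
move=> /smooth_gen_derive-/(_ j)[g sg dg].
by rewrite (_ : partial j f = g)//; apply/funext => x; exact: partial_val.
Qed.

Lemma smooth_gen_smooth (f : E -> R) : smooth_gen f -> smooth f.
Proof.
move=> sf s; have {}sf : smooth_gen (foldr partial f s).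
  by elim: s => //= i s; exact: smooth_gen_partial.
split; first exact: smooth_gen_continuous.
by move=> i x; have [g _ dg] := smooth_gen_derive i sf; case: (dg x).
Qed.

(** One family with two uses: small [s] gives cutoffs increasing the support to all of R^d, large
    [s] gives mollifiers concentrated within distance [s^-1] of [z]. *)
Definition box_bump s z x : R := \prod_i bump1 (s * (x ord0 i - z ord0 i)).

Lemma smooth_gen_prod (I : Type) (l : seq I) (F : I -> E -> R) :
  (forall j, smooth_gen (F j)) -> smooth_gen (fun x => \prod_(j <- l) F j x).
Proof.
move=> h; elim: l => [|j l IHl].
  by rewrite (_ : (fun _ => _) = fun=> 1); [exact: smooth_cst|apply/funext => x; rewrite big_nil].
rewrite (_ : (fun _ => _) = fun x => F j x * \prod_(k <- l) F k x); first exact: smooth_mul.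
by apply/funext => x; rewrite big_cons.
Qed.

Lemma smooth_gen_bump s z : smooth_gen (box_bump s z).
Proof.
apply: smooth_gen_prod => i.
rewrite (_ : (fun _ => _) = fun x => flat 1 (s * x ord0 i + (1 - s * z ord0 i)) *
    flat 1 (- s * x ord0 i + (1 + s * z ord0 i)) * expR 2).
  by apply: smooth_mul (smooth_cst _); apply: smooth_mul; exact: smooth_flat.
by apply/funext => x; rewrite /bump1; congr (flat _ _ * flat _ _ * _); ring.
Qed.

Lemma bump_ge0 s z x : 0 <= box_bump s z x.
Proof. by apply: prodr_ge0 => i _; exact: bump1_ge0. Qed.

Lemma bump_support s z x : 0 < s -> box_bump s z x != 0 -> cube d s^-1 (x - z).
Proof.
move=> s0 h i; rewrite ltNge; apply/negP => hx; move/eqP: h; apply.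
rewrite /box_bump (bigD1 i)//= bump1_eq0 ?mul0r//.
move: hx; rewrite !mxE normrM (gtr0_norm s0).
by rewrite -ler_pdivrMl ?invr_gt0// ?invrK mulr1.
Qed.

Lemma bump_test s z : 0 < s -> test_function (box_bump s z).
Proof.
move=> s0; split; first exact/smooth_gen_smooth/smooth_gen_bump.
have [r r0 cz] := cube_exists z.
apply: (@support_compact _ (s^-1 + r)) => x /(bump_support s0) h.
by rewrite -(subrK z x); exact: cubeD.
Qed.

Lemma bump_tame s z : 0 < s -> tame (box_bump s z : E -> R^o).
Proof. by move=> s0; apply: test_function_tame; exact: bump_test. Qed.

End smooth_bumps.

(** * Density of compactly supported functions and continuity of translations *)

Section density.
Context {R : realType} {d : nat}.
Notation E := 'rV[R]_d.
Notation mu := (lebesgue_rV d : {measure set 'rV[R]_d -> \bar R}).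
Notation "'e_ i" := (delta_mx ord0 i : 'rV[R]_d) (at level 8, i at level 2).
Notation l2 := (l2 mu).
Notation nrm := (nrm mu).
Implicit Types (u v w f g : E -> R^o) (x y z : E) (i : 'I_d) (r s : R) (A B : set E).

Lemma is_derive_scale u x (v : E) s l : is_derive (s *: x) v u l ->
  is_derive x v (fun y => u (s *: y)) (s * l).
Proof.
move=> /is_derive_line0 h; apply/is_derive_line0.
rewrite (_ : (fun _ => _) = (fun t : R => u (s *: x + t *: v)) \o (fun t : R => s * t + 0)).
  rewrite mulrC; apply: is_derive1_comp; last exact: is_derive_affine.
  by rewrite mulr0 addr0.
by apply/funext => t /=; rewrite addr0 scalerDr scalerA.
Qed.

Lemma bump_scale s z x : box_bump s z x = box_bump 1 0 (s *: (x - z)).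
Proof. by apply: eq_bigr => i _; rewrite !mxE subr0 mul1r. Qed.

Lemma bump0 s : box_bump s 0 (0 : E) = 1.
Proof. by rewrite /box_bump big1// => i _; rewrite !mxE subrr mulr0 bump1_0. Qed.

(** All bumps are rescalings of [box_bump 1 0], so one constant serves; the factor [|s|] makes the
    gradients of the cutoffs tend to 0 uniformly. *)
Lemma bump_bounds : exists2 C, 0 <= C & forall s z x, box_bump s z x <= C /\
  forall i, `|partial i (box_bump s 0 : E -> R) x| <= C * `|s|.
Proof.
have t1 := @bump_tame R d 1 0 ltr01.
have [_ _ _ [C hC]] := t1.
have C0 : 0 <= C by rewrite (le_trans _ (proj1 (hC 0))).
exists C => // s z x; split.
  by rewrite bump_scale (le_trans (ler_norm _))//; case: (hC (s *: (x - z))).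
move=> i.
have h : is_derive x 'e_ i (box_bump s 0 : E -> R^o) (s * partial i (box_bump 1 0 : E -> R) (s *: x)).
  rewrite (_ : box_bump s 0 = fun x => box_bump 1 0 (s *: x)).
    by apply: is_derive_scale; exact: tame_is_derive.
  by apply/funext => y; rewrite bump_scale subr0.
rewrite (partial_val h) normrM mulrC ler_wpM2r//.
by case: (hC (s *: x)).
Qed.

Lemma cvg_bump x : box_bump k.+1%:R^-1 0 x @[k --> \oo] --> (1 : R).
Proof.
rewrite (_ : (fun k => _) = fun k : nat => box_bump 1 0 (k.+1%:R^-1 *: x)); last first.
  by apply/funext => k; rewrite bump_scale subr0.
rewrite -[X in _ --> X](@bump0 1).
apply/cvgrPdist_lt => e e0.
have [r r0 hr] := (continuous_cubeP (box_bump 1 0 : E -> R^o)).1 (smooth_gen_continuous (smooth_gen_bump 1 0)) 0 _ e0.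
have [q q0 cq] := cube_exists x.
have /cvgr0Pnorm_lt/(_ (r / q)) := @cvg_harmonic R.
move=> /(_ (divr_gt0 r0 q0)); apply: filterS => k hk.
rewrite distrC -[_ *: x]add0r; apply: hr => i.
rewrite mxE normrM; move: hk; rewrite /= ltr_pdivlMr// => hk.
by apply: le_lt_trans hk; rewrite ler_wpM2l// ltW.
Qed.

Definition tame_adherent f := l2 f /\ forall e, 0 < e -> exists2 u, tame u & nrm (f - u) < e.

Lemma tame_adherent_tame u : tame u -> tame_adherent u.
Proof.
move=> tu; split; first exact: tame_l2.
by move=> e e0; exists u => //; rewrite subrr nrm0.
Qed.

Lemma tame_adherent_lin (a : R) f g : tame_adherent f -> tame_adherent g ->
  tame_adherent (a *: f + g).
Proof.
move=> [lf hf] [lg hg]; split; first exact: l2_lin.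
move=> e e0.
have a1 : 0 < `|a| + 1 by rewrite ltr_wpDl.
have [u tu hu] := hf (e / 2 / (`|a| + 1)) (divr_gt0 (divr_gt0 e0 (ltr0n R 2)) a1).
have [v tv hv] := hg (e / 2) (divr_gt0 e0 (ltr0n R 2)).
exists (a *: u + v); first by case: (tame_lin a tu tv).
rewrite opprD addrACA -scalerBr.
have lfu := l2B lf (tame_l2 tu); have lgv := l2B lg (tame_l2 tv).
rewrite (le_lt_trans (nrmD (l2Z a lfu) lgv))// nrmZ//.
rewrite ltr_pdivlMr// in hu.
by have := nrm_ge0 mu (f - u); lra.
Qed.

Lemma tame_adherent_lim f : l2 f ->
  (forall e, 0 < e -> exists2 g, tame_adherent g & nrm (f - g) < e) -> tame_adherent f.
Proof.
move=> lf h; split=> // e e0.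
have e2 : 0 < e / 2 by rewrite divr_gt0.
have [g [lg hg] fg] := h _ e2; have [u tu gu] := hg _ e2.
exists u => //; have := nrm_dist lf lg (tame_l2 tu); lra.
Qed.

Lemma tame_adherent_cvg (f_ : nat -> E -> R^o) f : l2 f -> (forall k, tame_adherent (f_ k)) ->
  nrm (f_ k - f) @[k --> \oo] --> (0 : R) -> tame_adherent f.
Proof.
move=> lf af hf; apply: tame_adherent_lim => // e e0.
have /cvgr0Pnorm_lt/(_ _ e0)[N _ hN] := hf.
exists (f_ N) => //; have [lN _] := af N.
rewrite nrm_distC//; have := hN N (leqnn _); apply: le_lt_trans; exact: ler_norm.
Qed.

Lemma tame_adherent_sum (I : Type) (l : seq I) (F : I -> E -> R^o) :
  (forall j, tame_adherent (F j)) -> tame_adherent (fun x => \sum_(j <- l) F j x).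
Proof.
move=> h; elim: l => [|j l IHl].
  rewrite (_ : (fun _ => _) = 0); first exact/tame_adherent_tame/tame0.
  by apply/funext => x; rewrite big_nil.
rewrite (_ : (fun _ => _) = 1 *: F j + (fun x => \sum_(k <- l) F k x)).
  exact: tame_adherent_lin.
by apply/funext => x; rewrite big_cons scale1r.
Qed.

(** Orthants form a pi-system generating the product sigma-algebra, and their indicators are
    explicit limits of smooth functions; this is the base of a Dynkin induction. *)
Definition orthant (a : 'I_d -> R) : set E := [set x | forall i, a i < x ord0 i].

Definition orthants : set (set E) := [set orthant a | a in setT].

Lemma measurable_orthants : @measurable _ 'rV[R]_d = <<s orthants >>.
Proof.
apply/seteqP; split=> A; last first.
  apply: smallest_sub; first exact: sigma_algebra_measurable.
  move=> _ [a _ <-].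
  rewrite (_ : orthant a = [set x | forall i, `]a i, +oo[%classic (x ord0 i)]).
    apply: (@measurable_rV_forall _ _ (fun i => `]a i, +oo[%classic : set (measurableTypeR R))) => i.
    exact: measurable_itv.
  by apply/seteqP; split=> x /= h i; have := h i; rewrite in_itv/= andbT.
move=> mA.
have mid : measurable_fun setT (fun x : g_sigma_algebraType orthants => (x : 'rV[R]_d)).
  apply: measurable_rVP => i.
  apply: (@measurability _ _ _ _ _ _ _ (RGenOInfty.measurableE R)).
  move=> _ [_ [a ->] <-]; rewrite setTI.
  rewrite (_ : _ @^-1` _ = \bigcup_k orthant (fun j => if j == i then a else - k%:R)).
    by apply: bigcupT_measurable => k; apply: sub_sigma_algebra; exists (fun j => if j == i then a else - k%:R).
  apply/seteqP; split=> x /=; rewrite in_itv/= andbT.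
    move=> ax; have [r r0 cr] := cube_exists x.
    exists (Num.truncn r).+1 => // j; case: eqP => [->//|_].
    have := cr j; rewrite ltr_norml => /andP[h _]; apply: lt_trans h.
    by rewrite ltrN2 Num.Theory.truncnS_gt.
  by move=> [k _ /(_ i)]; rewrite eqxx.
by have := mid measurableT _ mA; rewrite setTI.
Qed.

Lemma orthants_setI : setI_closed orthants.
Proof.
move=> _ _ [a _ <-] [b _ <-]; exists (fun i => Num.max (a i) (b i)) => //.
apply/seteqP; split=> x /=.
  by move=> h; split=> i; have := h i; rewrite gt_max => /andP[].
by move=> [h1 h2] i; rewrite gt_max h1 h2.
Qed.

Let cut s A x : R := box_bump s 0 x * \1_A x.

Let cut_l2 s A : 0 < s -> measurable A -> l2 (cut s A).
Proof.
move=> s0 mA; have tb := @bump_tame R d s 0 s0.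
apply: (l2_le _ (tame_l2 tb)).
  by apply: measurable_funM; [exact: tame_measurable|exact: measurable_indic].
move=> x; rewrite /cut normrM indicE; case: (_ \in _); rewrite ?normr1 ?normr0 ?mulr1 ?mulr0//.
Qed.

Lemma orthant_adherent s (a : 'I_d -> R) : 0 < s -> tame_adherent (cut s (orthant a)).
Proof.
move=> s0.
have mO : measurable (orthant a) by rewrite measurable_orthants; apply: sub_sigma_algebra; exists a.
have tb := @bump_tame R d s 0 s0.
(* On the orthant the product is the exponential of minus (k+1)^-1 times the sum of the 1/(x_i -
   a_i), which tends to 1; off the orthant one factor is 0 for every k. *)
pose v k x := box_bump s 0 x * \prod_(i < d) flat 1 (k.+1%:R * x ord0 i + - (k.+1%:R * a i)).
have vE k x : \prod_(i < d) flat 1 (k.+1%:R * x ord0 i + - (k.+1%:R * a i)) =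
    \prod_(i < d) flat 1 (k.+1%:R * (x ord0 i - a i)).
  by apply: eq_bigr => i _; rewrite mulrBr.
have p01 k x : 0 <= \prod_(i < d) flat 1 (k.+1%:R * x ord0 i + - (k.+1%:R * a i)) <= 1.
  apply/andP; split; first by apply: prodr_ge0 => i _; exact: flat1_ge0.
  by apply: prodr_ile1 => i _; rewrite flat1_ge0 flat1_le1.
have tv k : tame (v k).
  apply: test_function_tame; split.
    apply/smooth_gen_smooth/smooth_mul; first exact: smooth_gen_bump.
    by apply: smooth_gen_prod => i; exact: smooth_flat.
  apply: (@support_compact _ _ _ s^-1) => x /= vx.
  rewrite -[x]subr0; apply: bump_support => //; apply: contra_neq vx => bx.
  by rewrite /v bx mul0r.
apply: (@tame_adherent_cvg v); first exact: cut_l2.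
  by move=> k; exact: tame_adherent_tame.
apply: (nrm_dominated _ (cut_l2 s0 mO) (tame_l2 tb)).
- by move=> k; exact: tame_measurable.
- apply: aeW => x; rewrite /v /cut.
  apply: (@cvgM _ _ _ _ (fun=> box_bump s 0 x)); first exact: cvg_cst.
  rewrite indicE; have [Ox|nOx] := pselect (orthant a x).
    rewrite mem_set//.
    rewrite (_ : (fun k : nat => _) = fun k : nat => expR (- (k.+1%:R^-1 * \sum_(i < d) (x ord0 i - a i)^-1))).
      have c : - (k.+1%:R^-1 * \sum_(i < d) (x ord0 i - a i)^-1) @[k --> \oo] --> (0 : R).
        rewrite -[X in _ --> X](_ : - (0 * \sum_(i < d) (x ord0 i - a i)^-1) = 0); last by rewrite mul0r oppr0.
        by apply: cvgN; apply: cvgMr_tmp; exact: cvg_harmonic.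
      by rewrite -[X in _ --> X]expR0; apply: (continuous_cvg _ _ c); exact: continuous_expR.
    apply/funext => k; rewrite vE mulr_sumr -sumrN expR_sum; apply: eq_bigr => i _.
    by rewrite /flat mulr_gt0 ?ltr0n ?subr_gt0// hornerC mul1r invfM.
  rewrite memNset//.
  have [i ai] : exists i, ~~ (a i < x ord0 i).
    by apply: contrapT => h; apply: nOx => i; apply: contrapT => /negP ni; apply: h; exists i.
  rewrite (_ : (fun k : nat => _) = fun=> 0); first exact: cvg_cst.
  apply/funext => k; rewrite vE (bigD1 i)//= flat_le0 ?mul0r//.
  by rewrite pmulr_rle0 ?ltr0n// subr_le0 leNgt.
- move=> k x; rewrite /v normrM ler_piMr//.
  by have /andP[h1 h2] := p01 k x; rewrite ger0_norm.
Qed.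

(** The fixed cutoff makes every indicator square-integrable and is itself the dominating function,
    so that complements and countable unions remain in the L_2 closure. *)
Lemma cut_adherent s A : 0 < s -> measurable A -> tame_adherent (cut s A).
Proof.
move=> s0; rewrite measurable_orthants.
have tb := @bump_tame R d s 0 s0.
apply: (@dynkin_induction _ _ orthants (fun A => tame_adherent (cut s A))).
- exact: measurable_orthants.
- exact: orthants_setI.
- rewrite (_ : cut s setT = box_bump s 0); first exact: tame_adherent_tame.
  by apply/funext => x; rewrite /cut indicE in_setT mulr1.
- by move=> _ [a _ <-]; exact: orthant_adherent.
- move=> S mS aS.
  rewrite (_ : cut s (~` S) = (-1) *: (cut s S : E -> R^o) + box_bump s 0).
    by apply: tame_adherent_lin => //; exact: tame_adherent_tame.
  apply/funext => x; rewrite -[RHS]/(-1 * cut s S x + box_bump s 0 x) /cut !indicE in_setC.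
  by case: (x \in S) => /=; ring.
move=> F mF tF aF.
have mU : measurable (\bigcup_k F k) by exact: bigcupT_measurable.
(* Finite unions are handled by linearity, the pieces being disjoint; the countable union is then a
   dominated limit. *)
pose G n := [set x | exists2 k, (k < n)%N & F k x].
have aG n : tame_adherent (cut s (G n)).
  elim: n => [|n IHn].
    rewrite (_ : cut s (G 0%N) = 0); first exact/tame_adherent_tame/tame0.
    apply/funext => x; rewrite /cut indicE memNset ?mulr0//.
    by move=> [k]; rewrite ltn0.
  rewrite (_ : cut s (G n.+1) = 1 *: (cut s (G n) : E -> R^o) + cut s (F n)).
    exact: tame_adherent_lin.
  apply/funext => x; rewrite scale1r -[RHS]/(cut s (G n) x + cut s (F n) x) /cut -mulrDr.
  congr (_ * _); rewrite !indicE.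
  have [Fx|nFx] := pselect (F n x).
    rewrite [x \in F n]mem_set// [x \in G n.+1]mem_set; last by exists n.
    rewrite memNset ?add0r// => -[k kn Fk].
    have kk : k = n by apply: (tF k n) => //; exists x.
    by rewrite kk ltnn in kn.
  rewrite [x \in F n]memNset// addr0.
  have [Gx|nGx] := pselect (G n x).
    by rewrite !mem_set//; case: Gx => k kn Fk; exists k => //; exact: ltn_trans kn _.
  rewrite !memNset// => -[k]; rewrite ltnS leq_eqVlt => /orP[/eqP -> //|kn Fk].
  by apply: nGx; exists k.
apply: (@tame_adherent_cvg (fun n => cut s (G n))) => //; first exact: cut_l2.
apply: (nrm_dominated _ (cut_l2 s0 mU) (tame_l2 tb)).
- by move=> n; apply: (@l2_measurable _ _ _ mu); case: (aG n).
- apply: aeW => x; rewrite /cut.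
  apply: (@cvgM _ _ _ _ (fun=> box_bump s 0 x)); first exact: cvg_cst.
  have [[k _ Fk]|nU] := pselect ((\bigcup_k F k) x).
    rewrite indicE mem_set; last by exists k.
    apply: cvg_near_cst; exists k.+1 => // n /= kn.
    by rewrite indicE mem_set//; exists k.
  rewrite indicE memNset//; apply: cvg_near_cst; apply: nearW => n.
  by rewrite indicE memNset// => -[k _ Fk]; apply: nU; exists k.
- move=> n x; rewrite /cut normrM indicE; case: (_ \in _); rewrite ?normr1 ?normr0 ?mulr1 ?mulr0//.
Qed.

Import HBNNSimple.

Lemma cut_nnsfun_adherent s (phi : {nnsfun 'rV[R]_d >-> R}) : 0 < s ->
  tame_adherent (fun x => box_bump s 0 x * phi x).
Proof.
move=> s0.
rewrite (_ : (fun _ => _) = fun x => \sum_(y <- fset_set (range phi)) (y *: (cut s (phi @^-1` [set y]) : E -> R^o)) x).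
  apply: tame_adherent_sum => y; rewrite -[_ *: _]addr0.
  apply: tame_adherent_lin; last exact/tame_adherent_tame/tame0.
  by apply: cut_adherent => //; exact: measurable_funPTI.
apply/funext => x; rewrite fimfunE fsbig_finite//= mulr_sumr.
apply: eq_bigr => y _; rewrite -[RHS]/(y * cut s (phi @^-1` [set y]) x) /cut.
by rewrite mulrCA.
Qed.

Let ge0_adherent f : l2 f -> (forall x, 0 <= f x) -> tame_adherent f.
Proof.
move=> lf f0.
have mf := l2_measurable lf.
have mE : measurable_fun setT (EFin \o f) by exact/measurable_EFinP.
pose phi := nnsfun_approx measurableT mE.
have cphi x : phi k x @[k --> \oo] --> f x.
  have := @cvg_nnsfun_approx _ _ _ _ measurableT _ mE (fun x _ => f0 x) x Logic.I.
  by move=> /fine_cvg.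
have lphi k x : phi k x <= f x.
  rewrite -(cvg_lim (@Rhausdorff R) (cphi x)).
  apply: nondecreasing_cvgn_le; last exact: (cvgP _ (cphi x)).
  by move=> m n mn; have /lefP/(_ x) := nd_nnsfun_approx measurableT mE mn.
have [C C0 hC] := bump_bounds.
have kp k : 0 < k.+1%:R^-1 :> R by rewrite invr_gt0 ltr0n.
apply: (@tame_adherent_cvg (fun k x => box_bump k.+1%:R^-1 0 x * phi k x)) => //.
  by move=> k; apply: cut_nnsfun_adherent; exact: kp.
apply: (nrm_dominated _ lf (l2Z C lf)).
- move=> k; apply: (@l2_measurable _ _ _ mu); exact: proj1 (cut_nnsfun_adherent _ (kp k)).
- apply: aeW => x; rewrite -[X in _ --> X]mul1r.
  by apply: cvgM; [exact: cvg_bump|exact: cphi].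
- move=> k x; rewrite -[X in _ <= `|X|]/(C * f x) !ger0_norm ?mulr_ge0//; last exact: bump_ge0.
  by apply: ler_pM => //; [exact: bump_ge0|case: (hC k.+1%:R^-1 0 x)].
Qed.

Lemma tame_dense f : l2 f -> tame_adherent f.
Proof.
move=> lf; have mf := l2_measurable lf.
have -> : f = (-1) *: (fun x => Num.max (- f x) 0 : R^o) + (fun x => Num.max (f x) 0 : R^o).
  apply/funext => x; rewrite -[RHS]/(-1 * Num.max (- f x) 0 + Num.max (f x) 0).
  have [h|h] := leP (f x) 0; first by rewrite max_l ?oppr_ge0//; ring.
  by rewrite max_r ?oppr_le0 ?ltW//; ring.
apply: tame_adherent_lin; apply: ge0_adherent.
- apply: (l2_le _ lf); first by apply: measurable_maxr => //; exact: measurable_funN.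
  by move=> x; case: (leP (- f x) 0) => h; rewrite ?normr0 ?normrN.
- by move=> x; rewrite le_max lexx orbT.
- apply: (l2_le _ lf); first by apply: measurable_maxr.
  by move=> x; case: (leP (f x) 0) => h; rewrite ?normr0.
- by move=> x; rewrite le_max lexx orbT.
Qed.

(** * Continuity of translations in L_2 *)

Definition shift_fun z f : E -> R^o := fun x => f (x + z).

Lemma shift_l2 z f : l2 f -> l2 (shift_fun z f).
Proof.
move=> /l2P[mf /integrableP[m2 If]]; apply/l2P; split.
  exact: measurableT_comp mf (measurable_rV_shift z).
apply/integrableP; split.
  exact: measurableT_comp m2 (measurable_rV_shift z).
apply: le_lt_trans If; rewrite le_eqVlt; apply/orP; left; apply/eqP.
apply: (@integral_invariant _ _ _ mu (fun x => x + z) (fun x => `|(f x ^+ 2)%:E|%E)).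
- exact: measurable_rV_shift.
- by move=> A mA; exact: lebesgue_rV_shift.
- exact: measurableT_comp.
Qed.

Lemma shift_nrm z f : measurable_fun setT f -> nrm (shift_fun z f) = nrm f.
Proof.
move=> mf; congr Num.sqrt.
by apply: (Rintegral_shift (f := fun x => f x * f x)); exact: measurable_funM.
Qed.

(** Three-part splitting through a tame [u] close to [f]: translations are isometries, and for [u]
    uniform continuity on a cube of fixed volume gives L_2 smallness. *)
Lemma shift_continuous f e : l2 f -> 0 < e ->
  exists2 t, 0 < t & forall z, cube d t z -> nrm (shift_fun z f - f) < e.
Proof.
move=> lf e0.
have e3 : 0 < e / 3 by rewrite divr_gt0.
have [_ /(_ _ e3)[u tu fu]] := tame_dense lf.
have [cu [r ur] _ _] := tu.
pose q := Num.max (r + 1) 1.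
have q0 : 0 < q by rewrite lt_max ltr01 orbT.
pose S := Num.sqrt ((2 * q) ^+ d).
have S0 : 0 <= S by rewrite sqrtr_ge0.
have eS : 0 < e / 3 / (S + 1) by rewrite divr_gt0// ltr_wpDl.
have [t t0 ht] := uniformly_continuous cu ur eS.
exists (Num.min t 1); first by rewrite lt_min t0 ltr01.
move=> z cz.
have czt : cube d t z by apply: cubeS cz; rewrite ge_min lexx.
have cz1 : cube d 1 z by apply: cubeS cz; rewrite ge_min lexx orbT.
have lu := tame_l2 tu.
have lsu := shift_l2 z lu; have lsf := shift_l2 z lf.
have h1 : nrm (shift_fun z u - u) <= e / 3.
  apply: (@le_trans _ _ (e / 3 / (S + 1) * S)); last first.
    by rewrite mulrAC ler_pdivrMr ?ltr_wpDl// ler_pM2l// lerDl.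
  apply: (bounded_support_nrm _ _ _ q0).
  - exact: l2_measurable (l2B lsu lu).
  - move=> x nx; rewrite -[LHS]/(u (x + z) - u x).
    have nr : ~ cube d (r + 1) x by move=> cx; apply: nx; apply: cubeS cx; rewrite le_max lexx.
    rewrite !ur ?subrr// => cx; apply: nr.
      by apply: cubeS cx; rewrite lerDl.
    by rewrite -(addrK z x); apply: cubeD => //; exact: cubeN.
  - by move=> x; apply: ltW; exact: ht.
have h2 : nrm (shift_fun z f - shift_fun z u) < e / 3.
  have := shift_nrm z (l2_measurable (l2B lf lu)); rewrite -[shift_fun z (f - u)]/(shift_fun z f - shift_fun z u) => ->.
  exact: fu.
have h3 := nrm_dist lsf lsu lf.
have h4 := nrm_dist lsu lu lf.
have h5 := nrm_distC lu lf.
lra.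
Qed.

End density.

(** * Mollification *)

Section mollifier.
Context {R : realType} {d : nat}.
Notation E := 'rV[R]_d.
Notation mu := (lebesgue_rV d : {measure set 'rV[R]_d -> \bar R}).
Notation "'e_ i" := (delta_mx ord0 i : 'rV[R]_d) (at level 8, i at level 2).
Notation l2 := (l2 mu).
Notation nrm := (nrm mu).
Notation ip := (ip mu).
Implicit Types (u f g : E -> R^o) (x y z : E) (i : 'I_d) (r e t : R).

Definition bump_mass (s : R) : R := \int[mu]_x box_bump s (0 : E) x.

Definition rho (s : R) x : E -> R^o := (bump_mass s)^-1 *: (box_bump s x : E -> R^o).

(** Convolution written as a pairing with the test function [rho s x]: this is the form to which the
    definition of a weak derivative applies directly. The kernel has radius [s^-1], so the limit of
    interest is [s] tending to infinity. *)
Definition moll (s : R) f : E -> R^o := fun x => ip f (rho s x).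

Variable s : R.
Hypothesis s0 : 0 < s.

Lemma tame_integ u : tame u -> integ mu u.
Proof.
move=> tu; have [cu [r ur] _ [K uK]] := tu.
by apply: (@bounded_support_integ _ _ _ r K) => //; [exact: tame_measurable|move=> x; case: (uK x)].
Qed.

Lemma bump_mass_gt0 : 0 < bump_mass s.
Proof.
have tb := @bump_tame R d s 0 s0.
have half : 0 < 2^-1 :> R by rewrite invr_gt0.
have [r r0 hr] := (continuous_cubeP (box_bump s 0 : E -> R^o)).1 (tame_continuous tb) 0 _ half.
have mc : measurable (cube d r : set 'rV[R]_d) by exact: measurable_cube.
apply: (@lt_le_trans _ _ (\int[mu]_x (2^-1 * \1_(cube d r) x))).
  rewrite RintegralZl//; last exact: integ_indic_cube.
  by rewrite /Rintegral integral_indic// setIT lebesgue_rV_cube// mulr_gt0// exprn_gt0// mulr_gt0.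
apply: le_Rintegral => //.
- exact: integZ (integ_indic_cube r).
- exact: tame_integ.
move=> x _; rewrite indicE; have [cx|ncx] := pselect (cube d r x); last first.
  by rewrite memNset// mulr0 bump_ge0.
rewrite mem_set// mulr1; have := hr x cx; rewrite add0r bump0 distrC ltr_norml => /andP[_].
lra.
Qed.

Lemma rho_tame x : tame (rho s x).
Proof.
rewrite /rho -[X in tame X]addr0.
by have [] := tame_lin (bump_mass s)^-1 (@bump_tame R d s x s0) (@tame0 R d).
Qed.

Lemma rho_shift x z y : rho s (x + z) y = rho s x (y - z).
Proof.
rewrite -[LHS]/(_ * box_bump s (x + z) y) -[RHS]/(_ * box_bump s x (y - z)).
congr (_ * _); apply: eq_bigr => i _; rewrite !mxE; congr (bump1 (_ * _)); ring.
Qed.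

Lemma rho_center x y : rho s x y = rho s 0 (y - x).
Proof. by rewrite -rho_shift add0r. Qed.

Lemma rho_ge0 x y : 0 <= rho s x y.
Proof. by apply: mulr_ge0; [rewrite invr_ge0 ltW// bump_mass_gt0|exact: bump_ge0]. Qed.

Lemma rho_mass : \int[mu]_x rho s 0 x = 1.
Proof.
rewrite -[LHS]/(\int[mu]_x (_ * box_bump s 0 x)) RintegralZl//.
  by rewrite mulVf// gt_eqF// bump_mass_gt0.
exact: tame_integ (@bump_tame R d s 0 s0).
Qed.

Lemma rho_support z : rho s 0 z != 0 -> cube d s^-1 z.
Proof.
move=> h; rewrite -[z]subr0; apply: bump_support => //.
by apply: contra_neq h => h; rewrite /rho -[LHS]/(_ * box_bump s 0 z) h mulr0.
Qed.

Lemma partial_rho i x y : partial i (rho s x) y = partial i (rho s 0) (y - x).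
Proof.
have [_ <-] := tame_shift (- x) (rho_tame 0).
by congr (partial i _ y); apply/funext => z; exact: rho_center.
Qed.

Lemma moll_test x : test_function (rho s x).
Proof.
split.
  apply: smooth_gen_smooth; rewrite (_ : rho s x = fun y => (bump_mass s)^-1 * box_bump s x y)//.
  by apply: smooth_mul; [exact: smooth_cst|exact: smooth_gen_bump].
have [_ [r hr] _ _] := rho_tame x.
apply: (@support_compact _ _ _ r) => y /= hy; apply: contrapT => /hr; exact/eqP.
Qed.

Lemma mollE f x : measurable_fun setT f ->
  moll s f x = \int[mu]_z (f (x + z) * rho s 0 z).
Proof.
move=> mf; rewrite /moll /ip.
rewrite -(Rintegral_shift (f := fun y => f y * rho s x y) x).
  by apply: eq_Rintegral => z _; rewrite addrC rho_center addrC addrK.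
by apply: measurable_funM => //; exact: tame_measurable (rho_tame x).
Qed.

Lemma moll_continuous f : l2 f -> continuous (moll s f).
Proof.
move=> lf; apply/continuous_cubeP => x e e0.
have lr y := tame_l2 (rho_tame y).
have n0 : 0 < e / (nrm f + 1) by rewrite divr_gt0// ltr_wpDl// nrm_ge0.
have [t t0 ht] := shift_continuous (lr x) n0.
exists t => // z cz; rewrite /moll -ipBr//.
apply: (le_lt_trans (cauchy_schwarz lf (l2B (lr (x + z)) (lr x)))).
have -> : rho s (x + z) - rho s x = shift_fun (- z) (rho s x) - rho s x.
  by apply/funext => y; rewrite -[LHS]/(rho s (x + z) y - rho s x y) rho_shift.
have := ht _ (cubeN cz); rewrite ltr_pdivlMr; last by rewrite ltr_wpDl// nrm_ge0.
have := nrm_ge0 mu (shift_fun (- z) (rho s x) - rho s x).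
by rewrite mulrDr mulr1 mulrC; lra.
Qed.

Lemma moll_bounded f x : l2 f -> `|moll s f x| <= nrm f * nrm (rho s 0).
Proof.
move=> lf; have lr y := tame_l2 (rho_tame y).
have e : rho s x = shift_fun (- x) (rho s 0) by apply/funext => y; exact: rho_center.
apply: (le_trans (cauchy_schwarz lf (lr x))).
by rewrite e (shift_nrm (- x) (l2_measurable (lr 0))).
Qed.

Lemma moll_derive f i x : l2 f ->
  is_derive x 'e_ i (moll s f) (ip f (fun y => - partial i (rho s x) y)).
Proof.
move=> lf; apply/is_derive_line0.
pose F t y : R := f y * rho s (x + t *: 'e_ i) y.
pose G t y : R := f y * - partial i (rho s 0) (y - x - t *: 'e_ i).
have tr := rho_tame 0.
have dF t y : is_derive t 1 (F ^~ y) (G t y).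
  have h : is_derive t 1 (fun q : R => rho s (x + q *: 'e_ i) y : R^o) (- partial i (rho s 0) (y - x - t *: 'e_ i)).
    rewrite (_ : (fun q => _) = (fun q : R => rho s 0 (y - x + q *: 'e_ i)) \o (fun q : R => -1 * q + 0)); last first.
      apply/funext => q /=; rewrite addr0 mulN1r scaleNr rho_center.
      by congr (rho s 0 _); rewrite opprD addrA.
    rewrite -[X in is_derive _ _ _ X]mulr1 mulNr -mulrN.
    apply: is_derive1_comp.
      rewrite addr0 mulN1r; apply/is_derive_line.
      by rewrite scaleNr; exact: tame_is_derive.
    have h1 : is_derive t 1 (fun q : R => -1 * q) (-1).
      apply: (is_derive_eq (@is_deriveZ R R^o R^o id (-1) t 1 1 _)).
      by rewrite -[_ *: _]/(_ * 1) mulr1.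
    apply: (is_derive_eq (@is_deriveD R R^o R^o (fun q : R => -1 * q) (fun=> 0) t 1 (-1) 0 h1 _)).
    by rewrite addr0.
  exact: (is_derive_eq (@is_deriveZ R R^o R^o _ (f y) t 1 _ h)).
have [r [_ hr]] := tame_partial_support tr.
have [_ _ _ [K hK]] := tr.
have K0 : 0 <= K by rewrite (le_trans _ (proj1 (hK 0))).
have [q q0 cq] := cube_exists x.
(* The dominating function for differentiation under the integral. The radius adds the support [r]
   of the derivative of the kernel, the position [q] of [x], and the bound 1 on the parameter
   [t]. *)
pose D : E -> R^o := fun y => `|f y| * (K * \1_(cube d (r + q + 1)) y).
have lind : l2 (K *: (\1_(cube d (r + q + 1)) : E -> R^o)).
  apply: l2Z; apply: (@bounded_support_l2 _ _ _ (r + q + 1) 1).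
  - by apply: measurable_indic; exact: measurable_cube.
  - by move=> y ny; rewrite indicE memNset.
  - by move=> y; rewrite indicE; case: (_ \in _); rewrite ?normr1 ?normr0.
have lnf : l2 (fun y => `|f y|).
  apply: (l2_le _ lf); first by apply: measurableT_comp => //; exact: l2_measurable lf.
  by move=> y; rewrite normr_id.
have iD : mu.-integrable setT (EFin \o D) by exact: (l2_mul lnf lind).
have D0 y : 0 <= D y by rewrite /D !mulr_ge0// indicE; case: (_ \in _).
have zI : (0 : R) \in `](-1 : R), 1[ by rewrite in_itv/= ltrN10 ltr01.
have iF t : `](-1 : R), 1[%classic t -> mu.-integrable setT (EFin \o F t).
  by move=> _; exact: (l2_mul lf (tame_l2 (rho_tame _))).
have eqG t y : partial1of2 F t y = G t y by rewrite partial1of2E; case: (dF t y).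
have bG t y : `](-1 : R), 1[%classic t -> setT y -> `|partial1of2 F t y| <= D y.
  rewrite /= in_itv/= -ltr_norml => t1 _; rewrite eqG /G /D normrM normrN ler_wpM2l//.
  have [cy|ncy] := pselect (cube d (r + q + 1) y).
    by rewrite indicE mem_set// mulr1; case: (hK (y - x - t *: 'e_ i)).
  rewrite hr; first by rewrite normr0 mulr_ge0// indicE; case: (_ \in _).
  move=> c; apply: ncy.
  have -> : y = (y - x - t *: 'e_ i) + x + t *: 'e_ i by rewrite addrAC !subrK.
  by apply: cubeD; [exact: cubeD|exact: cube_scale_delta].
have dd t y : `](-1 : R), 1[%classic t -> setT y -> derivable (F ^~ y) t 1.
  by move=> _ _; case: (dF t y).
have h1 := derivable_under_integral measurableT zI iF dd D0 iD bG.
have h2 := differentiation_under_integral measurableT zI iF dd D0 iD bG.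
split=> //; rewrite derive1E in h2; rewrite h2.
by apply: eq_Rintegral => y _; rewrite eqG /G scale0r subr0 (partial_rho i x).
Qed.

Lemma measurable_shift_pair f : measurable_fun setT f ->
  measurable_fun [set: E * E] (fun p => f (p.1 + p.2)).
Proof.
move=> mf; apply: (measurableT_comp mf); apply: measurable_rVP => i.
under eq_fun do rewrite mxE.
apply: measurable_funD; apply: measurableT_comp (measurable_rV_coord i) _.
  exact: measurable_fst.
exact: measurable_snd.
Qed.

(* Jensen's inequality for the probability density [rho s 0], then Tonelli. *)
Lemma moll_dist f e : l2 f -> 0 <= e ->
  (forall z, cube d s^-1 z -> nrm (shift_fun z f - f) <= e) ->
  l2 (moll s f) /\ nrm (moll s f - f) <= e.
Proof.
move=> lf e0 he.
have mf := l2_measurable lf.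
have tr := rho_tame 0.
have mr := tame_measurable tr.
have [_ [r rr] _ [K hK]] := tr.
have ir := tame_integ tr.
pose m : E -> R^o := moll s f - f.
have mm : measurable_fun setT m.
  apply: measurable_funB => //; apply: continuous_measurable_rV; exact: moll_continuous.
pose J x z : R := (f (x + z) - f x) ^+ 2 * rho s 0 z.
have J0 x z : 0 <= J x z by rewrite /J mulr_ge0 ?sqr_ge0 ?rho_ge0.
have iL x : integ mu (fun z => f (x + z) * rho s 0 z).
  have h := l2_mul (shift_l2 x lf) (tame_l2 tr).
  by rewrite (_ : (fun z => _) = (fun z => shift_fun x f z * rho s 0 z))//; apply/funext => z; rewrite /shift_fun addrC.
have iQ x : integ mu (fun z => f (x + z) ^+ 2 * rho s 0 z).
  have /l2P[ms isq] := shift_l2 x lf.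
  apply: (integ_le _ (integZ K isq)).
    apply: measurable_funM => //; apply: measurable_funX.
    by rewrite (_ : (fun z => _) = shift_fun x f)//; apply/funext => z; rewrite /shift_fun addrC.
  move=> z; rewrite -[X in _ <= `|X|]/(K * f (z + x) ^+ 2) (addrC z x).
  rewrite [_ * rho s 0 z]mulrC (normrM (rho s 0 z)) (normrM K) ler_wpM2r//.
  by rewrite (le_trans (proj1 (hK z)))// ler_norm.
have JE x : J x = (fun z => f (x + z) ^+ 2 * rho s 0 z : R^o) +
    (((- 2 * f x) *: (fun z => f (x + z) * rho s 0 z : R^o)) + (f x ^+ 2) *: rho s 0).
  apply/funext => z; rewrite -[RHS]/(f (x + z) ^+ 2 * rho s 0 z + ((- 2 * f x) * (f (x + z) * rho s 0 z) + f x ^+ 2 * rho s 0 z)) /J.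
  by ring.
have iJ x : integ mu (J x).
  by rewrite JE; apply: integD => //; apply: integD; exact: integZ.
have jensen x : m x ^+ 2 <= \int[mu]_z J x z.
  have -> : \int[mu]_z J x z = \int[mu]_z (f (x + z) ^+ 2 * rho s 0 z) - 2 * f x * moll s f x + f x ^+ 2.
    rewrite JE RintegralD_integ//; last by apply: integD; exact: integZ.
    rewrite RintegralD_integ; [|exact: integZ|exact: integZ].
    rewrite RintegralZ_integ// RintegralZ_integ//.
    by rewrite rho_mass mollE//; ring.
  (* The variance of [f (x + z)] under the density is nonnegative; expanding it bounds the squared
     mean by the mean square, which is the instance of Jensen's inequality in use. *)
  have h : 0 <= \int[mu]_z ((f (x + z) - moll s f x) ^+ 2 * rho s 0 z).
    by apply: Rintegral_ge0 => z _; rewrite mulr_ge0 ?sqr_ge0 ?rho_ge0.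
  have e1 : (fun z => (f (x + z) - moll s f x) ^+ 2 * rho s 0 z) = (fun z => f (x + z) ^+ 2 * rho s 0 z : R^o) +
    (((- 2 * moll s f x) *: (fun z => f (x + z) * rho s 0 z : R^o)) + (moll s f x ^+ 2) *: rho s 0).
    apply/funext => z; rewrite -[RHS]/(f (x + z) ^+ 2 * rho s 0 z + ((- 2 * moll s f x) * (f (x + z) * rho s 0 z) + moll s f x ^+ 2 * rho s 0 z)).
    by ring.
  rewrite e1 RintegralD_integ// in h; last by apply: integD; exact: integZ.
  rewrite RintegralD_integ in h; [|exact: integZ|exact: integZ].
  rewrite RintegralZ_integ// RintegralZ_integ// in h.
  rewrite rho_mass -mollE// in h.
  by rewrite -[m x]/(moll s f x - f x); nra.
have mJ : measurable_fun [set: E * E] (fun p => (J p.1 p.2)%:E).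
  apply/measurable_EFinP; apply: measurable_funM.
    apply: measurable_funX; apply: measurable_funB; first exact: measurable_shift_pair.
    exact: measurableT_comp mf measurable_fst.
  exact: measurableT_comp mr measurable_snd.
have J0' (p : E * E) : (0 <= (J p.1 p.2)%:E)%E by rewrite lee_fin.
have bound : (\int[mu]_x (m x ^+ 2)%:E <= (e ^+ 2)%:E)%E.
  apply: (@le_trans _ _ (\int[mu]_x \int[mu]_z (J x z)%:E)%E).
    apply: ge0_le_integral => //.
    - by move=> x _; rewrite lee_fin sqr_ge0.
    - by apply/measurable_EFinP; exact: measurable_funX.
    - exact: (measurable_lebesgue_rV_integral mJ J0').
    - move=> x _; rewrite -[leRHS]fineK; last exact: integrable_fin_num (iJ x).
      by rewrite lee_fin; exact: jensen.
  rewrite (lebf_tonelli mJ J0') /=.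
  apply: (@le_trans _ _ (\int[mu]_z (e ^+ 2 * rho s 0 z)%:E)%E); last first.
    rewrite -[leLHS]fineK; last exact: integrable_fin_num (integZ (e ^+ 2) ir).
    rewrite -[fine _]/(\int[mu]_z (e ^+ 2 * rho s 0 z)) RintegralZl//.
    by rewrite rho_mass mulr1.
  apply: ge0_le_integral => //.
  - by move=> z _; apply: integral_ge0 => x _; rewrite lee_fin.
  - apply: (measurable_lebesgue_rV_integral (f := fun p => (J p.2 p.1)%:E)).
      have sw : measurable_fun [set: E * E] (fun p => (p.2, p.1)).
        by apply: measurable_fun_pair; [exact: measurable_snd|exact: measurable_fst].
      exact: (measurableT_comp mJ sw).
    by move=> p; rewrite lee_fin.
  - by apply/measurable_EFinP; apply: measurable_funM.
  - move=> z _.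
    have ld := l2B (shift_l2 z lf) lf.
    have id2 : integ mu (fun x => (f (x + z) - f x) ^+ 2) by have /l2P[] := ld.
    have -> : (\int[mu]_x (J x z)%:E = (nrm (shift_fun z f - f) ^+ 2 * rho s 0 z)%:E)%E.
      have iz : integ mu (fun x => J x z).
        have -> : (fun x => J x z) = rho s 0 z *: (fun x => (f (x + z) - f x) ^+ 2 : R^o).
          by apply/funext => x; rewrite /J mulrC.
        exact: integZ.
      rewrite -[LHS]fineK; last exact: integrable_fin_num iz.
      rewrite -[fine _]/(\int[mu]_x ((f (x + z) - f x) ^+ 2 * rho s 0 z)) RintegralZr//.
      by rewrite nrm_sqr.
    have [rz|nz] := eqVneq (rho s 0 z) 0; first by rewrite rz !mulr0.
    rewrite lee_fin ler_wpM2r ?rho_ge0//.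
    by rewrite lerXn2r ?nnegrE ?nrm_ge0// he//; exact: rho_support.
have im : integ mu (fun x => m x ^+ 2).
  apply/integrableP; split.
    by apply/measurable_EFinP; exact: (measurable_funX 2 mm).
  rewrite (eq_integral (fun x => (m x ^+ 2)%:E)); last first.
    by move=> x _; rewrite /= ger0_norm ?sqr_ge0.
  by apply: le_lt_trans bound _; rewrite ltry.
have lm : l2 m by apply/l2P.
split.
  by rewrite -(subrK f (moll s f)); apply: l2D.
rewrite -(ler_pXn2r (n := 2)) ?nnegrE ?nrm_ge0// nrm_sqr.
rewrite -lee_fin /ip; apply: le_trans bound.
rewrite /Rintegral fineK; last exact: integrable_fin_num (l2_mul lm lm).
by under eq_integral do rewrite -expr2.
Qed.

End mollifier.

Section mollifier_limit.
Context {R : realType} {d : nat}.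
Notation E := 'rV[R]_d.
Notation mu := (lebesgue_rV d : {measure set 'rV[R]_d -> \bar R}).
Notation l2 := (l2 mu).
Notation nrm := (nrm mu).
Implicit Types (f g : E -> R^o).

Let natS_gt0 (k : nat) : 0 < k.+1%:R :> R. Proof. by rewrite ltr0n. Qed.

Lemma moll_cvg f : l2 f ->
  (\forall k \near \oo, l2 (moll k.+1%:R f)) /\
  nrm (moll k.+1%:R f - f) @[k --> \oo] --> (0 : R).
Proof.
move=> lf.
have key (e : R) : 0 < e -> \forall k \near \oo, l2 (moll k.+1%:R f) /\ nrm (moll k.+1%:R f - f) <= e.
  move=> e0; have [t t0 ht] := shift_continuous lf e0.
  have /cvgr0Pnorm_lt/(_ _ t0) := @cvg_harmonic R; apply: filterS => k hk.
  apply: moll_dist => //; first exact: ltW.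
  move=> z cz; apply/ltW/ht; apply: cubeS cz; rewrite ltW//.
  by apply: le_lt_trans hk; exact: ler_norm.
split; first by apply: filterS (key _ ltr01) => k [].
apply/cvgr0Pnorm_le => e e0; apply: filterS (key _ e0) => k [_ h].
by rewrite ger0_norm// nrm_ge0.
Qed.

End mollifier_limit.

(** * Approximation of Sobolev functions *)

Lemma cvg_sum_seq {R : realType} (I : Type) (l : seq I) (F : nat -> I -> R) (a : I -> R) :
  (forall i, F k i @[k --> \oo] --> a i) ->
  \sum_(i <- l) F k i @[k --> \oo] --> \sum_(i <- l) a i.
Proof.
move=> h; elim: l => [|i l IHl].
  by under eq_fun do rewrite big_nil; rewrite big_nil; exact: cvg_cst.
by under eq_fun do rewrite big_cons; rewrite big_cons; exact: cvgD.
Qed.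

Section weak_derivatives.
Context {R : realType} {d : nat}.
Notation E := 'rV[R]_d.
Notation mu := (lebesgue_rV d : {measure set 'rV[R]_d -> \bar R}).
Notation "'e_ i" := (delta_mx ord0 i : 'rV[R]_d) (at level 8, i at level 2).
Notation l2 := (l2 mu).
Notation nrm := (nrm mu).
Notation ip := (ip mu).
Implicit Types (u v f g h : E -> R^o) (x y z : E) (i : 'I_d).

Definition weak i f g : Prop := forall eta : E -> R, test_function eta ->
  ip f (partial i eta) = - ip g eta.

Lemma tame_weak i u : tame u -> weak i u (partial i u).
Proof.
move=> tu eta teta; have te := test_function_tame teta.
have [ce _ de bK] := te.
have [tm pm] := tame_mul tu ce de bK.
have := integral_partial i tm.
under eq_Rintegral do rewrite pm.
rewrite RintegralD_integ; last 2 first.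
- exact: l2_mul (tame_partial_l2 i tu) (tame_l2 te).
- exact: l2_mul (tame_l2 tu) (tame_partial_l2 i te).
by move=> /eqP; rewrite addrC addr_eq0 => /eqP.
Qed.

Let natS_gt0 (k : nat) : 0 < k.+1%:R :> R. Proof. by rewrite ltr0n. Qed.

(** The crude estimate of any translation distance by twice the norm of [f] suffices to apply
    [moll_dist]. *)
Lemma moll_l2 (s : R) f : 0 < s -> l2 f -> l2 (moll s f).
Proof.
move=> s0 lf; apply: (proj1 (@moll_dist _ _ _ s0 _ (nrm f + nrm f) lf _ _)).
  by rewrite addr_ge0 ?nrm_ge0.
move=> z _; have lz := shift_l2 z lf.
rewrite -{1}(shift_nrm z (l2_measurable lf)) -(nrmN lf).
by apply: nrmD => //; exact: l2N.
Qed.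

(** Differentiating the kernel in its centre is minus differentiating it in the integration
    variable, and [rho s x] is an admissible test function. *)
Lemma moll_weak_derive (s : R) i f g x : 0 < s -> l2 f -> l2 g -> weak i f g ->
  is_derive x 'e_ i (moll s f) (moll s g x).
Proof.
move=> s0 lf lg wfg; apply: (is_derive_eq (moll_derive s0 i x lf)).
have <- : - ip f (partial i (rho s x)) = moll s g x.
  by rewrite wfg ?opprK//; exact: moll_test.
have -> : (fun y => - partial i (rho s x) y) = (-1) *: (partial i (rho s x) : E -> R^o).
  by apply/funext => y; rewrite scaleN1r.
have lp : l2 (partial i (rho s x) : E -> R^o) := tame_partial_l2 i (rho_tame s0 x).
have := ip_lin (-1) lp (l2_0 mu) lf.
rewrite addr0 ipC => ->; rewrite (ipC _ _ f) mulN1r.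
rewrite (_ : ip 0 f = 0) ?addr0//.
by rewrite /ip; under eq_Rintegral do rewrite mul0r; rewrite /Rintegral integral0.
Qed.

(** Every mollification of [f] is a pairing with a test function, hence 0, while mollifications
    converge to [f]. *)
Lemma moll_eq0 f : l2 f -> (forall eta, test_function eta -> ip f eta = 0) ->
  {ae mu, forall x, f x = 0}.
Proof.
move=> lf h; apply: (nrm_eq0 lf).
have [_ c] := moll_cvg lf.
rewrite (_ : (fun k => _) = fun=> nrm f) in c; first exact: cvg_lim_eq (cvg_cst _) c.
apply/funext => k; have -> : moll k.+1%:R f = 0.
  by apply/funext => x; rewrite /moll h//; exact: moll_test.
by rewrite sub0r nrmN.
Qed.

Lemma weak_unique i f g g' : l2 g -> l2 g' -> weak i f g -> weak i f g' ->
  {ae mu, forall x, g x = g' x}.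
Proof.
move=> lg lg' wg wg'.
have lgg := l2B lg lg'.
have : {ae mu, forall x, (g - g') x = 0}.
  apply: moll_eq0 => // eta te; rewrite ipBl//; last exact/tame_l2/test_function_tame.
  by rewrite -[ip g eta]opprK -wg// wg'// opprK subrr.
by apply: filterS => x /eqP; rewrite subr_eq0 => /eqP.
Qed.

Let chi (k : nat) : E -> R^o := box_bump k.+1%:R^-1 0.

Let chi_tame k : tame (chi k). Proof. exact: bump_tame. Qed.

Lemma cutoff_cvg (f_ : nat -> E -> R^o) f : l2 f -> (forall k, l2 (f_ k)) ->
  nrm (f_ k - f) @[k --> \oo] --> (0 : R) ->
  nrm ((fun x => chi k x * f_ k x) - f) @[k --> \oo] --> (0 : R).
Proof.
move=> lf lf_ hf.
have [C C0 hC] := @bump_bounds R d.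
have bchi k x : `|chi k x| <= C by rewrite ger0_norm ?bump_ge0//; case: (hC k.+1%:R^-1 0 x).
have lchi k h : l2 h -> l2 (fun x => chi k x * h x).
  by move=> lh; apply: (l2_mul_bounded _ (bchi k) lh); exact: tame_measurable.
have h1 : nrm ((fun x => chi k x * f x) - f) @[k --> \oo] --> (0 : R).
  apply: (nrm_dominated _ lf (l2Z C lf)).
  - by move=> k; exact: l2_measurable (lchi k f lf).
  - by apply: aeW => x; rewrite -[X in _ --> X]mul1r; apply: cvgMr_tmp; exact: cvg_bump.
  - move=> k x; rewrite -[X in _ <= `|X|]/(C * f x) !normrM ler_wpM2r//.
    by rewrite (le_trans (bchi k x))// ler_norm.
apply: (@squeeze_cvgr _ _ _ _ (fun=> 0)
  (fun k => C * nrm (f_ k - f) + nrm ((fun x => chi k x * f x) - f))).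
- apply: nearW => k; rewrite nrm_ge0/=.
  apply: (le_trans (nrm_dist (lchi k _ (lf_ k)) (lchi k f lf) lf)); rewrite lerD2r.
  rewrite -[C]ger0_norm// -(nrmZ C (l2B (lf_ k) lf)); apply: le_nrm.
  + by apply: l2B; exact: lchi.
  + exact/l2Z/l2B.
  + apply: aeW => x; rewrite -[X in `|X| <= _]/(chi k x * f_ k x - chi k x * f x).
    rewrite -[X in _ <= `|X|]/(C * (f_ k x - f x)) -mulrBr !normrM ler_wpM2r//.
    by rewrite (le_trans (bchi k x))// ler_norm.
- exact: cvg_cst.
- rewrite -[X in _ --> X](_ : C * 0 + 0 = 0); last by rewrite mulr0 addr0.
  by apply: cvgD => //; apply: cvgMl_tmp.
Qed.

(** Mollify, then cut off. In the product rule the derivative of the cutoff is O(1/k) uniformly and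
    the mollifications are bounded in L_2, so that term vanishes; the other is a cut-off
    mollification of [g i]. *)
Lemma weak_approx f (g : 'I_d -> E -> R^o) : l2 f -> (forall i, l2 (g i)) ->
  (forall i, weak i f (g i)) -> exists v : nat -> E -> R^o,
  [/\ forall k, tame (v k), nrm (v k - f) @[k --> \oo] --> (0 : R) &
      forall i, nrm ((partial i (v k) : E -> R^o) - g i) @[k --> \oo] --> (0 : R)].
Proof.
move=> lf lg wfg.
pose m k := moll k.+1%:R f.
have lm k : l2 (m k) by exact: moll_l2.
have lmg k i : l2 (moll k.+1%:R (g i)) by exact: moll_l2.
have dm k i x : is_derive x 'e_ i (m k) (moll k.+1%:R (g i) x) by exact: moll_weak_derive.
have pm k i x : partial i (m k) x = moll k.+1%:R (g i) x by exact: partial_val.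
pose v k : E -> R^o := fun x => chi k x * m k x.
have tv k : tame (v k) /\
    forall i x, partial i (v k) x = partial i (chi k) x * m k x + chi k x * partial i (m k) x.
  apply: tame_mul; [exact: chi_tame|exact: moll_continuous|by move=> i x; case: (dm k i x)|].
  pose M := nrm (rho k.+1%:R 0).
  exists (nrm f * M + \sum_i nrm (g i) * M) => x.
  have M0 : 0 <= M by exact: nrm_ge0.
  split.
    rewrite (le_trans (moll_bounded (natS_gt0 k) x lf))// lerDl sumr_ge0// => i _.
    by rewrite mulr_ge0// nrm_ge0.
  move=> i; rewrite pm (le_trans (moll_bounded (natS_gt0 k) x (lg i)))//.
  rewrite (bigD1 i)//= addrCA lerDl addr_ge0//; first by rewrite mulr_ge0// nrm_ge0.
  by rewrite sumr_ge0// => j _; rewrite mulr_ge0// nrm_ge0.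
have [_ cm] := moll_cvg lf.
exists v; split.
- by move=> k; case: (tv k).
- exact: cutoff_cvg.
move=> i.
have [C C0 hC] := @bump_bounds R d.
have [_ cmg] := moll_cvg (lg i).
have cg := cutoff_cvg (lg i) (fun k => lmg k i) cmg.
have bp k x : `|partial i (chi k) x| <= C * k.+1%:R^-1.
  have [_ /(_ i)] := hC k.+1%:R^-1 0 x.
  by rewrite [X in _ <= _ * X]ger0_norm// ltW.
have lchip k : l2 (fun x => partial i (chi k) x * m k x).
  by apply: (l2_mul_bounded _ (bp k) (lm k)); exact: tame_partial_measurable.
have lchi k h : l2 h -> l2 (fun x => chi k x * h x).
  have [_ _ _ [K hK]] := chi_tame k.
  move=> lh; apply: (@l2_mul_bounded _ _ _ _ _ _ K _ _ lh); first exact: tame_measurable.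
  by move=> x; case: (hK x).
have e k : (partial i (v k) : E -> R^o) - g i =
    (fun x => partial i (chi k) x * m k x : R^o) + ((fun x => chi k x * moll k.+1%:R (g i) x : R^o) - g i).
  apply/funext => x; have [_ p] := tv k.
  rewrite -[LHS]/(partial i (v k) x - g i x) p pm.
  by rewrite -[RHS]/(partial i (chi k) x * m k x + (chi k x * moll k.+1%:R (g i) x - g i x)) addrA.
apply: (@squeeze_cvgr _ _ _ _ (fun=> 0)
  (fun k => C * k.+1%:R^-1 * (nrm (m k - f) + nrm f) +
     nrm ((fun x => chi k x * moll k.+1%:R (g i) x : R^o) - g i))).
- apply: nearW => k; rewrite nrm_ge0/= e.
  apply: (le_trans (nrmD (lchip k) (l2B (lchi k _ (lmg k i)) (lg i)))).
  rewrite lerD2r.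
  have Ck : 0 <= C * k.+1%:R^-1 by rewrite mulr_ge0// ltW.
  apply: (@le_trans _ _ (C * k.+1%:R^-1 * nrm (m k))); last first.
    by rewrite ler_wpM2l// -{1}(subrK f (m k)) nrmD//; exact: l2B.
  rewrite -(ger0_norm Ck) -(nrmZ _ (lm k)); apply: le_nrm => //; first exact: l2Z.
  apply: aeW => x; rewrite -[X in _ <= `|X|]/(C * k.+1%:R^-1 * m k x) [leLHS]normrM [leRHS]normrM.
  by rewrite ler_wpM2r// (le_trans (bp k x))// ler_norm.
- exact: cvg_cst.
- rewrite -[X in _ --> X](_ : C * 0 * (0 + nrm f) + 0 = 0); last by rewrite mulr0 mul0r addr0.
  apply: cvgD => //; apply: cvgM; first by apply: cvgMl_tmp; exact: cvg_harmonic.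
  by apply: cvgD => //; exact: cvg_cst.
Qed.

End weak_derivatives.

(** * The energy form on compactly supported functions *)

Section energy.
Context {R : realType} {d : nat}.
Notation E := 'rV[R]_d.
Notation mu := (lebesgue_rV d : {measure set 'rV[R]_d -> \bar R}).
Notation l2 := (l2 mu).
Notation nrm := (nrm mu).
Notation ip := (ip mu).
Implicit Types (u v w f g h : E -> R^o) (x y z : E) (i j : 'I_d).

(** The conditions hold at every point, so that inequalities between energy densities are pointwise;
    [nice_coef_exists] produces such a representative of the given coefficients. *)
Record nice_coef (c : 'I_d -> 'I_d -> E -> R) : Prop := {
  coef_measurable : forall i j, measurable_fun setT (c i j) ;
  coef_bounded : exists K, forall i j x, `|c i j x| <= K ;
  coef_sym : forall i j x, c i j x = c j i x ;
  coef_psd : forall x (xi : 'I_d -> R),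
    0 <= \sum_i \sum_j c i j x * (xi i * xi j) }.

(** Stated for arbitrary vector fields in order to treat classical gradients of tame functions and
    weak gradients of Sobolev functions together. *)
Definition field_bil (c : 'I_d -> 'I_d -> E -> R) (G H : 'I_d -> E -> R^o) : R :=
  \sum_i \sum_j ip (G i) (fun x => c i j x * H j x).

Definition grad u : 'I_d -> E -> R^o := fun i => partial i u.

Definition energy c u v : R := field_bil c (grad u) (grad v).

(* The "carre du champ", i.e. the energy density. *)
Definition carre (c : 'I_d -> 'I_d -> E -> R) u v : E -> R^o :=
  fun x => \sum_i \sum_j c i j x * (partial i u x * partial j v x).

Variable c : 'I_d -> 'I_d -> E -> R.
Hypothesis nc : nice_coef c.

Lemma coef_l2 i j f : l2 f -> l2 (fun x => c i j x * f x).
Proof.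
have [K hK] := coef_bounded nc.
by move=> lf; apply: (l2_mul_bounded (coef_measurable nc i j) (hK i j) lf).
Qed.

Lemma field_bil_cvg (G_ H_ : nat -> 'I_d -> E -> R^o) (G H : 'I_d -> E -> R^o) :
  (forall i, l2 (G i)) -> (forall i, l2 (H i)) ->
  (forall k i, l2 (G_ k i)) -> (forall k i, l2 (H_ k i)) ->
  (forall i, nrm (G_ k i - G i) @[k --> \oo] --> (0 : R)) ->
  (forall i, nrm (H_ k i - H i) @[k --> \oo] --> (0 : R)) ->
  field_bil c (G_ k) (H_ k) @[k --> \oo] --> field_bil c G H.
Proof.
move=> lG lH lG_ lH_ hG hH.
have [K hK] := coef_bounded nc.
apply: cvg_sum_seq => i; apply: cvg_sum_seq => j.
apply: cvg_ip => //; [exact: coef_l2|by move=> k; exact: coef_l2|].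
apply: (@squeeze_cvgr _ _ _ _ (fun=> 0) (fun k => `|K| * nrm (H_ k j - H j))).
- apply: nearW => k; rewrite nrm_ge0/=.
  have lHH := l2B (lH_ k j) (lH j).
  rewrite -(nrmZ K lHH); apply: le_nrm; [by apply: l2B; exact: coef_l2|exact: l2Z|].
  apply: aeW => x; rewrite -[X in `|X| <= _]/(c i j x * H_ k j x - c i j x * H j x) -mulrBr.
  rewrite -[X in _ <= `|X|]/(K * (H_ k j x - H j x)) !normrM ler_wpM2r//.
  by rewrite (le_trans (hK i j x))// ler_norm.
- exact: cvg_cst.
- by rewrite -[X in _ --> X](mulr0 `|K|); apply: cvgMl_tmp.
Qed.

Lemma grad_l2 u i : tame u -> l2 (grad u i).
Proof. exact: tame_partial_l2. Qed.

Lemma carre_term_integ u v i j : tame u -> tame v ->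
  integ mu (fun x => c i j x * (partial i u x * partial j v x)).
Proof.
move=> tu tv; have h := l2_mul (grad_l2 i tu) (coef_l2 i j (grad_l2 j tv)).
by rewrite (_ : (fun x => _) = (fun x => grad u i x * (c i j x * grad v j x)))//; apply/funext => x; rewrite mulrCA.
Qed.

Lemma carre_integ u v : tame u -> tame v -> integ mu (carre c u v).
Proof.
move=> tu tv.
rewrite (_ : carre c u v = \sum_i \sum_j (fun x => c i j x * (partial i u x * partial j v x) : R^o)).
  by apply: integ_sum => i; apply: integ_sum => j; exact: carre_term_integ.
by apply/funext => x; rewrite fct_sumE; apply: eq_bigr => i _; rewrite fct_sumE.
Qed.

Lemma energyE u v : tame u -> tame v -> energy c u v = \int[mu]_x carre c u v x.
Proof.
move=> tu tv; rewrite /carre.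
rewrite (Rintegral_sum _ (F := fun i x => \sum_j c i j x * (partial i u x * partial j v x))); last first.
  move=> i; rewrite (_ : (fun x => _) = \sum_j (fun x => c i j x * (partial i u x * partial j v x) : R^o)).
    by apply: integ_sum => j; exact: carre_term_integ.
  by apply/funext => x; rewrite fct_sumE.
apply: eq_bigr => i _.
rewrite (Rintegral_sum _ (F := fun j x => c i j x * (partial i u x * partial j v x))); last first.
  by move=> j; exact: carre_term_integ.
by apply: eq_bigr => j _; apply: eq_Rintegral => x _; rewrite mulrCA.
Qed.

Lemma carre_ge0 u x : 0 <= carre c u u x.
Proof. exact: coef_psd nc x (fun i => partial i u x). Qed.

Lemma carre_sym u v x : carre c u v x = carre c v u x.
Proof.
rewrite /carre exchange_big/=; apply: eq_bigr => j _; apply: eq_bigr => i _.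
by rewrite (coef_sym nc) [partial i u x * _]mulrC.
Qed.

Lemma carre_lin (a : R) u v w x : tame u -> tame v ->
  carre c (a *: u + v) w x = a * carre c u w x + carre c v w x.
Proof.
move=> tu tv; have [_ p] := tame_lin a tu tv.
rewrite /carre mulr_sumr -big_split/=; apply: eq_bigr => i _.
rewrite mulr_sumr -big_split/=; apply: eq_bigr => j _.
by rewrite p; ring.
Qed.

Lemma energy_semi_inner : semi_inner l2 tame nrm (energy c).
Proof.
split.
- exact: l2_lin.
- exact: nrm_ge0.
- exact: nrmD.
- exact: nrmZ.
- exact: tame_l2.
- exact: tame0.
- by move=> a u v tu tv; case: (tame_lin a tu tv).
- move=> a u v w tu tv tw; have [tuv _] := tame_lin a tu tv.
  rewrite !energyE// -RintegralZl//; last exact: carre_integ.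
  have ih : integ mu (a *: carre c u w) by apply: integZ; exact: carre_integ.
  rewrite -RintegralD_integ; [|exact: ih|exact: carre_integ].
  by apply: eq_Rintegral => x _; rewrite carre_lin.
- move=> u v tu tv; rewrite (energyE tu tv) (energyE tv tu).
  by apply: eq_Rintegral => x _; exact: carre_sym.
- by move=> u tu; rewrite energyE//; apply: Rintegral_ge0 => x _; exact: carre_ge0.
Qed.

Lemma carre_comp (F F' : R -> R) u v (K : R) x : tame u -> (forall t : R, is_derive t 1 F (F' t)) ->
  (forall t, `|F t| <= K * `|t|) -> (forall t, `|F' t| <= K) ->
  carre c (F \o u) v x = F' (u x) * carre c u v x.
Proof.
move=> tu dF FK F'K; have [_ p] := tame_comp tu dF FK F'K.
rewrite /carre mulr_sumr; apply: eq_bigr => i _; rewrite mulr_sumr; apply: eq_bigr => j _.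
by rewrite p; ring.
Qed.

Lemma carre_amgm u v x : 2 * `|carre c u v x| <= carre c u u x + carre c v v x.
Proof.
have key (s : R) : s ^+ 2 = 1 -> 0 <= carre c u u x + 2 * s * carre c u v x + carre c v v x.
  move=> s1; have := coef_psd nc x (fun i => s * partial i u x + partial i v x).
  rewrite (_ : \sum_i _ = s ^+ 2 * carre c u u x + s * carre c u v x + s * carre c v u x + carre c v v x).
    by rewrite s1 (carre_sym v u); lra.
  rewrite /carre !mulr_sumr -!big_split/=; apply: eq_bigr => i _.
  by rewrite !mulr_sumr -!big_split/=; apply: eq_bigr => j _; ring.
have [_|_] := ler0P (carre c u v x).
  by have := key 1 (expr1n _ _); lra.
by have := key (-1) (etrans (sqrrN 1) (expr1n _ _)); lra.
Qed.

End energy.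

(** * Contractions and locality of the relaxed energy *)

Section contractions.
Context {R : realType}.
Implicit Types (s t a e : R).

Lemma lipschitz_of_derive (F F' : R -> R) (K : R) : (forall t, is_derive t 1 F (F' t)) ->
  (forall t, `|F' t| <= K) -> forall s t, `|F t - F s| <= K * `|t - s|.
Proof.
move=> dF F'K.
have cF s t : {within `[s, t], continuous F}.
  by apply: derivable_within_continuous => q _; case: (dF q).
have key s t : s <= t -> `|F t - F s| <= K * `|t - s|.
  move=> st; have [c _ ->] := MVT_segment st (fun q _ => dF q) (cF s t).
  by rewrite normrM ler_wpM2r.
move=> s t; case: (leP s t) => [/key //|/ltW/key].
by rewrite distrC (distrC s t).
Qed.

Lemma lipschitz0 (F F' : R -> R) (K : R) : (forall t, is_derive t 1 F (F' t)) ->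
  (forall t, `|F' t| <= K) -> F 0 = 0 -> forall t, `|F t| <= K * `|t|.
Proof. by move=> dF hF F0 t; have := lipschitz_of_derive dF hF 0 t; rewrite F0 !subr0. Qed.

Definition soft_abs e t : R := Num.sqrt (t ^+ 2 + e ^+ 2).

Lemma soft_abs_gt0 e t : 0 < e -> 0 < t ^+ 2 + e ^+ 2.
Proof. by move=> e0; rewrite ltr_wpDl ?sqr_ge0// exprn_gt0. Qed.

Lemma soft_abs_bounds e t : 0 < e -> `|t| <= soft_abs e t <= `|t| + e.
Proof.
move=> e0; apply/andP; split.
  by rewrite -sqrtr_sqr ler_wsqrtr// lerDl sqr_ge0.
have -> : `|t| + e = Num.sqrt ((`|t| + e) ^+ 2).
  by rewrite sqrtr_sqr [RHS]ger0_norm// addr_ge0// ltW.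
rewrite ler_wsqrtr//.
rewrite sqrrD real_normK ?num_real// -addrA lerD2l lerDr mulrn_wge0//.
by rewrite mulr_ge0// ltW.
Qed.

Lemma is_derive_soft_abs e t a : 0 < e ->
  is_derive t 1 (fun t => soft_abs e (t - a)) ((t - a) / soft_abs e (t - a)).
Proof.
move=> e0.
have h1 : is_derive t 1 (fun t : R => (t - a) ^+ 2 + e ^+ 2) (2 * (t - a)).
  have h : is_derive t 1 (horner (('X - a%:P) * ('X - a%:P) + (e ^+ 2)%:P)) (2 * (t - a)).
    apply: (is_derive_eq (is_derive_poly _ t)).
    by rewrite derivD derivC addr0 derivM derivXsubC mul1r mulr1 hornerD !hornerXsubC; ring.
  move: h; congr (is_derive _ _ _ _).
  by apply/funext => q; rewrite hornerD hornerM !hornerXsubC hornerC expr2.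
apply: (is_derive_eq (@is_derive1_comp _ (@Num.sqrt R) (fun t : R => (t - a) ^+ 2 + e ^+ 2) t _ _ _ h1)).
  exact/is_derive1_sqrt/soft_abs_gt0.
rewrite /soft_abs; have : Num.sqrt ((t - a) ^+ 2 + e ^+ 2) != 0 by rewrite gt_eqF// sqrtr_gt0 soft_abs_gt0.
by move=> ?; field.
Qed.

Lemma soft_abs_slope e t : 0 < e -> `|t / soft_abs e t| <= 1.
Proof.
move=> e0; have s0 : 0 < soft_abs e t by rewrite sqrtr_gt0 soft_abs_gt0.
rewrite normrM normfV (gtr0_norm s0) ler_pdivrMr// mul1r.
by have /andP[] := soft_abs_bounds t e0.
Qed.

(* [min (max t 0) 1 = (|t| - |t - 1| + 1) / 2], with both absolute values
   smoothed. *)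
Definition soft_clip e t : R :=
  (soft_abs e (t - 0) - soft_abs e (t - 1) + (soft_abs e 1 - e)) / 2.

Definition soft_clip' e t : R := ((t - 0) / soft_abs e (t - 0) - (t - 1) / soft_abs e (t - 1)) / 2.

Lemma is_derive_soft_clip e t : 0 < e -> is_derive t 1 (soft_clip e) (soft_clip' e t).
Proof.
move=> e0.
have h0 := is_derive_soft_abs t 0 e0; have h1 := is_derive_soft_abs t 1 e0.
have h2 := is_deriveD (is_deriveB h0 h1) (is_derive_cst (soft_abs e 1 - e : R^o) t 1).
have h3 := is_deriveZ (2^-1 : R) h2.
rewrite (_ : soft_clip e = 2^-1 *: ((fun q : R => soft_abs e (q - 0)) - (fun q => soft_abs e (q - 1)) + cst (soft_abs e 1 - e)) :> (R^o -> R^o)).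
  by apply: (is_derive_eq h3); rewrite addr0 /soft_clip' -[_ *: _]/(_ * _) mulrC.
by apply/funext => q; rewrite /soft_clip mulrC.
Qed.

Lemma soft_clip'_le1 e t : 0 < e -> `|soft_clip' e t| <= 1.
Proof.
move=> e0; rewrite /soft_clip' normrM normfV (@ger0_norm _ 2)// ler_pdivrMr// mul1r.
rewrite (le_trans (ler_normB _ _))//.
have := soft_abs_slope (t - 0) e0; have := soft_abs_slope (t - 1) e0; lra.
Qed.

Lemma soft_clip0 e : 0 < e -> soft_clip e 0 = 0.
Proof.
move=> e0; rewrite /soft_clip subr0 sub0r.
have -> : soft_abs e 0 = e by rewrite /soft_abs expr0n add0r sqrtr_sqr gtr0_norm.
have -> : soft_abs e (-1) = soft_abs e 1 by rewrite /soft_abs sqrrN.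
by ring.
Qed.

Definition clip t : R := Num.min (Num.max t 0) 1.

Lemma clipE t : clip t = (`|t| - `|t - 1| + 1) / 2.
Proof.
rewrite /clip; have [t0|t0] := leP t 0.
  rewrite min_l// (ler0_norm t0) ler0_norm; lra.
have [t1|t1] := leP t 1; first by rewrite (gtr0_norm t0) ler0_norm; lra.
rewrite (gtr0_norm t0) gtr0_norm; lra.
Qed.

Lemma soft_clip_dist e t : 0 < e -> `|soft_clip e t - clip t| <= 2 * e.
Proof.
move=> e0; rewrite clipE /soft_clip.
have /andP[a1 a2] := soft_abs_bounds (t - 0) e0.
have /andP[b1 b2] := soft_abs_bounds (t - 1) e0.
have /andP[c1 c2] := soft_abs_bounds 1 e0.
rewrite subr0 in a1 a2 *; rewrite normr1 in c1 c2.
by rewrite ler_norml; apply/andP; split; lra.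
Qed.

Lemma clip_lipschitz s t : `|clip s - clip t| <= `|s - t|.
Proof.
rewrite !clipE.
have h1 := ler_dist_dist s t; have h2 := ler_dist_dist (s - 1) (t - 1).
have e1 : s - 1 - (t - 1) = s - t by ring.
rewrite e1 in h2; move: h1 h2; rewrite !ler_norml => /andP[? ?] /andP[? ?].
by apply/andP; split; lra.
Qed.

(** The primitive, vanishing at 0, of a Lorentzian of width [e] centred at [-a]: it has slope 1 at
    [-a], where the level set of interest lies, yet total oscillation of order [e]. *)
Definition atan_step a e t : R := e * (atan ((t + a) / e) - atan (a / e)).

Definition atan_step' a e t : R := (1 + ((t + a) / e) ^+ 2)^-1.

Lemma is_derive_atan_step a e t : 0 < e -> is_derive t 1 (atan_step a e) (atan_step' a e t).
Proof.
move=> e0.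
have h1 : is_derive t 1 (fun t : R => (t + a) / e) e^-1.
  have h : is_derive t 1 (horner (e^-1 *: ('X + a%:P))) e^-1.
    apply: (is_derive_eq (is_derive_poly _ t)).
    by rewrite derivZ derivD derivX derivC addr0 hornerZ hornerC mulr1.
  move: h; congr (is_derive _ _ _ _).
  by apply/funext => q; rewrite hornerZ hornerD hornerX hornerC mulrC.
have h2 := @is_derive1_comp _ atan (fun t : R => (t + a) / e) t _ _ (is_derive1_atan _) h1.
have h3 := is_deriveZ e (is_deriveB h2 (is_derive_cst (atan (a / e) : R^o) t 1)).
apply: (is_derive_eq h3); rewrite subr0 /atan_step' -[_ *: _]/(_ * _) mulrC -mulrA mulVf ?mulr1//.
by rewrite gt_eqF.
Qed.

Lemma atan_step'_bounds a e t : 0 <= atan_step' a e t <= 1.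
Proof.
have h : 0 <= ((t + a) / e) ^+ 2 by exact: sqr_ge0.
rewrite /atan_step' invr_ge0 invf_le1; first by apply/andP; split; lra.
lra.
Qed.

Lemma atan_step'_le1 a e t : `|atan_step' a e t| <= 1.
Proof. by have /andP[h1 h2] := atan_step'_bounds a e t; rewrite ger0_norm. Qed.

Lemma atan_step0 a e : atan_step a e 0 = 0.
Proof. by rewrite /atan_step add0r subrr mulr0. Qed.

Lemma atan_step_small a e t : 0 < e -> `|atan_step a e t| <= e * pi.
Proof.
move=> e0; rewrite normrM (gtr0_norm e0) ler_pM2l//.
have := atan_gtNpi2 ((t + a) / e); have := atan_ltpi2 ((t + a) / e).
have := atan_gtNpi2 (a / e); have := atan_ltpi2 (a / e).
by rewrite ler_norml => ? ? ? ?; apply/andP; split; lra.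
Qed.

(** With q = (t + a)/e the complement is q^2/(1 + q^2), which is at most |q|. This linear vanishing
    at [t = -a] is what converts the relation between [f] and [g] into smallness of the weight. *)
Lemma atan_step_complement a e t : 0 < e ->
  0 <= 1 - atan_step' a e t <= 1 /\ 1 - atan_step' a e t <= `|t + a| / e.
Proof.
move=> e0; have /andP[h1 h2] := atan_step'_bounds a e t.
split; first by apply/andP; split; lra.
have -> : `|t + a| / e = `|(t + a) / e| by rewrite normrM normfV (gtr0_norm e0).
rewrite /atan_step'; set q := (t + a) / e.
have q2 : 0 <= q ^+ 2 := sqr_ge0 q.
have q1 : 0 < 1 + q ^+ 2 by lra.
rewrite -(@ler_pM2r _ (1 + q ^+ 2))// mulrBl mul1r mulVf ?gt_eqF// [1 + _]addrC addrK.
rewrite -[q ^+ 2]real_normK ?num_real//.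
by have := normr_ge0 q; nra.
Qed.

End contractions.


(** * The Markov property of the relaxed energy *)

Section relaxed_energy.
Context {R : realType} {d : nat}.
Notation E := 'rV[R]_d.
Notation mu := (lebesgue_rV d : {measure set 'rV[R]_d -> \bar R}).
Notation l2 := (l2 mu).
Notation nrm := (nrm mu).
Notation ip := (ip mu).
Implicit Types (u v w f g h : E -> R^o) (x y z : E) (i j : 'I_d) (e : R).

Variable c : 'I_d -> 'I_d -> E -> R.
Hypothesis nc : nice_coef c.

Notation en := (energy c).
Notation dom := (rdom l2 tame nrm en).
Notation q0 := (relax tame nrm en).
Notation b0 := (relax_bil tame nrm en).

Let H := energy_semi_inner nc.

(** Composition multiplies the energy density by the square of [F' (u x)], which is at most 1. *)
Lemma energy_comp_le (F F' : R -> R) u : tame u -> (forall t : R, is_derive t 1 F (F' t)) ->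
  (forall t, `|F t| <= 1 * `|t|) -> (forall t, `|F' t| <= 1) ->
  tame (F \o u) /\ en (F \o u) (F \o u) <= en u u.
Proof.
move=> tu dF FK F'K; have [tF _] := tame_comp tu dF FK F'K; split; first exact: tF.
rewrite (energyE nc tF tF) (energyE nc tu tu); apply: le_Rintegral => //.
- exact: carre_integ.
- exact: carre_integ.
move=> x _; rewrite (carre_comp _ _ _ tu dF FK F'K) carre_sym// (carre_comp _ _ _ tu dF FK F'K) mulrA.
rewrite ler_piMl ?carre_ge0// -expr2 -real_normK ?num_real// expr_le1//.
Qed.

Lemma clip_fun_l2 f : l2 f -> l2 (clip \o f).
Proof.
move=> lf; have mf := l2_measurable lf.
apply: (l2_le _ lf).
  apply: measurable_minr; last exact: measurable_cst.
  by apply: measurable_maxr => //; exact: measurable_cst.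
move=> x /=; have := clip_lipschitz (f x) 0.
by rewrite (_ : clip 0 = 0) ?subr0// /clip maxxx min_l.
Qed.

Lemma relax_clip f : dom f -> dom (clip \o f) /\ q0 (clip \o f) <= q0 f.
Proof.
move=> df; have lf := rdom_amb df.
have lcf := clip_fun_l2 lf.
apply: (rdomP H lcf) => e e0.
have e2 : 0 < e / 2 by rewrite divr_gt0.
have [u [tu nu bu]] := relax_upper H df e2.
have lu := tame_l2 tu; have lcu := clip_fun_l2 lu.
have [_ [r hr] _ _] := tu.
pose r1 := Num.max r 1.
have r10 : 0 < r1 by rewrite lt_max ltr01 orbT.
pose S := Num.sqrt ((2 * r1) ^+ d).
have S0 : 0 <= S by rewrite sqrtr_ge0.
(* The smoothing error is at most [2 * k] on a cube whose volume has square root [S], hence at most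
   [2 * k * S] in L_2; dividing by [S + 1] makes this strictly less than [e / 2]. *)
pose k := e / 2 / (2 * (S + 1)).
have k0 : 0 < k by rewrite !divr_gt0// mulr_gt0// ltr_wpDl.
have dF t := @is_derive_soft_clip R k t k0.
have F'1 t := @soft_clip'_le1 R k t k0.
have F1 := lipschitz0 dF F'1 (soft_clip0 k0).
have [tF eF] := energy_comp_le tu dF F1 F'1.
exists (soft_clip k \o u); split; [exact: tF| |].
  2: by apply: (le_trans eF); apply: (le_trans (ltW bu)); rewrite lerD2l ler_pdivrMr// ler_pMr ?ltr0n// ler1n.
have h1 : nrm ((soft_clip k \o u) - (clip \o u)) <= 2 * k * S.
  apply: (bounded_support_nrm _ _ _ r10).
  - exact: l2_measurable (l2B (tame_l2 tF) lcu).
  - move=> x nx; rewrite -[LHS]/(soft_clip k (u x) - clip (u x)) hr.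
      by rewrite soft_clip0// /clip maxxx min_l ?subrr.
    by move=> cx; apply: nx; apply: cubeS cx; rewrite le_max lexx.
  - by move=> x; exact: soft_clip_dist.
have h2 : nrm ((clip \o u) - (clip \o f)) <= nrm (u - f).
  apply: le_nrm; [exact: l2B|exact: l2B|].
  by apply: aeW => x; exact: clip_lipschitz.
have h3 := nrm_dist (tame_l2 tF) lcu lcf.
have h4 : 2 * k * S < e / 2.
  rewrite /k invfM !mulrA -[2 * e]mulrC [e * 2 / 2]mulfK ?pnatr_eq0//.
  have -> : e / 2 / (S + 1) * S = e / 2 * (S / (S + 1)) by rewrite mulrA mulrAC.
  by rewrite gtr_pMr// ltr_pdivrMr ?ltr_wpDl// mul1r ltrDl.
move: h1 h2 h3 h4 nu; clear; lra.
Qed.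

End relaxed_energy.

(** * Locality of the relaxed energy *)

Section locality.
Context {R : realType} {d : nat}.
Notation E := 'rV[R]_d.
Notation mu := (lebesgue_rV d : {measure set 'rV[R]_d -> \bar R}).
Notation l2 := (l2 mu).
Notation nrm := (nrm mu).
Notation ip := (ip mu).
Implicit Types (u v w f g h : E -> R^o) (x y z : E) (i j : 'I_d) (e : R).

Variable c : 'I_d -> 'I_d -> E -> R.
Hypothesis nc : nice_coef c.

Notation en := (energy c).
Notation dom := (rdom l2 tame nrm en).
Notation q0 := (relax tame nrm en).
Notation b0 := (relax_bil tame nrm en).

Let H := energy_semi_inner nc.

Let F_ a e : R -> R := atan_step a e.
Let G_ a e : R -> R := fun t => t - atan_step a e t.
Let F'_ a e : R -> R := atan_step' a e.
Let G'_ a e : R -> R := fun t => 1 - atan_step' a e t.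

Let dF a e (t : R) : 0 < e -> is_derive t 1 (F_ a e) (F'_ a e t).
Proof. exact: is_derive_atan_step. Qed.

Let dG a e (t : R) : 0 < e -> is_derive t 1 (G_ a e) (G'_ a e t).
Proof. by move=> e0; exact: (is_deriveB (is_derive_id t (1 : R)) (dF a t e0)). Qed.

Let F'1 a e t : `|F'_ a e t| <= 1. Proof. exact: atan_step'_le1. Qed.

Let G'1 a e t : `|G'_ a e t| <= 1.
Proof.
have /andP[h1 h2] := atan_step'_bounds a e t.
by rewrite ger0_norm /G'_; lra.
Qed.

Let F1 a e t : 0 < e -> `|F_ a e t| <= 1 * `|t|.
Proof. by move=> e0; apply: (lipschitz0 (fun t => dF a t e0)) => //; exact: atan_step0. Qed.

Let G1 a e t : 0 < e -> `|G_ a e t| <= 1 * `|t|.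
Proof.
move=> e0; apply: (lipschitz0 (fun t => dG a t e0)) => //.
by rewrite /G_ atan_step0 subr0.
Qed.

(** The uniform bound on the step yields pointwise convergence only, since constants are not
    square-integrable on an infinite measure space; [f] itself dominates, the step being a
    contraction that fixes 0. *)
Lemma atan_step_cvg a f : l2 f ->
  nrm (F_ a k.+1%:R^-1 \o f) @[k --> \oo] --> (0 : R).
Proof.
move=> lf; have mf := l2_measurable lf.
have k0 (k : nat) : 0 < k.+1%:R^-1 :> R by rewrite invr_gt0 ltr0n.
have mF k : measurable_fun setT (F_ a k.+1%:R^-1 \o f).
  apply: measurableT_comp mf; apply: continuous_measurable_fun => t.
  by apply: derivable_continuous1; case: (dF a t (k0 k)).
have h := @nrm_dominated _ _ _ mu (fun k => F_ a k.+1%:R^-1 \o f) 0 f mF (l2_0 mu) lf.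
have -> : (fun k : nat => nrm (F_ a k.+1%:R^-1 \o f)) = fun k : nat => nrm ((F_ a k.+1%:R^-1 \o f) - 0).
  by apply/funext => k; rewrite subr0.
apply: h.
- apply: aeW => x; apply: (@squeeze_cvgr _ _ _ _ (fun k => - (k.+1%:R^-1 * pi)) (fun k => k.+1%:R^-1 * pi)).
  + by apply: nearW => k; rewrite -ler_norml; exact: atan_step_small.
  + by rewrite -[X in _ --> X](_ : - (0 * pi) = 0 :> R); [apply: cvgN; apply: cvgMr_tmp; exact: cvg_harmonic|rewrite mul0r oppr0].
  + by rewrite -[X in _ --> X](mul0r pi); apply: cvgMr_tmp; exact: cvg_harmonic.
- by move=> k x; rewrite -[leRHS]mul1r; exact: F1.
Qed.

(** Boundedness of the partial derivatives gives square integrability of the density, so that it can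
    be paired with weights that are small only in L_2. *)
Lemma carre_l2 u : tame u -> l2 (carre c u u).
Proof.
move=> tu; have [r [_ hr]] := tame_partial_support tu; have [_ _ _ [K hK]] := tu.
have [C hC] := coef_bounded nc.
apply: (@bounded_support_l2 _ _ _ r (\sum_(i < d) \sum_(j < d) C * (K * K))).
- exact: integ_measurable (carre_integ nc tu tu).
- by move=> x nx; rewrite /carre big1// => i _; rewrite big1// => j _; rewrite hr// mul0r mulr0.
- move=> x; rewrite (le_trans (ler_norm_sum _ _ _))//; apply: ler_sum => i _.
  rewrite (le_trans (ler_norm_sum _ _ _))//; apply: ler_sum => j _.
  have [_ h] := hK x.
  by rewrite !normrM; apply: ler_pM => //; rewrite ?mulr_ge0//; apply: ler_pM.
Qed.


Lemma carre_split u v x : tame u -> tame v ->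
  carre c u u x <= 2 * carre c v v x + 2 * carre c (u - v) (u - v) x.
Proof.
move=> tu tv; have tuv : tame (u - v) by exact: (domB H).
have e1 w : tame w -> carre c u w x = carre c (u - v) w x + carre c v w x.
  by move=> tw; rewrite -[X in carre c X](subrK v) -{1}[u - v]scale1r carre_lin// mul1r.
have : carre c u u x = carre c (u - v) (u - v) x + 2 * carre c (u - v) v x + carre c v v x.
  rewrite e1// (carre_sym nc _ u) (carre_sym nc v) !e1// (carre_sym nc v).
  ring.
have := carre_amgm nc (u - v) v x; have := ler_norm (carre c (u - v) v x).
move: (carre c _ _ x) (carre c _ _ x) (carre c _ _ x) (carre c _ _ x).
by move=> A B C D; lra.
Qed.

Lemma weighted_energy_cvg f (u w p : nat -> E -> R^o) : dom f ->
  minimizing tame nrm en f u -> (forall k, measurable_fun setT (w k)) ->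
  (forall k x, 0 <= w k x <= 1) -> (forall k, l2 (p k)) ->
  nrm (p k) @[k --> \oo] --> (0 : R) ->
  (forall k, {ae mu, forall x, w k x <= p k x}) ->
  (forall k, integ mu (fun x => w k x * carre c (u k) (u k) x)) /\
  \int[mu]_x (w k x * carre c (u k) (u k) x) @[k --> \oo] --> (0 : R).
Proof.
move=> df mu_ mw w01 lp np wp; have [tu _ _] := mu_.
have iw k v : tame v -> integ mu (fun x => w k x * carre c v v x).
  move=> tv; have ic := carre_integ nc tv tv; apply: (integ_le _ ic).
    by apply: measurable_funM => //; exact: integ_measurable ic.
  move=> x; have /andP[h1 h2] := w01 k x.
  by rewrite normrM (ger0_norm h1) ler_piMl.
split; first by move=> k; exact: iw.
apply/cvgr0Pnorm_le => e e0.
have e4 : 0 < e / 4 by rewrite divr_gt0.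
have arith (A B : R) : A <= e / 4 -> B < e / 4 -> 2 * A + 2 * B <= e.
  by lra.
have [N hN] := minseq_cauchy H df mu_ e4.
have nG := nrm_ge0 mu (carre c (u N) (u N)).
pose q := e / 4 / (nrm (carre c (u N) (u N)) + 1).
have q0 : 0 < q by rewrite divr_gt0// ltr_wpDl.
have /cvgr0Pnorm_le/(_ _ q0) hq := np.
near=> k.
have Nk : (N <= k)%N by near: k; exact: nbhs_infty_ge.
have : `|nrm (p k)| <= q by near: k.
rewrite ger0_norm ?nrm_ge0// => nq.
have tuk : tame (u k - u N) by exact: (domB H).
have lG := carre_l2 (tu N).
have iG := carre_integ nc tuk tuk.
have ipG := l2_mul (lp k) lG.
rewrite ger0_norm; last first.
  by apply: Rintegral_ge0 => x _; have /andP[h _] := w01 k x; rewrite mulr_ge0// (carre_ge0 nc).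
have h1 : \int[mu]_x (w k x * carre c (u k) (u k) x) <=
    \int[mu]_x ((2 : R) *: (fun x => p k x * carre c (u N) (u N) x : R^o) + (2 : R) *: carre c (u k - u N) (u k - u N)) x.
  apply: le_ae_Rintegral; [exact: iw|exact: (integ_lin 2 ipG (integZ 2 iG))|].
  apply: filterS (wp k) => x wpx.
  rewrite -[leRHS]/(2 * (p k x * carre c (u N) (u N) x) + 2 * carre c (u k - u N) (u k - u N) x).
  have /andP[w0 w1] := w01 k x.
  have := carre_split x (tu k) (tu N).
  have := carre_ge0 nc (u N) x; have := carre_ge0 nc (u k - u N) x.
  set A := carre c (u k - u N) _ x; set B := carre c (u N) _ x; set C := carre c (u k) _ x.
  move=> A0 B0 hC.
  have : w k x * C <= w k x * (2 * B + 2 * A) by rewrite ler_wpM2l.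
  have : w k x * A <= A by rewrite ler_piMl.
  have : w k x * B <= p k x * B by rewrite ler_wpM2r.
  lra.
apply: (le_trans h1).
rewrite (RintegralD_integ (integZ 2 ipG) (integZ 2 iG)) !RintegralZ_integ//.
rewrite -(energyE nc tuk tuk).
have h2 := hN k N Nk (leqnn _).
have h3 : ip (p k) (carre c (u N) (u N)) <= e / 4.
  apply: (le_trans (ler_norm _)); apply: (le_trans (cauchy_schwarz (lp k) lG)).
  apply: (@le_trans _ _ (q * nrm (carre c (u N) (u N)))); first by rewrite ler_wpM2r.
  by rewrite /q mulrAC ler_pdivrMr ?ltr_wpDl// ler_pM2l// lerDl.
exact: arith h3 h2.
Unshelve. all: by end_near. Qed.


Let comp_F a e u : tame u -> 0 < e -> tame (F_ a e \o u) /\ en (F_ a e \o u) (F_ a e \o u) <= en u u.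
Proof.
by move=> tu e0; exact: (energy_comp_le nc tu (fun t => dF a t e0) (fun t => F1 a t e0) (F'1 a e)).
Qed.

Let comp_G a e u : tame u -> 0 < e -> tame (G_ a e \o u) /\ en (G_ a e \o u) (G_ a e \o u) <= en u u.
Proof.
by move=> tu e0; exact: (energy_comp_le nc tu (fun t => dG a t e0) (fun t => G1 a t e0) (G'1 a e)).
Qed.

Let comp_FG a e u : u = (F_ a e \o u) + (G_ a e \o u).
Proof. by apply/funext => x; rewrite -[RHS]/(F_ a e (u x) + (u x - F_ a e (u x))) addrC subrK. Qed.

Let energy_splitr a e u v : tame u -> tame v -> 0 < e ->
  en v u = en v (F_ a e \o u) + en v (G_ a e \o u).
Proof.
move=> tu tv e0; have [tF _] := comp_F a tu e0; have [tG _] := comp_G a tu e0.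
apply: etrans (bilDr H tF tG tv).
congr (energy c _ _).
exact: comp_FG.
Qed.

Let energy_splitl a e u v : tame u -> tame v -> 0 < e ->
  en u v = en (F_ a e \o u) v + en (G_ a e \o u) v.
Proof.
move=> tu tv e0; have [tF _] := comp_F a tu e0; have [tG _] := comp_G a tu e0.
have s1 := bil_sym H tu tv.
have s2 := bil_sym H tv tF.
have s3 := bil_sym H tv tG.
have s4 := energy_splitr a tu tv e0.
have s5 := etrans s1 s4.
have s6 := congr2 +%R s2 s3.
have s7 := etrans s5 s6.
exact: s7.

Qed.

Let carre_F a e u v x : tame u -> 0 < e -> carre c (F_ a e \o u) v x = F'_ a e (u x) * carre c u v x.
Proof.
by move=> tu e0; exact: (carre_comp c v x tu (fun t => dF a t e0) (fun t => F1 a t e0) (F'1 a e)).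
Qed.

Let carre_G a e u v x : tame u -> 0 < e -> carre c (G_ a e \o u) v x = G'_ a e (u x) * carre c u v x.
Proof.
by move=> tu e0; exact: (carre_comp c v x tu (fun t => dG a t e0) (fun t => G1 a t e0) (G'1 a e)).
Qed.

(** The slope lies between 0 and 1 and so dominates its square. The energy of the step is thereby
    controlled by an interaction with [u] itself, to which the orthogonality principle applies. *)
Let energy_F_le a e u : tame u -> 0 < e -> en (F_ a e \o u) (F_ a e \o u) <= en u (F_ a e \o u).
Proof.
move=> tu e0; have [tF _] := comp_F a tu e0.
rewrite (energyE nc tF tF) (energyE nc tu tF); apply: le_Rintegral.
- exact: measurableT.
- exact: carre_integ.
- exact: carre_integ.
move=> x _; rewrite carre_F// (carre_sym nc u) carre_F//.
have /andP[h1 h2] := atan_step'_bounds a e (u x).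
by rewrite ler_piMl// mulr_ge0// (carre_ge0 nc).
Qed.

Let norm_F_le a e u f : l2 u -> l2 f -> 0 < e ->
  tame u -> nrm (F_ a e \o u) <= nrm (u - f) + nrm (F_ a e \o f).
Proof.
move=> lu lf e0 tu; have lF := tame_l2 (proj1 (comp_F a tu e0)).
have lFf : l2 (F_ a e \o f).
  apply: (l2_le _ lf) => [|x]; last by rewrite -[leRHS]mul1r; exact: F1.
  apply: measurableT_comp (l2_measurable lf); apply: continuous_measurable_fun => t.
  by apply: derivable_continuous1; case: (dF a t e0).
rewrite -[X in nrm X](subrK (F_ a e \o f)) (le_trans (nrmD (l2B lF lFf) lFf))// lerD2r.
apply: le_nrm; [exact: l2B|exact: l2B|apply: aeW => x].
rewrite -[leRHS]mul1r; exact: (lipschitz_of_derive (fun t => dF a t e0) (F'1 a e)).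
Qed.

Let measurable_G' a e u : measurable_fun setT u -> measurable_fun setT (G'_ a e \o u).
Proof.
move=> mu_; apply: measurableT_comp mu_; apply: continuous_measurable_fun => t.
apply: cvgB; first exact: cvg_cst.
apply: cvgV; first by rewrite gt_eqF// ltr_pwDl// sqr_ge0.
apply: cvgD; first exact: cvg_cst.
have h : (fun q : R => (q + a) / e) q @[q --> t] --> (t + a) / e.
  by apply: cvgMr_tmp; apply: cvgD; [exact: cvg_id|exact: cvg_cst].
by rewrite expr2; under eq_fun do rewrite expr2; exact: cvgM.
Qed.

(** The chain rule in both arguments puts the product of slopes in front of the mixed density of [v]
    and [u]; the pointwise inequality [carre_amgm] then separates the two functions. *)
Let energy_G_le a e u v : tame u -> tame v -> 0 < e ->
  2 * `|en (G_ 0 e \o v) (G_ a e \o u)| <=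
  \int[mu]_x (G'_ 0 e (v x) * G'_ a e (u x) * carre c v v x) +
  \int[mu]_x (G'_ 0 e (v x) * G'_ a e (u x) * carre c u u x).
Proof.
move=> tu tv e0.
have [tGv _] := comp_G 0 tv e0; have [tGu _] := comp_G a tu e0.
pose w : E -> R^o := fun x => G'_ 0 e (v x) * G'_ a e (u x).
have w01 x : 0 <= w x <= 1.
  have [/andP[h1 h2] _] := atan_step_complement 0 (v x) e0.
  have [/andP[h3 h4] _] := atan_step_complement a (u x) e0.
  by rewrite mulr_ge0//= mulr_ile1.
have mw : measurable_fun setT w.
  by apply: measurable_funM; apply: measurable_G'; exact: l2_measurable (tame_l2 _).
have iw u1 : tame u1 -> integ mu (fun x => w x * carre c u1 u1 x).
  move=> t1; have ic := carre_integ nc t1 t1; apply: (integ_le _ ic).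
    by apply: measurable_funM => //; exact: integ_measurable ic.
  by move=> x; have /andP[h1 h2] := w01 x; rewrite normrM (ger0_norm h1) ler_piMl.
have iG := carre_integ nc tGv tGu.
have cE x : carre c (G_ 0 e \o v) (G_ a e \o u) x = w x * carre c v u x.
  by rewrite carre_G// (carre_sym nc) carre_G// (carre_sym nc u) mulrA.
rewrite (energyE nc tGv tGu) -(RintegralD_integ (iw _ tv) (iw _ tu)).
apply: (@le_trans _ _ (2 * \int[mu]_x `|carre c (G_ 0 e \o v) (G_ a e \o u) x|)).
  by rewrite ler_pM2l//; exact: le_normr_Rintegral.
rewrite -(RintegralZ_integ 2 (f := fun x => `|carre c (G_ 0 e \o v) (G_ a e \o u) x|)); last first.
  apply: (integ_le _ iG); last by move=> x; rewrite normr_id.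
  by apply: measurableT_comp => //; exact: integ_measurable iG.
apply: le_Rintegral; first exact: measurableT.
- apply: integZ; apply: (integ_le _ iG); last by move=> x; rewrite normr_id.
  by apply: measurableT_comp => //; exact: integ_measurable iG.
- exact: integD (iw _ tv) (iw _ tu).
move=> x _; rewrite -[leLHS]/(2 * `|carre c (G_ 0 e \o v) (G_ a e \o u) x|) cE.
have /andP[h1 h2] := w01 x.
rewrite normrM (ger0_norm h1) mulrCA -mulrDr ler_wpM2l//.
exact: carre_amgm.
Qed.


(** Almost every point has [f = -a] or [g = 0]. In the first case the slope at [u_ k] is at most
    |u_k - f|/e, in the second the slope at [v_ k] is at most |v_k - g|/e, and the other slope is at
    most 1. *)
Let weight_cvg a e f g (u_ v_ : nat -> E -> R^o) : l2 f -> l2 g -> 0 < e ->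
  (forall k, l2 (u_ k)) -> (forall k, l2 (v_ k)) ->
  {ae mu, forall x, (f x + a) * g x = 0} ->
  nrm (u_ k - f) @[k --> \oo] --> (0 : R) -> nrm (v_ k - g) @[k --> \oo] --> (0 : R) ->
  exists p : nat -> E -> R^o, [/\ forall k, l2 (p k), nrm (p k) @[k --> \oo] --> (0 : R) &
    forall k, {ae mu, forall x, G'_ 0 e (v_ k x) * G'_ a e (u_ k x) <= p k x}].
Proof.
move=> lf lg e0 lu lv fg0 nu nv.
pose abs f : E -> R^o := fun x => `|f x|.
have labs f1 : l2 f1 -> l2 (abs f1).
  move=> lf1; apply: (l2_le _ lf1); last by move=> x; rewrite normr_id.
  by apply: measurableT_comp => //; exact: l2_measurable lf1.
have nabs f1 : l2 f1 -> nrm (abs f1) <= nrm f1.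
  by move=> lf1; apply: le_nrm => //; [exact: labs|apply: aeW => x; rewrite normr_id].
have luf k := l2B (lu k) lf; have lvg k := l2B (lv k) lg.
have lp k := l2Z e^-1 (l2D (labs _ (luf k)) (labs _ (lvg k))).
exists (fun k => e^-1 *: (abs (u_ k - f) + abs (v_ k - g))); split=> //.
- apply: (@squeeze_cvgr _ _ _ _ (fun=> 0) (fun k => e^-1 * (nrm (u_ k - f) + nrm (v_ k - g)))).
  + apply: nearW => k; rewrite nrm_ge0/= (nrmZ _ (l2D (labs _ (luf k)) (labs _ (lvg k)))).
    rewrite gtr0_norm ?invr_gt0// ler_pM2l ?invr_gt0//.
    by rewrite (le_trans (nrmD (labs _ (luf k)) (labs _ (lvg k))))// lerD// nabs.
  + exact: cvg_cst.
  + by rewrite -[X in _ --> X](_ : e^-1 * (0 + 0) = 0); [apply: cvgMl_tmp; exact: cvgD|rewrite addr0 mulr0].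
- move=> k; apply: filterS fg0 => x /eqP; rewrite mulf_eq0.
  rewrite -[X in _ <= X]/(e^-1 * (`|u_ k x - f x| + `|v_ k x - g x|)) [leRHS]mulrDr.
  have [/andP[v0 v1] vb] := atan_step_complement 0 (v_ k x) e0.
  have [/andP[u0 u1] ub] := atan_step_complement a (u_ k x) e0.
  have iu : 0 <= e^-1 * `|u_ k x - f x| by rewrite mulr_ge0// invr_ge0 ltW.
  have iv : 0 <= e^-1 * `|v_ k x - g x| by rewrite mulr_ge0// invr_ge0 ltW.
  case/orP => /eqP h.
  + apply: (@le_trans _ _ (e^-1 * `|u_ k x - f x|)); last by rewrite lerDl.
    apply: (@le_trans _ _ (G'_ a e (u_ k x))); first by rewrite ler_piMl.
    by rewrite [leRHS]mulrC (_ : u_ k x - f x = u_ k x + a)// -(subr0 (_ + a)) -h; ring.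
  + apply: (@le_trans _ _ (e^-1 * `|v_ k x - g x|)); last by rewrite lerDr.
    apply: (@le_trans _ _ (G'_ 0 e (v_ k x))); first by rewrite ler_piMr.
    by rewrite [leRHS]mulrC h subr0 -[X in `|X|]addr0.
Qed.

Lemma relax_local a f g : dom f -> dom g ->
  {ae mu, forall x, (f x + a) * g x = 0} -> b0 g f = 0.
Proof.
move=> df dg fg0.
have [u mu_] := minseq_exists H df; have [v mv] := minseq_exists H dg.
apply: cvg_lim_eq (relax_bil_cvg H dg df mv mu_) _.
have [tu nu _] := mu_; have [tv nv _] := mv.
have lf := rdom_amb df; have lg := rdom_amb dg.
have lu k := tame_l2 (tu k); have lv k := tame_l2 (tv k).
have [Mu hMu] := minseq_bounded mu_; have [Mv hMv] := minseq_bounded mv.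
pose M := Num.max Mu Mv.
have hu k : en (u k) (u k) <= M by rewrite le_max hMu.
have hv k : en (v k) (v k) <= M by rewrite le_max hMv orbT.
have M0 : 0 <= M by rewrite (le_trans _ (hu 0%N))// (bil_ge0 H).
have M1 : 0 < M + 1 by rewrite ltr_wpDl.
apply/cvgr0Pnorm_le => r r0.
have r4 : 0 < r / 4 by rewrite divr_gt0.
(* The weight in [bil_amgm] for the mixed term of [F_ 0 e \o v k] with [G_ a e \o u k]: the energy
   of the latter is only bounded by [M], so the former must have energy at most [r / 4 / t], which
   is what [d2] secures. *)
pose t := (M + 1) / (r / 4).
have t0 : 0 < t by rewrite divr_gt0.
have tM : t^-1 * M <= r / 4.
  by rewrite /t invf_div mulrAC ler_pdivrMr// ler_pM2l// lerDl.
have r't : 0 < r / 4 / t by rewrite divr_gt0.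
have [d1 d10 hd1] := relax_orth H dg M0 r4.
have [d2 d20 hd2] := relax_orth H dg M0 r't.
pose dl := Num.min d1 d2.
have dl0 : 0 < dl by rewrite lt_min d10.
have dl2 : 0 < dl / 2 by rewrite divr_gt0.
have /cvgr0Pnorm_lt/(_ _ dl2) ha := atan_step_cvg a lf.
have /cvgr0Pnorm_lt/(_ _ dl2) hb := atan_step_cvg 0 lg.
(* The scale [e] is fixed here, before [k] tends to infinity, because the weight estimate carries a
   factor [e^-1]. It is chosen from the limits [f] and [g]; contraction transfers the smallness to
   [u k] and [v k]. *)
have [m [nFa nFb]] : exists m : nat, nrm (F_ a m.+1%:R^-1 \o f) < dl / 2 /\
    nrm (F_ 0 m.+1%:R^-1 \o g) < dl / 2.
  near \oo => m; exists m; split; rewrite -[ltLHS]ger0_norm ?nrm_ge0//; near: m; [exact: ha|exact: hb].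
pose e : R := m.+1%:R^-1.
have e0 : 0 < e by rewrite invr_gt0 ltr0n.
have [p [lp np wp]] := weight_cvg lf lg e0 lu lv fg0 nu nv.
pose w k : E -> R^o := fun x => G'_ 0 e (v k x) * G'_ a e (u k x).
have w01 k x : 0 <= w k x <= 1.
  have [/andP[h1 h2] _] := atan_step_complement 0 (v k x) e0.
  have [/andP[h3 h4] _] := atan_step_complement a (u k x) e0.
  by rewrite mulr_ge0//= mulr_ile1.
have mw k : measurable_fun setT (w k).
  by apply: measurable_funM; apply: measurable_G'; exact: l2_measurable (tame_l2 _).
have [iwu wu] := weighted_energy_cvg df mu_ mw w01 lp np wp.
have [iwv wv] := weighted_energy_cvg dg mv mw w01 lp np wp.
have /cvgr0Pnorm_le/(_ _ r4) hwu := wu.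
have /cvgr0Pnorm_le/(_ _ r4) hwv := wv.
pose Pk k := `|\int[mu]_x (w k x * carre c (v k) (v k) x)| <= r / 4.
pose Qk k := `|\int[mu]_x (w k x * carre c (u k) (u k) x)| <= r / 4.
have hPQ : \forall k \near \oo, Pk k /\ Qk k by exact: (filterI hwv hwu).
have /cvgr0Pnorm_lt/(_ _ dl2) hnu := nu.
have /cvgr0Pnorm_lt/(_ _ dl2) hnv := nv.
have nearv := minseq_near mv dl0.
(* The three terms are the interactions of [v k] with the step of [u k], of the step of [v k] with
   the complement of [u k], and of the two complements. *)
have arith (A B C P Q : R) : 2 * A <= 2 * (r / 4) -> 2 * B <= r / 4 + r / 4 ->
   2 * C <= P + Q -> P <= r / 4 -> Q <= r / 4 -> A + B + C <= r.
  by lra.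
near=> k.
have [hv1 hv2] : nrm (v k - g) < dl /\ en (v k) (v k) < q0 g + dl by near: k; exact: nearv.
have nuk : nrm (u k - f) < dl / 2.
  by rewrite -[ltLHS]ger0_norm ?nrm_ge0//; near: k; exact: hnu.
have nvk : nrm (v k - g) < dl / 2.
  by rewrite -[ltLHS]ger0_norm ?nrm_ge0//; near: k; exact: hnv.
have [tFu eFu] := comp_F a (tu k) e0; have [tFv eFv] := comp_F 0 (tv k) e0.
have [tGu eGu] := comp_G a (tu k) e0; have [tGv eGv] := comp_G 0 (tv k) e0.
have nFu : nrm (F_ a e \o u k) < dl.
  by rewrite (le_lt_trans (norm_F_le a (lu k) lf e0 (tu k)))// [ltRHS]splitr ltrD.
have nFv : nrm (F_ 0 e \o v k) < dl.
  by rewrite (le_lt_trans (norm_F_le 0 (lv k) lg e0 (tv k)))// [ltRHS]splitr ltrD.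
have dl1 : dl <= d1 by rewrite ge_min lexx.
have dl_2 : dl <= d2 by rewrite ge_min lexx orbT.
have T1 : `|en (v k) (F_ a e \o u k)| <= r / 4.
  apply: hd1 => //.
  - exact: lt_le_trans hv1 dl1.
  - by rewrite (lt_le_trans hv2)// lerD2l.
  - exact: lt_le_trans nFu dl1.
  - exact: le_trans eFu (hu k).
have T2' : `|en (v k) (F_ 0 e \o v k)| <= r / 4 / t.
  apply: hd2 => //.
  - exact: lt_le_trans hv1 dl_2.
  - by rewrite (lt_le_trans hv2)// lerD2l.
  - exact: lt_le_trans nFv dl_2.
  - exact: le_trans eFv (hv k).
have T2 : 2 * `|en (F_ 0 e \o v k) (G_ a e \o u k)| <= r / 4 + r / 4.
  apply: (le_trans (bil_amgm H t0 tFv tGu)); apply: lerD.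
    rewrite mulrC -ler_pdivlMr//; apply: le_trans T2'.
    by rewrite (le_trans (energy_F_le 0 (tv k) e0))// ler_norm.
  by apply: le_trans tM; rewrite ler_pM2l ?invr_gt0// (le_trans eGu).
have T3 := energy_G_le a (tu k) (tv k) e0.
have [P1 Q1] : Pk k /\ Qk k by near: k; exact: hPQ.
have E1 := energy_splitr a (tu k) (tv k) e0.
have E2 := energy_splitl 0 (tv k) tGu e0.
rewrite E1 E2 addrA.
apply: (le_trans (ler_normD _ _)); apply: (le_trans (lerD (ler_normD _ _) (lexx _))).
by apply: (arith _ _ _ _ _ _ T2 T3 (le_trans (ler_norm _) P1) (le_trans (ler_norm _) Q1)); rewrite ler_pM2l.
Unshelve. all: by end_near. Qed.

End locality.

(** * Uniform density *)

Section uniform_density.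
Context {R : realType} {d : nat}.
Notation E := 'rV[R]_d.
Notation mu := (lebesgue_rV d : {measure set 'rV[R]_d -> \bar R}).
Notation l2 := (l2 mu).
Notation nrm := (nrm mu).
Notation ip := (ip mu).
Implicit Types (u v w f g h : E -> R^o) (x y z : E) (i j : 'I_d).

(** The derivatives of the kernel at different centres are translates of one another, hence have
    equal norms, and the Cauchy-Schwarz inequality bounds the partial derivatives uniformly. *)
Lemma moll_tame (s r : R) f : 0 < s -> l2 f -> (forall x, ~ cube d r x -> f x = 0) ->
  tame (moll s f).
Proof.
move=> s0 lf sf.
pose pr i x : E -> R^o := fun y => - partial i (rho s x) y.
have lpr i x : l2 (pr i x) by exact: l2N (tame_partial_l2 i (rho_tame s0 x)).
have pm i x : partial i (moll s f) x = ip f (pr i x).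
  exact: (partial_val (moll_derive s0 i x lf)).
have npr i x : nrm (pr i x) = nrm (pr i 0).
  have -> : pr i x = shift_fun (- x) (pr i 0).
    by apply/funext => y; rewrite /shift_fun /pr (partial_rho s0).
  exact: (shift_nrm (- x) (l2_measurable (lpr i 0))).
split.
- exact: moll_continuous.
- exists (r + s^-1) => x nx; rewrite mollE//; last exact: l2_measurable lf.
  rewrite (_ : (fun z => _) = fun=> 0); first by rewrite /Rintegral integral0.
  apply/funext => z; have [->|/(rho_support s0) cz] := eqVneq (rho s 0 z) 0; first by rewrite mulr0.
  rewrite sf ?mul0r// => cxz; apply: nx; rewrite -(addrK z x).
  by apply: cubeD => //; exact: cubeN.
- by move=> i x; have [] := moll_derive s0 i x lf.
pose B := \sum_i nrm (pr i 0).
exists (nrm f * nrm (rho s 0) + nrm f * B) => x.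
have B0 : 0 <= B by apply: sumr_ge0 => i _; exact: nrm_ge0.
split.
  by rewrite (le_trans (moll_bounded s0 x lf))// lerDl mulr_ge0// nrm_ge0.
move=> i; rewrite pm (le_trans (cauchy_schwarz lf (lpr i x)))//.
apply: (@le_trans _ _ (nrm f * B)); last by rewrite lerDr mulr_ge0// nrm_ge0.
rewrite ler_wpM2l ?nrm_ge0// npr /B (bigD1 i)//=.
by rewrite lerDl sumr_ge0// => j _; exact: nrm_ge0.
Qed.

Lemma moll_uniform (s r t e : R) f : 0 < s -> l2 f -> s^-1 <= t ->
  (forall x, ~ cube d r x -> f x = 0) -> (forall x z, cube d t z -> `|f (x + z) - f x| <= e) ->
  forall x, `|moll s f x - f x| <= e.
Proof.
move=> s0 lf st sf fe x; have mf := l2_measurable lf.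
have ir : integ mu (rho s 0) := tame_integ (rho_tame s0 0).
have mfx : measurable_fun setT (fun z => f (x + z)).
  by under eq_fun do rewrite addrC; exact: (measurableT_comp mf (measurable_rV_shift x)).
have bd z : `|(f (x + z) - f x) * rho s 0 z| <= e * rho s 0 z.
  have r0 := rho_ge0 s0 0 z; rewrite normrM (ger0_norm r0).
  have [->|/(rho_support s0) cz] := eqVneq (rho s 0 z) 0; first by rewrite !mulr0.
  by rewrite ler_wpM2r// fe//; exact: cubeS cz.
have e0 : 0 <= e.
  have := fe 0 0; rewrite addr0 subrr normr0; apply => i; rewrite mxE normr0.
  by rewrite (lt_le_trans _ st)// invr_gt0.
have m1 : \int[mu]_z rho s 0 z = 1 := rho_mass s0.
have i1 : integ mu (fun z => (f (x + z) - f x) * rho s 0 z).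
  apply: (integ_le _ (integZ e ir)).
    apply: measurable_funM; last exact: integ_measurable ir.
    by apply: measurable_funB => //; exact: measurable_cst.
  move=> z; apply: (le_trans (bd z)); rewrite -[X in _ <= `|X|]/(e * rho s 0 z).
  exact: ler_norm.
have i2 : integ mu (f x *: rho s 0) by exact: integZ.
have -> : moll s f x - f x = \int[mu]_z ((f (x + z) - f x) * rho s 0 z).
  rewrite (mollE s0)// -[X in _ - X]mulr1 -m1 -(RintegralZ_integ _ ir).
  apply/eqP; rewrite subr_eq -(RintegralD_integ i1 i2); apply/eqP.
  apply: eq_Rintegral => z _; rewrite -[X in _ = _ + X]/(f x * rho s 0 z); ring.
apply: (le_trans (le_normr_Rintegral _ _)) => //.
apply: (@le_trans _ _ (\int[mu]_z (e *: rho s 0) z)); last first.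
  by rewrite (RintegralZ_integ _ ir) m1 mulr1.
apply: le_Rintegral => //.
- apply: (integ_le _ i1); first by apply: measurableT_comp => //; exact: integ_measurable i1.
  by move=> z; rewrite normr_id.
- exact: integZ.
Qed.

Lemma tame_uniform_dense f : continuous f ->
  (forall e : R, 0 < e -> exists2 K, compact K & forall x, ~ K x -> `|f x| < e) ->
  forall e : R, 0 < e -> exists2 u, tame u & forall x, `|f x - u x| < e.
Proof.
move=> cf vf e e0.
have e4 : 0 < e / 4 by rewrite divr_gt0.
have [K cK hK] := vf _ e4.
have [r r0 Kr] := coord_norm_bounded cK.
(* Soft thresholding at level [e / 4], a continuous map sending small values to 0 and moving no
   value by more than [e / 4]. It replaces [f] by a compactly supported function, which
   mollification then makes tame. *)
pose S (t : R) := t + (`|t - e / 4| - `|t + e / 4|) / 2.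
have S0 t : `|t| < e / 4 -> S t = 0.
  rewrite ltr_norml => /andP[h1 h2]; rewrite /S ler0_norm; last by lra.
  by rewrite ger0_norm; [field|lra].
have Sd t : `|t - S t| <= e / 4.
  have -> : t - S t = (`|t + e / 4| - `|t - e / 4|) / 2 by rewrite /S; field.
  have := ler_dist_dist (t + e / 4) (t - e / 4).
  rewrite (_ : t + e / 4 - (t - e / 4) = e / 2); last by field.
  rewrite (ger0_norm (ltW (divr_gt0 e0 (ltr0n _ 2)))) !ler_norml => /andP[h1 h2].
  by apply/andP; split; lra.
pose g : E -> R^o := fun x => f x + (`|f x - e / 4| - `|f x + e / 4|) / 2.
have sg x : ~ cube d r x -> g x = 0 by move=> nx; rewrite -[LHS]/(S (f x)); apply: S0; apply: hK => /Kr.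
have cS : continuous (S : R -> R).
  move=> q; apply: cvgD; first exact: cvg_id.
  by apply: cvgMr_tmp; apply: cvgB; apply: cvg_norm; [apply: cvgB|apply: cvgD];
     [exact: cvg_id|exact: cvg_cst|exact: cvg_id|exact: cvg_cst].
have cg : continuous g by move=> x; exact: (@continuous_comp _ _ _ f S x (cf x) (cS _)).
have [B _ hB] := continuous_vanish_bounded cg sg.
have lg : l2 g by apply: (@bounded_support_l2 _ _ _ r B) => //; exact: continuous_measurable_rV.
have [t t0 ht] := uniformly_continuous cg sg e4.
have s0 : 0 < t^-1 by rewrite invr_gt0.
exists (moll t^-1 g); first exact: moll_tame sg.
move=> x; have h := @moll_uniform t^-1 r t (e / 4) g s0 lg _ sg (fun x z cz => ltW (ht x z cz)) x.
have {}h : `|moll t^-1 g x - g x| <= e / 4 by apply: h; rewrite invrK.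
have hS : `|f x - g x| <= e / 4 := Sd (f x).
rewrite (_ : f x - _ = (f x - g x) - (moll t^-1 g x - g x)); last by ring.
rewrite (le_lt_trans (ler_normB _ _))//.
by move: h hS; lra.
Qed.

End uniform_density.

(** * Regularizing the coefficients on a null set *)

Section coefficients.
Context {R : realType} {d : nat}.
Notation E := 'rV[R]_d.
Notation mu := (lebesgue_rV d : {measure set 'rV[R]_d -> \bar R}).
Implicit Types (x y z : E) (i j : 'I_d).

Lemma ae_forall_fin (I : finType) (P : I -> E -> Prop) :
  (forall i : I, {ae mu, forall x, P i x}) -> {ae mu, forall x, forall i : I, P i x}.
Proof.
move=> h; have : {ae mu, forall x, forall i : I, i \in enum I -> P i x}.
  elim: (enum I) => [|i s IHs]; first by apply: aeW.
  apply: filterS2 (h i) IHs => x Pi Ps j; rewrite in_cons => /orP[/eqP-> //|]; exact: Ps.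
by apply: filterS => x hx i; apply: hx; rewrite mem_enum.
Qed.

Lemma Linfty_bounded (f : E -> R) : f \in Lfun mu +oo%E ->
  measurable_fun setT f /\ exists K, {ae mu, forall x, `|f x| <= K}.
Proof.
rewrite inE => /andP[]; rewrite !inE => mf hf; split=> //; move: hf.
rewrite /= /finite_norm unlock.
(* The norm is the essential supremum only if the whole space has positive measure; otherwise any
   bound holds almost everywhere and 0 is taken. *)
case: ifPn => [m0|]; last first.
  rewrite -leNgt => m0 _; exists 0; exists setT; split=> //.
  by apply/eqP; rewrite eq_le m0 measure_ge0.
move=> hf; exists (fine (ess_sup mu (abse \o (EFin \o f)))).
have e0 : (0 <= ess_sup mu (abse \o (EFin \o f)))%E by apply: ess_sup_gee => //; apply: aeW => x; exact: abse_ge0.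
apply: filterS (ess_sup_ge mu (abse \o (EFin \o f))) => x h.
by rewrite -lee_fin fineK// ge0_fin_numE.
Qed.

(** Finitely many entries and one positivity condition allow a single measurable null set to contain
    all bad points. There the matrix is set to 0, which is bounded, symmetric and positive. *)
Lemma nice_coef_exists (c : 'I_d -> 'I_d -> E -> R) :
  (forall i j, c i j \in Lfun mu +oo%E) ->
  (forall i j, {ae mu, forall x, c i j x = c j i x}) ->
  {ae mu, forall x, forall xi : 'cV[R]_d, 0 <= (xi^T *m coeff_mx c x *m xi) ord0 ord0} ->
  exists2 c', nice_coef c' & forall i j, {ae mu, forall x, c i j x = c' i j x}.
Proof.
move=> cL cs cp.
have /choice[K hK] : forall i, exists K, forall j, {ae mu, forall x, `|c i j x| <= K j}.
  move=> i; have /choice[K hK] : forall j, exists K, {ae mu, forall x, `|c i j x| <= K}.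
    by move=> j; have [_] := Linfty_bounded (cL i j).
  by exists K.
pose K0 := \sum_i \sum_j `|K i j|.
have KK i j : K i j <= K0.
  rewrite /K0 (bigD1 i)//= (bigD1 j)//= -!addrA; apply: (le_trans (ler_norm _)).
  by rewrite lerDl addr_ge0// sumr_ge0// => k _; rewrite ?sumr_ge0.
have : {ae mu, forall x, (forall i j, `|c i j x| <= K i j /\ c i j x = c j i x) /\
    forall xi : 'cV[R]_d, 0 <= (xi^T *m coeff_mx c x *m xi) ord0 ord0}.
  apply: filterI => //; apply: ae_forall_fin => i; apply: ae_forall_fin => j.
  by apply: filterS2 (hK i j) (cs i j) => x h1 h2; split.
move=> [A [mA A0 hA]].
pose c' i j x := c i j x * \1_(~` A) x.
have out x : ~ A x -> (forall i j, `|c i j x| <= K i j /\ c i j x = c j i x) /\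
    forall xi : 'cV[R]_d, 0 <= (xi^T *m coeff_mx c x *m xi) ord0 ord0.
  by move=> nA; apply: contrapT => h; apply: nA; exact: hA.
have cA x : A x -> forall i j, c' i j x = 0.
  by move=> Ax i j; rewrite /c' indicE memNset ?mulr0//= => /(_ Ax).
have cNA x : ~ A x -> forall i j, c' i j x = c i j x.
  by move=> Ax i j; rewrite /c' indicE mem_set ?mulr1.
exists c'; last first.
  move=> i j; exists A; split=> // x /= h; apply: contrapT => nA; apply: h.
  by rewrite cNA.
split.
- move=> i j; apply: measurable_funM; first by have [] := Linfty_bounded (cL i j).
  by apply: measurable_indic; exact: measurableC.
- exists K0 => i j x; have [Ax|nA] := pselect (A x).
    by rewrite cA// normr0 sumr_ge0// => k _; rewrite sumr_ge0.
  by rewrite cNA// (le_trans _ (KK i j))//; have [/(_ i j)[]] := out _ nA.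
- move=> i j x; have [Ax|nA] := pselect (A x); first by rewrite !cA.
  by rewrite !cNA//; have [/(_ i j)[]] := out _ nA.
- move=> x xi; have [Ax|nA] := pselect (A x).
    by rewrite sumr_ge0// => i _; rewrite sumr_ge0// => j _; rewrite cA// mul0r.
  have [_ /(_ (\col_i xi i))] := out _ nA.
  rewrite mxE exchange_big/=; congr (0 <= _); apply: eq_bigr => j _.
  rewrite !mxE mulr_suml; apply: eq_bigr => i _.
  by rewrite !mxE cNA//; ring.
Qed.

End coefficients.

(** * Complexification of real quadratic forms *)

Section complexification.
Context {R : realType} {d : nat}.
Notation E := 'rV[R]_d.
Notation mu := (lebesgue_rV d : {measure set 'rV[R]_d -> \bar R}).
Notation C := R[i].
Notation l2 := (l2 mu).
Notation nrm := (nrm mu).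
Notation ip := (ip mu).
Implicit Types (u v w : E -> R^o) (f g h : E -> C) (x y z : E) (i j : 'I_d).

Definition re f : E -> R^o := fun x => complex.Re (f x).
Definition im f : E -> R^o := fun x => complex.Im (f x).
Definition cplx u v : E -> C := fun x => Complex (u x) (v x).

Lemma reD f g : re (f \+ g) = re f + re g.
Proof.
apply/funext => x; rewrite -[LHS]/(complex.Re (f x + g x)) -[RHS]/(complex.Re (f x) + complex.Re (g x)).
by case: (f x) (g x) => [? ?] [? ?].
Qed.

Lemma imD f g : im (f \+ g) = im f + im g.
Proof.
apply/funext => x; rewrite -[LHS]/(complex.Im (f x + g x)) -[RHS]/(complex.Im (f x) + complex.Im (g x)).
by case: (f x) (g x) => [? ?] [? ?].
Qed.

Lemma reB f g : re (f \- g) = re f - re g.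
Proof.
apply/funext => x; rewrite -[LHS]/(complex.Re (f x - g x)) -[RHS]/(complex.Re (f x) - complex.Re (g x)).
by case: (f x) (g x) => [? ?] [? ?].
Qed.

Lemma imB f g : im (f \- g) = im f - im g.
Proof.
apply/funext => x; rewrite -[LHS]/(complex.Im (f x - g x)) -[RHS]/(complex.Im (f x) - complex.Im (g x)).
by case: (f x) (g x) => [? ?] [? ?].
Qed.

Lemma reM (a : C) f : re (a \*o f) = complex.Re a *: re f - complex.Im a *: im f.
Proof.
apply/funext => x; rewrite -[LHS]/(complex.Re (a * f x)).
rewrite -[RHS]/(complex.Re a * complex.Re (f x) - complex.Im a * complex.Im (f x)).
by case: a (f x) => [? ?] [? ?].
Qed.

Lemma imM (a : C) f : im (a \*o f) = complex.Re a *: im f + complex.Im a *: re f.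
Proof.
apply/funext => x; rewrite -[LHS]/(complex.Im (a * f x)).
rewrite -[RHS]/(complex.Re a * complex.Im (f x) + complex.Im a * complex.Re (f x)).
by case: a (f x) => [a1 a2] [f1 f2] /=; rewrite [a2 * f1]mulrC.
Qed.

Lemma re0 : re (fun=> 0) = 0. Proof. by []. Qed.

Lemma im0 : im (fun=> 0) = 0. Proof. by []. Qed.

Lemma l2norm_sqr f : L2 f -> l2norm f ^+ 2 = nrm (re f) ^+ 2 + nrm (im f) ^+ 2.
Proof.
move=> [lr li].
have e : complex.Re (inner f f) = ip (re f) (re f) + ip (im f) (im f).
  rewrite -(RintegralD_integ (l2_mul lr lr) (l2_mul li li)).
  apply: eq_Rintegral => x _; rewrite /re /im; case: (f x) => a b /=.
  by rewrite mulNr opprK.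
have e0 : 0 <= complex.Re (inner f f).
  by rewrite e; exact: addr_ge0 (ip_ge0 _ _) (ip_ge0 _ _).
by rewrite (sqr_sqrtr e0) e (nrm_sqr _ (re f)) (nrm_sqr _ (im f)).
Qed.

Lemma l2norm_ge0 f : 0 <= l2norm f. Proof. exact: sqrtr_ge0. Qed.

Let sqr_le (r t : R) : 0 <= t -> r ^+ 2 <= t ^+ 2 -> r <= t.
Proof. by move=> t0 h; rewrite (le_trans (ler_norm r))// -(ger0_norm t0) -!sqrtr_sqr ler_wsqrtr. Qed.

Lemma nrm_re_le f : L2 f -> nrm (re f) <= l2norm f.
Proof.
move=> lf; apply: sqr_le; first exact: l2norm_ge0.
by rewrite (l2norm_sqr lf) lerDl sqr_ge0.
Qed.

Lemma nrm_im_le f : L2 f -> nrm (im f) <= l2norm f.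
Proof.
move=> lf; apply: sqr_le; first exact: l2norm_ge0.
by rewrite (l2norm_sqr lf) lerDr sqr_ge0.
Qed.

Lemma l2norm_le f : L2 f -> l2norm f <= nrm (re f) + nrm (im f).
Proof.
move=> lf; apply: sqr_le; first exact: addr_ge0 (nrm_ge0 _ _) (nrm_ge0 _ _).
rewrite (l2norm_sqr lf) sqrrD lerD2r lerDl mulrn_wge0//.
exact: mulr_ge0 (nrm_ge0 _ _) (nrm_ge0 _ _).
Qed.

Lemma L2B f g : L2 f -> L2 g -> L2 (f \- g).
Proof.
move=> [lf1 lf2] [lg1 lg2]; split.
  by rewrite -/(l2 (re (f \- g))) reB; exact: (l2B lf1 lg1).
by rewrite -/(l2 (im (f \- g))) imB; exact: (l2B lf2 lg2).
Qed.

Lemma l2_cvgP (u_ : nat -> E -> C) f : (forall k, L2 (u_ k)) -> L2 f ->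
  l2_cvg u_ f <-> nrm (re (u_ k) - re f) @[k --> \oo] --> (0 : R) /\
                 nrm (im (u_ k) - im f) @[k --> \oo] --> (0 : R).
Proof.
move=> lu lf; have luf k := L2B (lu k) lf; split=> [h|[h1 h2]].
  split; apply: (squeeze_cvgr _ (cvg_cst (0 : R)) h); apply: nearW => k;
    rewrite nrm_ge0/=.
  by rewrite -reB; exact: nrm_re_le.
  by rewrite -imB; exact: nrm_im_le.
apply: (@squeeze_cvgr _ _ _ _ (fun=> 0) (fun k => nrm (re (u_ k) - re f) + nrm (im (u_ k) - im f))).
- by apply: nearW => k; rewrite l2norm_ge0/= -reB -imB; exact: l2norm_le.
- exact: cvg_cst.
- by rewrite -[X in _ --> X](addr0 0); exact: cvgD.
Qed.

Lemma ae_re_im f g : ae_eq_L2 f g ->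
  {ae mu, forall x, re f x = re g x} /\ {ae mu, forall x, im f x = im g x}.
Proof. by move=> fg; split; apply: filterS fg => x; rewrite /re /im => ->. Qed.

Lemma polar_eval (a b a' b' : R) :
  4%:R^-1 * (a%:C%C - b%:C%C + Complex 0 1 * (a'%:C%C - b'%:C%C)) = Complex ((a - b) / 4) ((a' - b') / 4).
Proof.
rewrite -[4%:R](rmorph_nat (@real_complex R)) -fmorphV.
apply/eqP; rewrite eq_complex /=; apply/andP; split; apply/eqP; ring.
Qed.

Variables (D : set (E -> R^o)) (b : (E -> R^o) -> (E -> R^o) -> R).
Hypothesis H : semi_inner l2 D nrm b.
Hypothesis Dae : forall u v, l2 v -> {ae mu, forall x, u x = v x} ->
  D u -> D v /\ b v v = b u u.

Definition cdom : set (E -> C) := [set f | D (re f) /\ D (im f)].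

(** Built twice from the same relaxed bilinear form: on the full relaxed domain and on W^{1,2}.
    Compatibility of [D] and [b] with almost everywhere equality, assumed above, gives the
    corresponding axiom of [positive_form]. *)
Definition cform f : \bar R :=
  if `[< cdom f >] then (b (re f) (re f) + b (im f) (im f))%:E else +oo%E.

Lemma cform_val f : cdom f -> cform f = (b (re f) (re f) + b (im f) (im f))%:E.
Proof. by move=> df; rewrite /cform asboolT. Qed.

Lemma form_dom_cform : form_dom cform = cdom.
Proof.
apply/seteqP; split=> f; rewrite /form_dom /= /cform; case: asboolP => // _.
by move=> _; exact: ltry.
Qed.

Lemma cdom_lin (a : C) f g : cdom f -> cdom g -> cdom ((a \*o f) \+ g).
Proof.
move=> [f1 f2] [g1 g2]; split.
  rewrite reD reM; apply: (domD H) => //.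
  by apply: (domB H); exact: (domZ H).
rewrite imD imM; apply: (domD H) => //.
by apply: (domD H); exact: (domZ H).
Qed.

Lemma cdomD f g : cdom f -> cdom g -> cdom (f \+ g).
Proof. by move=> [f1 f2] [g1 g2]; split; rewrite ?reD ?imD; exact: (domD H). Qed.

Lemma cdomB f g : cdom f -> cdom g -> cdom (f \- g).
Proof. by move=> [f1 f2] [g1 g2]; split; rewrite ?reB ?imB; exact: (domB H). Qed.

Lemma cdom_L2 f : cdom f -> L2 f.
Proof. by move=> [f1 f2]; split; apply: (dom_amb H). Qed.

Let bD4 u v : D u -> D v -> b (u + v) (u + v) - b (u - v) (u - v) = 4 * b u v.
Proof.
move=> Du Dv; have Dp := domD H Du Dv; have Dm := domB H Du Dv.
rewrite (bilDl H Du Dv Dp) (bilBl H Du Dv Dm) (bilDr H Du Dv Du) (bilDr H Du Dv Dv)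
  (bilBr H Du Dv Du) (bilBr H Du Dv Dv) (bil_sym H Dv Du).
ring.
Qed.

(** This formula reduces every axiom on [polar], as well as locality, to statements about the real
    symmetric form [b]. *)
Lemma polar_cform f g : cdom f -> cdom g ->
  polar cform g f = Complex (b (re f) (re g) + b (im f) (im g))
                            (b (im f) (re g) - b (re f) (im g)).
Proof.
move=> df dg; have [f1 f2] := df; have [g1 g2] := dg.
have ig : cdom ((Complex 0 1 : C) \*o g).
  split; rewrite ?reM ?imM.
    by apply: (domB H); exact: (domZ H).
  by apply: (domD H); exact: (domZ H).
rewrite /polar (cform_val (cdomD df dg)) (cform_val (cdomB df dg)).
rewrite (cform_val (cdomD df ig)) (cform_val (cdomB df ig)) [LHS]polar_eval.
rewrite !reB !imB !reD !imD !reM !imM /= !scale0r !scale1r sub0r add0r.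
have k1 := bD4 f1 g1; have k2 := bD4 f2 g2.
have k3 := bD4 f2 g1; have k4 := bD4 f1 (domN H g2).
have k5 : b (re f) (- im g) = - b (re f) (im g).
  by rewrite -scaleN1r (bilZr H)// mulN1r.
rewrite k5 in k4.
apply/eqP; rewrite eq_complex /=; apply/andP; split; apply/eqP.
  rewrite (_ : _ - _ = 4 * b (re f) (re g) + 4 * b (im f) (im g)); first by field.
  by rewrite -k1 -k2; ring.
rewrite (_ : _ - _ = 4 * - b (re f) (im g) + 4 * b (im f) (re g)); first by field.
by rewrite -k3 -k4; ring.
Qed.

Lemma polar_cform_sym f g : cdom f -> cdom g -> polar cform f g = conjc (polar cform g f).
Proof.
move=> df dg; rewrite !polar_cform//; have [f1 f2] := df; have [g1 g2] := dg.
rewrite (bil_sym H g1 f1) (bil_sym H g2 f2) (bil_sym H g2 f1) (bil_sym H g1 f2) /=.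
by congr Complex; rewrite opprB.
Qed.

Lemma polar_cform_lin (a : C) f g h : cdom f -> cdom g -> cdom h ->
  polar cform h ((a \*o f) \+ g) = a * polar cform h f + polar cform h g.
Proof.
move=> df dg dh; rewrite !polar_cform//; last exact: cdom_lin.
have [f1 f2] := df; have [g1 g2] := dg; have [h1 h2] := dh.
rewrite reD imD reM imM; case: a => a1 a2 /=.
have z1 := domZ H a1 f1; have z2 := domZ H a2 f2.
have z3 := domZ H a1 f2; have z4 := domZ H a2 f1.
have z5 := domB H z1 z2; have z6 := domD H z3 z4.
have r1 w : D w -> b (a1 *: re f - a2 *: im f + re g) w = a1 * b (re f) w - a2 * b (im f) w + b (re g) w.
  by move=> Dw; rewrite (bilDl H z5 g1 Dw) (bilBl H z1 z2 Dw) (bilZl H _ f1 Dw) (bilZl H _ f2 Dw).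
have r2 w : D w -> b (a1 *: im f + a2 *: re f + im g) w = a1 * b (im f) w + a2 * b (re f) w + b (im g) w.
  by move=> Dw; rewrite (bilDl H z6 g2 Dw) (bilDl H z3 z4 Dw) (bilZl H _ f1 Dw) (bilZl H _ f2 Dw).
rewrite !r1// !r2//; apply/eqP; rewrite eq_complex /=; apply/andP; split; apply/eqP; ring.
Qed.

Lemma cform_positive : positive_form cform.
Proof.
split.
- move=> f; rewrite /cform; case: asboolP => // -[f1 f2].
  by rewrite lee_fin addr_ge0// (bil_ge0 H).
- by rewrite form_dom_cform => f; exact: cdom_L2.
- have key f g : L2 g -> ae_eq_L2 f g -> cdom f -> cdom g /\ cform g = cform f.
    move=> [lg1 lg2] /ae_re_im[h1 h2] df; have [f1 f2] := df.
    have [g1 e1] := Dae lg1 h1 f1; have [g2 e2] := Dae lg2 h2 f2.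
    have dg : cdom g by split.
    by split=> //; rewrite !cform_val// e1 e2.
  move=> f g lf lg fg.
  have gf : ae_eq_L2 g f by apply: filterS fg.
  have [df|ndf] := pselect (cdom f); first by have [_ ->] := key _ _ lg fg df.
  have ndg : ~ cdom g by move=> dg; apply: ndf; have [] := key _ _ lf gf dg.
  by rewrite /cform !asboolF.
- by rewrite form_dom_cform; split; rewrite ?re0 ?im0; exact: (dom0 H).
- by rewrite form_dom_cform; exact: cdom_lin.
- by rewrite form_dom_cform => *; exact: polar_cform_lin.
- rewrite form_dom_cform => a f g h df dg dh.
  rewrite polar_cform_sym//; last exact: cdom_lin.
  have cM (p q : C) : conjc (a * p + q) = conjc a * conjc p + conjc q by rewrite rmorphD rmorphM.
  by rewrite polar_cform_lin// cM (polar_cform_sym df dh) (polar_cform_sym dg dh).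
- rewrite form_dom_cform => f df; rewrite polar_cform// cform_val//=.
  have [f1 f2] := df.
  by rewrite (bil_sym H f2 f1) subrr.
Qed.

End complexification.

(** * The elliptic form and the relaxed energy *)

Section elliptic.
Context {R : realType} {d : nat}.
Notation E := 'rV[R]_d.
Notation mu := (lebesgue_rV d : {measure set 'rV[R]_d -> \bar R}).
Notation C := R[i].
Notation l2 := (l2 mu).
Notation nrm := (nrm mu).
Notation ip := (ip mu).
Implicit Types (u v w : E -> R^o) (f g h : E -> C) (x y z : E) (i j : 'I_d).

Definition w12 u : Prop := l2 u /\ forall i, exists2 g, l2 g & weak i u g.

Lemma ae_ip u v w : l2 u -> l2 v -> l2 w -> {ae mu, forall x, u x = v x} -> ip u w = ip v w.
Proof.
move=> lu lv lw uv; apply: ae_eq_Rintegral.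
- exact: measurable_funM (l2_measurable lu) (l2_measurable lw).
- exact: measurable_funM (l2_measurable lv) (l2_measurable lw).
- by apply: filterS uv => x ->.
Qed.

Lemma test_l2 (eta : E -> R) i : test_function eta ->
  l2 (eta : E -> R^o) /\ l2 (partial i eta : E -> R^o).
Proof.
by move=> /test_function_tame te; split; [exact: tame_l2|exact: tame_partial_l2].
Qed.

Lemma weak_lin (a : R) i u v (g h : E -> R^o) : l2 u -> l2 v -> l2 g -> l2 h ->
  weak i u g -> weak i v h -> weak i (a *: u + v) (a *: g + h).
Proof.
move=> lu lv lg lh wu wv eta te; have [l1 l2'] := test_l2 i te.
rewrite (ip_lin a lu lv l2') (ip_lin a lg lh l1) (wu _ te) (wv _ te); ring.
Qed.

Lemma weak_ae i u v (g : E -> R^o) : l2 u -> l2 v -> {ae mu, forall x, u x = v x} ->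
  weak i u g -> weak i v g.
Proof.
move=> lu lv uv wu eta te; have [_ l2'] := test_l2 i te.
by rewrite -(ae_ip lu lv l2' uv) wu.
Qed.

Lemma w12_lin (a : R) u v : w12 u -> w12 v -> w12 (a *: u + v).
Proof.
move=> [lu wu] [lv wv]; split=> [|i]; first exact: l2_lin.
have [g lg wg] := wu i; have [h lh wh] := wv i.
by exists (a *: g + h); [exact: l2_lin|exact: weak_lin].
Qed.

Lemma w12_ae u v : l2 v -> {ae mu, forall x, u x = v x} -> w12 u -> w12 v.
Proof.
move=> lv uv [lu wu]; split=> // i; have [g lg wg] := wu i.
by exists g => //; exact: weak_ae uv wg.
Qed.

Lemma tame_w12 u : tame u -> w12 u.
Proof.
move=> tu; split=> [|i]; first exact: tame_l2.
by exists (partial i u); [exact: tame_partial_l2|exact: tame_weak].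
Qed.

Lemma cintegral_real f (q : E -> R) :
  cintegral (fun x => f x * (q x)%:C%C) = Complex (ip (re f) q) (ip (im f) q).
Proof.
congr Complex; apply: eq_Rintegral => x _; rewrite /re /im; case: (f x) => a b /=.
  by rewrite mulr0 subr0.
by rewrite mulr0 add0r.
Qed.

Lemma is_weak_partialP i f g :
  is_weak_partial i f g <-> weak i (re f) (re g) /\ weak i (im f) (im g).
Proof.
split=> [h|[h1 h2] eta te]; last first.
  by rewrite !cintegral_real (h1 _ te) (h2 _ te).
by split=> eta te; have := h _ te; rewrite !cintegral_real => -[].
Qed.

Lemma W12P f : W12 f <-> w12 (re f) /\ w12 (im f).
Proof.
split=> [[[l1 l2'] h]|[[l1 h1] [l2' h2]]].
  by split; split=> // i; have [g [g1 g2] /is_weak_partialP[]] := h i;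
    [exists (re g)|exists (im g)].
split=> // i; have [g1 lg1 wg1] := h1 i; have [g2 lg2 wg2] := h2 i.
by exists (cplx g1 g2); [split|apply/is_weak_partialP; split].
Qed.

Lemma weak_partialP i f : W12 f -> L2 (weak_partial i f) /\ is_weak_partial i f (weak_partial i f).
Proof.
move=> [_ /(_ i)[g lg wg]].
have := @xgetPex _ (fun=> 0) [set g | L2 g /\ is_weak_partial i f g].
by apply; exists g.
Qed.

Variables c c' : 'I_d -> 'I_d -> E -> R.
Hypothesis nc : nice_coef c'.
Hypothesis mc : forall i j, measurable_fun setT (c i j).
Hypothesis cc' : forall i j, {ae mu, forall x, c i j x = c' i j x}.

Notation en := (energy c').
Notation dom := (rdom l2 tame nrm en).
Notation a0 := (relax tame nrm en).
Notation b0 := (relax_bil tame nrm en).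

Let H := energy_semi_inner nc.

(** The place where the given coefficients are exchanged for their corrected representative, under
    the integral sign. *)
Lemma Re_inner_coef i j f g : L2 f -> L2 g ->
  complex.Re (inner f (fun x => (c i j x)%:C%C * g x)) =
  ip (re f) (fun x => c' i j x * re g x) + ip (im f) (fun x => c' i j x * im g x).
Proof.
move=> [f1 f2] [g1 g2].
have k1 := l2_mul f1 (coef_l2 nc i j g1); have k2 := l2_mul f2 (coef_l2 nc i j g2).
rewrite -(RintegralD_integ k1 k2).
rewrite -[LHS]/(\int[mu]_x complex.Re (conjc (f x) * ((c i j x)%:C%C * g x))).
rewrite (_ : (fun x => complex.Re _) = fun x => re f x * (c i j x * re g x) + im f x * (c i j x * im g x)).
  apply: ae_eq_Rintegral.
  - apply: measurable_funD.
      apply: measurable_funM (l2_measurable f1) _; exact: measurable_funM (mc i j) (l2_measurable g1).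
    apply: measurable_funM (l2_measurable f2) _; exact: measurable_funM (mc i j) (l2_measurable g2).
  - apply: measurable_funD; [exact: integ_measurable k1|exact: integ_measurable k2].
  - by apply: filterS (cc' i j) => x ->.
apply/funext => x; rewrite /re /im; case: (f x) (g x) => [a1 a2] [b1 b2] /=; ring.
Qed.

Let G1 f i : E -> R^o := re (weak_partial i f).
Let G2 f i : E -> R^o := im (weak_partial i f).

Lemma elliptic_val f : W12 f ->
  elliptic_form c f = (field_bil c' (G1 f) (G1 f) + field_bil c' (G2 f) (G2 f))%:E.
Proof.
move=> wf; rewrite /elliptic_form asboolT//; congr EFin.
rewrite raddf_sum /field_bil -big_split/=; apply: eq_bigr => i _.
rewrite raddf_sum -big_split/=; apply: eq_bigr => j _.
exact: (Re_inner_coef i j (proj1 (weak_partialP i wf)) (proj1 (weak_partialP j wf))).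
Qed.

Lemma relax_le_field u (G : 'I_d -> E -> R^o) : l2 u -> (forall i, l2 (G i)) ->
  (forall i, weak i u (G i)) -> dom u /\ a0 u <= field_bil c' G G.
Proof.
move=> lu lG wG; have [v [tv nv gv]] := weak_approx lu lG wG.
have lv k i : l2 (grad (v k) i) by exact: grad_l2.
have cv := field_bil_cvg nc lG lG lv lv gv gv.
apply: (relax_lsc H) => // e e0.
have /cvgr0Pnorm_lt/(_ _ e0) h1 := nv.
have /cvgrPdist_le/(_ _ e0) h2 := cv.
have [k [h1k h2k]] : exists k, `|nrm (v k - u)| < e /\
    `|field_bil c' G G - field_bil c' (grad (v k)) (grad (v k))| <= e.
  near \oo => k; exists k; split; near: k; [exact: h1|exact: h2].
exists (v k); have [dv av] := dom_rdom H (tv k); split=> //.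
  by apply: le_lt_trans h1k; exact: ler_norm.
apply: (le_trans av); rewrite /energy.
by move: h2k; rewrite ler_distlC => /andP[_].
Unshelve. all: by end_near. Qed.

Lemma w12_dom u : w12 u -> dom u.
Proof.
move=> [lu wu]; have /choice[G hG] : forall i, exists v, l2 v /\ weak i u v.
  by move=> i; have [g] := wu i; exists g.
have [] // := @relax_le_field u G lu; by move=> i; case: (hG i).
Qed.

Lemma relax_le_elliptic f : W12 f -> ((a0 (re f) + a0 (im f))%:E <= elliptic_form c f)%E.
Proof.
move=> wf; rewrite elliptic_val// lee_fin.
have [[l1 l2'] _] := wf.
have p i := weak_partialP i wf.
apply: lerD.
- have [] // := @relax_le_field (re f) (G1 f) l1; first by move=> i; have [[]] := p i.
  by move=> i; have [_ /is_weak_partialP[]] := p i.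
- have [] // := @relax_le_field (im f) (G2 f) l2'; first by move=> i; have [[]] := p i.
  by move=> i; have [_ /is_weak_partialP[]] := p i.
Qed.

Lemma field_bil_ae (G F : 'I_d -> E -> R^o) : (forall i, l2 (G i)) -> (forall i, l2 (F i)) ->
  (forall i, {ae mu, forall x, G i x = F i x}) -> field_bil c' G G = field_bil c' F F.
Proof.
move=> lG lF GF.
have cv i : nrm (G i - F i) @[_ --> \oo] --> (0 : R).
  rewrite (_ : nrm (G i - F i) = 0); first exact: cvg_cst.
  rewrite -(nrm0 mu); apply: ae_nrm; [exact: l2B|exact: l2_0|].
  by apply: filterS (GF i) => x h; rewrite -[LHS]/(G i x - F i x) h subrr.
have h := field_bil_cvg nc lF lF (fun=> lG) (fun=> lG) cv cv.
exact: cvg_lim_eq (cvg_cst _) h.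
Qed.

(** The weak derivatives selected in [elliptic_form] agree with the classical ones up to null sets,
    by uniqueness. *)
Lemma elliptic_tame f : tame (re f) -> tame (im f) ->
  elliptic_form c f = (en (re f) (re f) + en (im f) (im f))%:E.
Proof.
move=> t1 t2; have wf : W12 f by apply/W12P; split; exact: tame_w12.
have p i := weak_partialP i wf.
rewrite elliptic_val//; congr (_ + _)%:E; apply: field_bil_ae.
- by move=> i; have [[]] := p i.
- by move=> i; exact: grad_l2.
- move=> i; have [[q1 q2] /is_weak_partialP[r1 r2]] := p i.
  exact: weak_unique q1 (grad_l2 i t1) r1 (tame_weak i t1).
- by move=> i; have [[]] := p i.
- by move=> i; exact: grad_l2.
- move=> i; have [[q1 q2] /is_weak_partialP[r1 r2]] := p i.
  exact: weak_unique q2 (grad_l2 i t2) r2 (tame_weak i t2).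
Qed.

Lemma form_dom_elliptic : form_dom (elliptic_form c) = W12.
Proof.
apply/seteqP; split=> f; rewrite /form_dom /= /elliptic_form; case: asboolP => // _.
by move=> _; exact: ltry.
Qed.

Lemma relax_ae u v : l2 v -> {ae mu, forall x, u x = v x} -> dom u -> dom v /\ a0 v = a0 u.
Proof.
move=> lv uv du; have lu := rdom_amb du.
have key p q : l2 q -> {ae mu, forall x, p x = q x} -> dom p -> dom q /\ a0 q <= a0 p.
  move=> lq pq dp; have lp := rdom_amb dp.
  apply: (relax_lsc H lq) => e e0; exists p; split=> //; last by rewrite lerDl ltW.
  rewrite (_ : nrm (p - q) = 0)// -(nrm0 mu); apply: ae_nrm; [exact: l2B|exact: l2_0|].
  by apply: filterS pq => x h; rewrite -[LHS]/(p x - q x) h subrr.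
have [dv h1] := key _ _ lv uv du; split=> //.
have vu : {ae mu, forall x, v x = u x} by apply: filterS uv.
have [_ h2] := key _ _ lu vu dv.
by apply/eqP; rewrite eq_le h1.
Qed.

End elliptic.

(** * The viscosity form *)

Lemma bil_diag_cvg {R : realType} {V : lmodType R} (L D : set V) (n : V -> R) (b : V -> V -> R)
    (f : V) (u : nat -> V) : semi_inner L D n b -> D f -> (forall k, D (u k)) ->
  b (u k - f) (u k - f) @[k --> \oo] --> (0 : R) -> b (u k) (u k) @[k --> \oo] --> b f f.
Proof.
move=> H df du hu; pose x k := u k - f.
have dx k : D (x k) := domB H (du k) df.
have bE k : b (u k) (u k) = b (x k) (x k) + 2 * b (x k) f + b f f.
  have -> : u k = 1 *: x k + f by rewrite scale1r /x subrK.
  by rewrite (bil_sqr H)// expr1n mul1r mulr1.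
have bf0 := bil_ge0 H df.
have c0 : b (x k) f @[k --> \oo] --> (0 : R).
  apply/cvgr0Pnorm_le => e e0; pose t := (b f f + 1) / e.
  have t0 : 0 < t by rewrite divr_gt0// ltr_wpDl.
  have te : 0 < e / t by rewrite divr_gt0.
  have /cvgr0Pnorm_le/(_ _ te) := hu; apply: filterS => k /(le_trans (ler_norm _)) hk.
  have := bil_amgm H t0 (dx k) df.
  have : t * b (x k) (x k) <= e by rewrite mulrC -ler_pdivlMr.
  have : t^-1 * b f f <= e.
    by rewrite /t invf_div mulrAC ler_pdivrMr ?ltr_wpDl// ler_pM2l// lerDl.
  by move: (_ * b (x k) (x k)) (t^-1 * _) => A B; lra.
have -> : (fun k => b (u k) (u k)) = fun k => b (x k) (x k) + 2 * b (x k) f + b f f.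
  by apply/funext => k; exact: bE.
have h : b (x k) (x k) + 2 * b (x k) f + b f f @[k --> \oo] --> 0 + 2 * 0 + b f f.
  by apply: cvgD; [apply: cvgD; [exact: hu|exact: cvgMl_tmp]|exact: cvg_cst].
by rewrite mulr0 !add0r in h.
Qed.

Section viscosity.
Context {R : realType} {d : nat}.
Notation E := 'rV[R]_d.
Notation mu := (lebesgue_rV d : {measure set 'rV[R]_d -> \bar R}).
Notation C := R[i].
Notation l2 := (l2 mu).
Notation nrm := (nrm mu).
Notation ip := (ip mu).
Implicit Types (u v w : E -> R^o) (f g h : E -> C) (x y z : E) (i j : 'I_d).

Lemma cvg_EFin_seq (a : nat -> R) (l : R) : a @ \oo --> l ->
  (a k)%:E @[k --> \oo] --> l%:E.
Proof. by move=> h; apply: cvg_EFin => //; exact: nearW. Qed.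

(** Along a real line an abstract positive form is a quadratic polynomial; the comparison of a
    competing form [t] with the relaxation uses its algebra only through this. *)
Lemma positive_form_expand (t : (E -> C) -> \bar R) f g : positive_form t ->
  form_dom t f -> form_dom t g -> exists p : R, forall a : R,
  fine (t ((a%:C%C \*o f) \+ g)) = a ^+ 2 * fine (t f) + a * p + fine (t g).
Proof.
move=> pt df dg; exists (complex.Re (polar t f g + polar t g f)) => a.
have dw := form_domP pt a%:C%C df dg.
have := form_diag pt dw.
rewrite (form_linr pt a%:C%C df dg dw) !(form_linl pt a%:C%C df dg)// (form_diag pt df) (form_diag pt dg).
case: (polar t f g) (polar t g f) => [p1 p2] [r1 r2] /(congr1 (@complex.Re R)) /= <-.
by ring.
Qed.

(** Positivity at [e^-1 f + g], multiplied by [e], bounds the cross term. The constant in front of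
    [g] is as close to 1 as desired, the price being paid by [f]. *)
Lemma positive_form_sub (t : (E -> C) -> \bar R) f g (e : R) : positive_form t ->
  form_dom t f -> form_dom t g -> 0 < e ->
  fine (t (((-1)%:C%C \*o f) \+ g)) <= (1 + e^-1) * fine (t f) + (1 + e) * fine (t g).
Proof.
move=> pt df dg e0; have [p hp] := positive_form_expand pt df dg.
have : 0 <= e * fine (t ((e^-1%:C%C \*o f) \+ g)).
  by rewrite mulr_ge0 ?(ltW e0)// fine_ge0// (form_ge0 pt).
rewrite hp hp.
have -> : e * (e^-1 ^+ 2 * fine (t f) + e^-1 * p + fine (t g)) = e^-1 * fine (t f) + p + e * fine (t g).
  by field; rewrite gt_eqF.
by move: (fine (t f)) (fine (t g)) => F G; lra.
Qed.

Lemma form_closure_unique (q t t' : (E -> C) -> \bar R) :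
  is_form_closure q t -> is_form_closure q t' -> t = t'.
Proof.
move=> h h'; apply/funext => f; have [h1 h2] := h f; have [h1' h2'] := h' f.
have off s : ~ form_dom s f -> s f = +oo%E.
  by rewrite /form_dom /= => /negP; rewrite -leNgt leye_eq => /eqP.
have [df|ndf] := pselect (form_dom t f).
  by have [u au] := h1.1 df; exact: (cvg_unique _ (h2 _ au) (h2' _ au)).
rewrite !off// => df'; apply: ndf; apply: h1.2; exact: h1'.1.
Qed.

Lemma regular_part_unique (q s s' : (E -> C) -> \bar R) :
  is_regular_part q s -> is_regular_part q s' -> s = s'.
Proof.
move=> [p d1 cl le max] [p' d1' cl' le' max']; apply/funext => f.
by apply/eqP; rewrite eq_le (max' s)// (max s').
Qed.

Variables c c' : 'I_d -> 'I_d -> E -> R.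
Hypothesis nc : nice_coef c'.
Hypothesis mc : forall i j, measurable_fun setT (c i j).
Hypothesis cc' : forall i j, {ae mu, forall x, c i j x = c' i j x}.

Notation en := (energy c').
Notation dom := (rdom l2 tame nrm en).
Notation a0 := (relax tame nrm en).
Notation b0 := (relax_bil tame nrm en).

Let H := energy_semi_inner nc.
Let H0 : semi_inner l2 dom nrm b0 := relax_semi_inner H.

Let Hw : semi_inner l2 w12 nrm b0.
Proof.
have wd u : w12 u -> dom u by exact: w12_dom.
split.
- exact: (amb_lin H).
- exact: (amb_norm_ge0 H).
- exact: (amb_normD H).
- exact: (amb_normZ H).
- by move=> u [].
- exact: tame_w12 (dom0 H).
- exact: w12_lin.
- by move=> a u v w /wd du /wd dv /wd dw; exact: (bil_lin H0).
- by move=> u v /wd du /wd dv; exact: (bil_sym H0).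
- by move=> u /wd du; exact: (bil_ge0 H0).
Qed.

Let dom_ae u v : l2 v -> {ae mu, forall x, u x = v x} -> dom u -> dom v /\ b0 v v = b0 u u.
Proof.
move=> lv uv du; have [dv e] := relax_ae nc lv uv du; split; first exact: dv.
by rewrite (relax_bil_diag H dv) (relax_bil_diag H du).
Qed.

Let w12_ae' u v : l2 v -> {ae mu, forall x, u x = v x} -> w12 u -> w12 v /\ b0 v v = b0 u u.
Proof.
move=> lv uv wu; split; first exact: w12_ae lv uv wu.
by have [] := dom_ae lv uv (w12_dom nc wu).
Qed.

Definition relaxed_form := cform dom b0.

(** The candidate for the regular part: the relaxed form cut down to the domain of the elliptic
    form. *)
Definition w12_form := cform w12 b0.

Lemma relaxed_form_positive : positive_form relaxed_form. Proof. exact: (cform_positive H0 dom_ae). Qed.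

Lemma w12_form_positive : positive_form w12_form. Proof. exact: (cform_positive Hw w12_ae'). Qed.

Lemma relaxed_form_val f : cdom dom f -> relaxed_form f = (a0 (re f) + a0 (im f))%:E.
Proof.
by move=> df; rewrite /relaxed_form cform_val//; have [d1 d2] := df; rewrite !(relax_bil_diag H).
Qed.

Lemma relaxed_form_dom f : form_dom relaxed_form f <-> cdom dom f.
Proof. by rewrite /relaxed_form form_dom_cform. Qed.

Lemma w12_form_dom f : form_dom w12_form f <-> cdom w12 f.
Proof. by rewrite /w12_form form_dom_cform. Qed.

Lemma w12_cdom f : cdom w12 f -> cdom dom f.
Proof. by move=> [w1 w2]; split; exact: w12_dom. Qed.

Lemma w12_form_val f : cdom w12 f -> w12_form f = relaxed_form f.
Proof. by move=> wf; rewrite /w12_form /relaxed_form !cform_val//; exact: w12_cdom. Qed.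

Lemma relaxed_form_closed : closed_form relaxed_form.
Proof.
move=> u f [du lf uf cu].
have {}du k : cdom dom (u k) by exact/relaxed_form_dom.
have lu k : L2 (u k) := cdom_L2 H0 (du k).
have [n1 n2] := (l2_cvgP lu lf).1 uf.
have d1 k : dom (re (u k)) by case: (du k).
have d2 k : dom (im (u k)) by case: (du k).
have [l1 l2'] := lf.
have cau e : 0 < e -> exists N, forall k l, (N <= k)%N -> (N <= l)%N ->
    a0 (re (u k) - re (u l)) < e /\ a0 (im (u k) - im (u l)) < e.
  move=> e0; have [N hN] := cu _ e0; exists N => k l Nk Nl.
  have := hN _ _ Nk Nl.
  have dkl : cdom dom (u k \- u l) := cdomB H0 (du k) (du l).
  rewrite (relaxed_form_val dkl) lte_fin reB imB.
  have := relax_ge0 H (domB H0 (d1 k) (d1 l)); have := relax_ge0 H (domB H0 (d2 k) (d2 l)).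
  by move: (a0 _) (a0 _) => A B; split; lra.
have [f1 c1] : dom (re f) /\ a0 (re (u k) - re f) @[k --> \oo] --> (0 : R).
  apply: (relax_closed H l1 d1 n1) => e /cau[N hN]; exists N => k l Nk Nl.
  exact: (proj1 (hN _ _ Nk Nl)).
have [f2 c2] : dom (im f) /\ a0 (im (u k) - im f) @[k --> \oo] --> (0 : R).
  apply: (relax_closed H l2' d2 n2) => e /cau[N hN]; exists N => k l Nk Nl.
  exact: (proj2 (hN _ _ Nk Nl)).
have df : cdom dom f by split.
split; first exact/relaxed_form_dom.
rewrite (_ : (fun k => _) = fun k => (a0 (re (u k) - re f) + a0 (im (u k) - im f))%:E).
  by apply: cvg_EFin_seq; rewrite -[X in _ --> X](addr0 0); exact: (cvgD c1 c2).
by apply/funext => k; rewrite (relaxed_form_val (cdomB H0 (du k) df)) reB imB.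
Qed.

(** The last clause is a Cauchy property for the energy itself, stronger than for the relaxed form:
    a competitor [t] is majorized by the elliptic form, and inherits the Cauchy property from
    there. *)
Lemma tame_approx f : cdom dom f -> exists u : nat -> E -> C,
  [/\ forall k, tame (re (u k)) /\ tame (im (u k)), form_approx relaxed_form u f,
      a0 (re (u k) - re f) + a0 (im (u k) - im f) @[k --> \oo] --> (0 : R),
      en (re (u k)) (re (u k)) + en (im (u k)) (im (u k)) @[k --> \oo] --> a0 (re f) + a0 (im f) &
      forall e : R, 0 < e -> exists N : nat, forall k l, (N <= k)%N -> (N <= l)%N ->
        en (re (u k) - re (u l)) (re (u k) - re (u l)) +
        en (im (u k) - im (u l)) (im (u k) - im (u l)) < e].
Proof.
move=> df; have [f1 f2] := df.
have [u1 m1] := minseq_exists H f1; have [u2 m2] := minseq_exists H f2.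
have [t1 n1 e1] := m1; have [t2 n2 e2] := m2.
pose u k := cplx (u1 k) (u2 k).
have du k : cdom dom (u k) by split; [have [] := dom_rdom H (t1 k)|have [] := dom_rdom H (t2 k)].
have cau e : 0 < e -> exists N : nat, forall k l, (N <= k)%N -> (N <= l)%N ->
    en (u1 k - u1 l) (u1 k - u1 l) + en (u2 k - u2 l) (u2 k - u2 l) < e.
  move=> e0; have e2' : 0 < e / 2 by rewrite divr_gt0.
  have [N1 h1] := minseq_cauchy H f1 m1 e2'; have [N2 h2] := minseq_cauchy H f2 m2 e2'.
  exists (maxn N1 N2) => k l; rewrite !geq_max => /andP[k1 k2] /andP[l1 l2'].
  rewrite [ltRHS]splitr; exact: ltrD (h1 _ _ k1 l1) (h2 _ _ k2 l2').
exists u; split.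
- by move=> k; split; [exact: t1|exact: t2].
- split.
  + by move=> k; exact/relaxed_form_dom.
  + exact: (cdom_L2 H0 df).
  + apply: (l2_cvgP (fun k => cdom_L2 H0 (du k)) (cdom_L2 H0 df)).2.
    by split; [exact: n1|exact: n2].
  + move=> e /cau[N hN]; exists N => k l Nk Nl.
    have dkl : cdom dom (u k \- u l) := cdomB H0 (du k) (du l).
    rewrite (relaxed_form_val dkl) lte_fin reB imB; apply: le_lt_trans (hN _ _ Nk Nl).
    apply: lerD.
      by have [] := dom_rdom H (domB H (t1 k) (t1 l)).
    by have [] := dom_rdom H (domB H (t2 k) (t2 l)).
- rewrite -[X in _ --> X](addr0 0); apply: cvgD.
    exact: (minseq_core H f1 m1).
  exact: (minseq_core H f2 m2).
- exact: cvgD e1 e2.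
- exact: cau.
Qed.


(** It is a restriction of the closed form [relaxed_form]. *)
Lemma w12_form_closable : closable w12_form.
Proof.
move=> u [du l0 u0 cu].
have {}du k : cdom w12 (u k) by exact/w12_form_dom.
have ap : form_approx relaxed_form u (fun=> 0).
  split=> //; first by move=> k; apply/relaxed_form_dom; exact: w12_cdom.
  move=> e /cu[N hN]; exists N => k l Nk Nl.
  by rewrite -(w12_form_val (cdomB Hw (du k) (du l))); exact: hN.
have [_ hc] := relaxed_form_closed ap.
have e : (fun k => relaxed_form (u k \- (fun=> 0))) = fun k => w12_form (u k).
  apply/funext => k; rewrite (w12_form_val (du k)).
  have -> : u k \- (fun=> 0) = u k by apply/funext => x; rewrite /= subr0.
  by [].
by rewrite e in hc.
Qed.

Lemma form_le_w12_form (t : (E -> C) -> \bar R) : positive_form t -> closable t ->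
  form_le t (elliptic_form c) -> form_le t w12_form.
Proof.
move=> pt ct th f.
have [wf|nwf] := pselect (cdom w12 f); last by rewrite /w12_form /cform asboolF// leey.
have df := w12_cdom wf.
have lf : L2 f := cdom_L2 H0 df.
have [u [tu [_ _ uf _] _ eu cau]] := tame_approx df.
have wu k : W12 (u k) by apply/W12P; have [t1 t2] := tu k; split; exact: tame_w12.
have tfin g : W12 g -> form_dom t g.
  move=> wg; apply: (le_lt_trans (th g)).
  by have : form_dom (elliptic_form c) g by rewrite form_dom_elliptic.
have dtf : form_dom t f by apply: tfin; exact/W12P.
have dtu k : form_dom t (u k) := tfin _ (wu k).
(* Closability concerns sequences tending to 0. The [v k] lie in the domain of [t], tend to 0 in L_2
   and are Cauchy for [t] since the [u k] are Cauchy for the energy, so [t (v k)] tends to 0. *)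
pose v k : E -> C := u k \- f.
have vE k : v k = ((-1)%:C%C \*o f) \+ u k.
  by apply/funext => x; rewrite /v /= rmorphN1 mulN1r addrC.
have dtv k : form_dom t (v k) by rewrite vE; exact: (form_domP pt).
have apv : form_approx t v (fun=> 0).
  split=> //.
  - by split; exact: l2_0.
  - rewrite /l2_cvg (_ : (fun k => _) = fun k => l2norm (u k \- f))//.
    by apply/funext => k; congr l2norm; apply/funext => x; rewrite /= subr0.
  - move=> e /cau[N hN]; exists N => k l Nk Nl.
    have -> : (v k \- v l)%R = u k \- u l by apply/funext => x; rewrite /v /=; ring.
    apply: (le_lt_trans (th _)).
    have [k1 k2] := tu k; have [l1 l2'] := tu l.
    have s1 : tame (re (u k \- u l)) by rewrite reB; exact: (domB H).
    have s2 : tame (im (u k \- u l)) by rewrite imB; exact: (domB H).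
    rewrite (elliptic_tame nc mc cc' s1 s2) lte_fin reB imB; exact: hN.
have tv : fine (t (v k)) @[k --> \oo] --> (0 : R) by apply: fine_cvg; exact: ct.
pose M := a0 (re f) + a0 (im f).
have M0 : 0 <= M by have [d1 d2] := df; apply: addr_ge0; exact: (relax_ge0 H).
(* Writing [f = u k - v k], the term in [v k] disappears as [k] grows in spite of its factor
   [1 + e^-1]; only afterwards does [e] tend to 0. *)
have key e : 0 < e -> fine (t f) <= (1 + e) * M.
  move=> e0.
  have h : (1 + e^-1) * fine (t (v k)) + (1 + e) * (en (re (u k)) (re (u k)) + en (im (u k)) (im (u k)))
      @[k --> \oo] --> (1 + e^-1) * 0 + (1 + e) * M.
    by apply: cvgD; [exact: cvgMl_tmp tv|exact: cvgMl_tmp eu].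
  rewrite mulr0 add0r in h.
  rewrite -(cvg_lim _ h)//; apply: limr_ge; first by apply/cvg_ex; exists ((1 + e) * M).
  apply: nearW => k.
  have fE : f = ((-1)%:C%C \*o v k) \+ u k.
    by apply/funext => x; rewrite /v /= rmorphN1 mulN1r opprB subrK.
  have := positive_form_sub pt (dtv k) (dtu k) e0; rewrite -fE => /le_trans; apply.
  have e1 : 0 < 1 + e by rewrite addr_gt0.
  rewrite lerD2l (ler_pM2l e1).
  have [k1 k2] := tu k.
  rewrite -lee_fin fineK.
    by rewrite -(elliptic_tame nc mc cc' k1 k2).
  by rewrite ge0_fin_numE ?(form_ge0 pt)//; exact: dtu.
have tfE : t f = (fine (t f))%:E.
  by rewrite fineK// ge0_fin_numE ?(form_ge0 pt).
rewrite (w12_form_val wf) (relaxed_form_val df) tfE lee_fin -/M.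
apply/ler_addgt0Pr => e e0.
have M1 : 0 < M + 1 by rewrite ltr_wpDl.
apply: (le_trans (key (e / (M + 1)) (divr_gt0 e0 M1))).
rewrite mulrDl mul1r lerD2l mulrAC ler_pdivrMr// ler_pM2l// lerDl//.
Qed.

Lemma w12_form_regular_part : is_regular_part (elliptic_form c) w12_form.
Proof.
split.
- exact: w12_form_positive.
- rewrite form_dom_elliptic /w12_form form_dom_cform; apply/seteqP.
  by split=> f /W12P.
- exact: w12_form_closable.
- move=> f; have [wf|nwf] := pselect (W12 f); last by rewrite /elliptic_form asboolF// leey.
  have cf : cdom w12 f by exact/W12P.
  by rewrite (w12_form_val cf) (relaxed_form_val (w12_cdom cf)); exact: (relax_le_elliptic nc mc cc').
- exact: form_le_w12_form.
Qed.

Lemma relaxed_form_continuous f (u : nat -> E -> C) : cdom dom f -> (forall k, cdom dom (u k)) ->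
  relaxed_form (u k \- f) @[k --> \oo] --> 0%E -> relaxed_form (u k) @[k --> \oo] --> relaxed_form f.
Proof.
move=> df du hu; have [f1 f2] := df.
have d1 k : dom (re (u k)) by case: (du k).
have d2 k : dom (im (u k)) by case: (du k).
have p1 k : 0 <= b0 (re (u k) - re f) (re (u k) - re f) := bil_ge0 H0 (domB H0 (d1 k) f1).
have p2 k : 0 <= b0 (im (u k) - im f) (im (u k) - im f) := bil_ge0 H0 (domB H0 (d2 k) f2).
have hx : b0 (re (u k) - re f) (re (u k) - re f) + b0 (im (u k) - im f) (im (u k) - im f)
    @[k --> \oo] --> (0 : R).
  have e : (fun k => relaxed_form (u k \- f)) = fun k => (b0 (re (u k) - re f) (re (u k) - re f) +
      b0 (im (u k) - im f) (im (u k) - im f))%:E.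
    by apply/funext => k; rewrite /relaxed_form (cform_val _ (cdomB H0 (du k) df)) reB imB.
  by rewrite e in hu; exact: (fine_cvg hu).
have c1 : b0 (re (u k) - re f) (re (u k) - re f) @[k --> \oo] --> (0 : R).
  apply: (squeeze_cvgr _ (cvg_cst (0 : R)) hx); apply: nearW => k.
  by rewrite p1/= lerDl p2.
have c2 : b0 (im (u k) - im f) (im (u k) - im f) @[k --> \oo] --> (0 : R).
  apply: (squeeze_cvgr _ (cvg_cst (0 : R)) hx); apply: nearW => k.
  by rewrite p2/= lerDr p1.
have hk k : relaxed_form (u k) = (b0 (re (u k)) (re (u k)) + b0 (im (u k)) (im (u k)))%:E.
  exact: cform_val (du k).
have -> : (fun k => relaxed_form (u k)) =
    fun k => (b0 (re (u k)) (re (u k)) + b0 (im (u k)) (im (u k)))%:E.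
  by apply/funext => k; exact: hk.
have -> : relaxed_form f = (b0 (re f) (re f) + b0 (im f) (im f))%:E by exact: cform_val df.
apply: cvg_EFin_seq.
exact: (cvgD (bil_diag_cvg H0 f1 d1 c1) (bil_diag_cvg H0 f2 d2 c2)).
Qed.

(** Approximating sequences in W^{1,2} have their limits in the relaxed domain because
    [relaxed_form] is closed; conversely the tame approximants of any element of that domain already
    lie in W^{1,2}. *)
Lemma w12_form_closure : is_form_closure w12_form relaxed_form.
Proof.
have ap (u : nat -> E -> C) f : form_approx w12_form u f -> form_approx relaxed_form u f /\ forall k, cdom w12 (u k).
  move=> [du lf uf cu].
  have {}du k : cdom w12 (u k) by exact/w12_form_dom.
  split=> //; split=> //; first by move=> k; apply/relaxed_form_dom; exact: w12_cdom.
  move=> e /cu[N hN]; exists N => k l Nk Nl.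
  by rewrite -(w12_form_val (cdomB Hw (du k) (du l))); exact: hN.
move=> f; split; last first.
  move=> u /ap[au wu]; have [/relaxed_form_dom df hu] := relaxed_form_closed au.
  have -> : (fun k => w12_form (u k)) = fun k => relaxed_form (u k) by apply/funext => k; exact: w12_form_val.
  by apply: relaxed_form_continuous => // k; exact: w12_cdom.
split=> [/relaxed_form_dom df|[u /ap[au _]]]; last by have [] := relaxed_form_closed au.
have [u [tu [_ lf uf cu] _ _ _]] := tame_approx df.
have wu k : cdom w12 (u k) by have [t1 t2] := tu k; split; exact: tame_w12.
exists u; split=> //; first by move=> k; exact/w12_form_dom.
move=> e /cu[N hN]; exists N => k l Nk Nl.
by rewrite (w12_form_val (cdomB Hw (wu k) (wu l))); exact: hN.
Qed.

Lemma viscosityE : viscosity_form (elliptic_form c) = relaxed_form.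
Proof.
have e : regular_part (elliptic_form c) = w12_form.
  apply: xget_unique; first exact: w12_form_regular_part.
  by move=> s hs; exact: regular_part_unique hs w12_form_regular_part.
rewrite /viscosity_form e; apply: xget_unique; first exact: w12_form_closure.
by move=> s hs; exact: form_closure_unique hs w12_form_closure.
Qed.

End viscosity.

(** * The viscosity form is a regular local Dirichlet form *)

Section dirichlet.
Context {R : realType} {d : nat}.
Notation E := 'rV[R]_d.
Notation mu := (lebesgue_rV d : {measure set 'rV[R]_d -> \bar R}).
Notation C := R[i].
Notation l2 := (l2 mu).
Notation nrm := (nrm mu).
Implicit Types (u v w : E -> R^o) (f g h : E -> C) (x y z : E) (i j : 'I_d).

Lemma normc_le (z : C) : ComplexField.Normc.normc z <= `|complex.Re z| + `|complex.Im z|.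
Proof.
case: z => a b /=.
rewrite -(ger0_norm (addr_ge0 (normr_ge0 a) (normr_ge0 b))) -sqrtr_sqr ler_wsqrtr//.
by rewrite sqrrD !real_normK ?num_real// lerD2r lerDl mulrn_wge0.
Qed.

Lemma Re_normc_le (z : C) : `|complex.Re z| <= ComplexField.Normc.normc z.
Proof. by case: z => a b /=; rewrite -sqrtr_sqr ler_wsqrtr// lerDl sqr_ge0. Qed.

Lemma Im_normc_le (z : C) : `|complex.Im z| <= ComplexField.Normc.normc z.
Proof. by case: z => a b /=; rewrite -sqrtr_sqr ler_wsqrtr// lerDr sqr_ge0. Qed.

Lemma tame_Cc f : tame (re f) -> tame (im f) -> Cc f.
Proof.
move=> [c1 [r1 h1] _ _] [c2 [r2 h2] _ _]; split; first by split.
apply: (@support_compact _ _ _ (Num.max r1 r2)) => x /= fx.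
apply: contrapT => nx; move/eqP : fx; apply; apply/eqP.
have e1 : re f x = 0 by apply: h1 => cx; apply: nx; apply: cubeS cx; rewrite le_max lexx.
have e2 : im f x = 0 by apply: h2 => cx; apply: nx; apply: cubeS cx; rewrite le_max lexx orbT.
by move: e1 e2; rewrite /re /im eq_complex /= => -> ->; rewrite eqxx.
Qed.

Variable c' : 'I_d -> 'I_d -> E -> R.
Hypothesis nc : nice_coef c'.

Notation en := (energy c').
Notation dom := (rdom l2 tame nrm en).
Notation a0 := (relax tame nrm en).
Notation b0 := (relax_bil tame nrm en).

Let H := energy_semi_inner nc.
Let H0 : semi_inner l2 dom nrm b0 := relax_semi_inner H.

Lemma relaxN u : dom u -> a0 (- u) = a0 u.
Proof.
move=> du; have dnu := domN H0 du.
rewrite -(relax_bil_diag H dnu) -(relax_bil_diag H du) -scaleN1r.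
rewrite (bilZl H0 (-1) du (domZ H0 (-1) du)) (bilZr H0 (-1) du du).
by rewrite mulrA mulrNN !mul1r.
Qed.

Lemma relaxed_form_real f : relaxed_form c' (fun x => conjc (f x)) = relaxed_form c' f.
Proof.
have e1 : re (fun x => conjc (f x)) = re f.
  by apply/funext => x; rewrite /re; case: (f x).
have e2 : im (fun x => conjc (f x)) = - im f.
  by apply/funext => x; rewrite -[RHS]/(- complex.Im (f x)) /im; case: (f x).
have [df|ndf] := pselect (cdom dom f).
  have [d1 d2] := df.
  have dg : cdom dom (fun x => conjc (f x)).
    by split; [rewrite e1|rewrite e2; exact: (domN H0)].
  by rewrite (relaxed_form_val nc dg) (relaxed_form_val nc df) e1 e2 (relaxN d2).
rewrite /relaxed_form /cform (asboolF ndf) asboolF// => -[]; rewrite e1 e2 => d1 d2.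
by apply: ndf; split => //; rewrite -[im f]opprK; exact: (domN H0).
Qed.

Lemma relaxed_form_markov f : (forall x, complex.Im (f x) = 0) -> (relaxed_form c' (unit_contraction f) <= relaxed_form c' f)%E.
Proof.
move=> f0; have [df|ndf] := pselect (cdom dom f); last by rewrite [leRHS]/relaxed_form /cform asboolF// leey.
have [d1 d2] := df.
have e2 : im f = 0 by apply/funext => x; exact: f0.
have e2' : im (unit_contraction f) = 0 by [].
have e1 : re (unit_contraction f) = clip \o re f by [].
have [dc hc] := relax_clip nc d1.
have dg : cdom dom (unit_contraction f) by split; rewrite ?e1 ?e2' -?e2.
by rewrite (relaxed_form_val nc dg) (relaxed_form_val nc df) e1 e2 e2' lee_fin lerD2r.
Qed.

Lemma relaxed_form_dense : densely_defined (relaxed_form c').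
Proof.
move=> f [l1 l2'] e e0; have e2 : 0 < e / 2 by rewrite divr_gt0.
have [_ /(_ _ e2)[u1 t1 n1]] := tame_dense l1.
have [_ /(_ _ e2)[u2 t2 n2]] := tame_dense l2'.
have dg : cdom dom (cplx u1 u2).
  by split; [have [] := dom_rdom H t1|have [] := dom_rdom H t2].
exists (cplx u1 u2); first exact/relaxed_form_dom.
apply: (le_lt_trans (l2norm_le (L2B (conj l1 l2') (cdom_L2 H0 dg)))).
by rewrite reB imB [ltRHS]splitr; exact: ltrD n1 n2.
Qed.

Lemma relaxed_form_dirichlet : dirichlet_form (relaxed_form c').
Proof.
split.
- exact: relaxed_form_positive.
- exact: relaxed_form_dense.
- exact: relaxed_form_closed.
- exact: relaxed_form_real.
- exact: relaxed_form_markov.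
Qed.

Lemma relaxed_form_core f e : cdom dom f -> 0 < e -> exists g, [/\ tame (re g), tame (im g) &
  Num.sqrt (fine (relaxed_form c' (f \- g)) + l2norm (f \- g) ^+ 2) < e].
Proof.
move=> df e0; have lf := cdom_L2 H0 df.
have [u [tu [du _ uf _] hu _ _]] := tame_approx nc df.
have dg k : cdom dom (u k) by exact/relaxed_form_dom.
have lu k : L2 (u k) := cdom_L2 H0 (dg k).
have [n1 n2] := (l2_cvgP lu lf).1 uf.
have hn : nrm (re (u k) - re f) ^+ 2 + nrm (im (u k) - im f) ^+ 2 @[k --> \oo] --> (0 : R).
  have h : nrm (re (u k) - re f) * nrm (re (u k) - re f) + nrm (im (u k) - im f) * nrm (im (u k) - im f)
    @[k --> \oo] --> (0 * 0 + 0 * 0 : R).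
    exact: cvgD (cvgM n1 n1) (cvgM n2 n2).
  by rewrite mul0r addr0 in h.
have q0 : 0 < e ^+ 2 / 2 by rewrite divr_gt0// exprn_gt0.
have /cvgr0Pnorm_lt/(_ _ q0) k1 := hu.
have /cvgr0Pnorm_lt/(_ _ q0) k2 := hn.
have [k [h1 h2]] := filter_ex (filterI k1 k2).
exists (u k); have [t1 t2] := tu k; split=> //.
have [f1 f2] := df; have [g1 g2] := dg k.
have dfg : cdom dom (f \- u k) := cdomB H0 df (dg k).
have lfg : L2 (f \- u k) := cdom_L2 H0 dfg.
have s1 : re (f \- u k) = - (re (u k) - re f) by rewrite reB opprB.
have s2 : im (f \- u k) = - (im (u k) - im f) by rewrite imB opprB.
have b1 := domB H0 g1 f1; have b2 := domB H0 g2 f2.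
have m1 := rdom_amb b1; have m2 := rdom_amb b2.
rewrite (relaxed_form_val nc dfg) (l2norm_sqr lfg) s1 s2 (relaxN b1) (relaxN b2) (nrmN m1) (nrmN m2).
rewrite -[ltRHS](ger0_norm (ltW e0)) -[ltRHS]sqrtr_sqr ltr_sqrt ?exprn_gt0//.
rewrite [ltRHS]splitr; apply: ltrD; [exact: le_lt_trans (ler_norm _) h1|exact: le_lt_trans (ler_norm _) h2].
Qed.

(** The functions with tame real and imaginary parts serve for both densities: minimizing sequences
    give the form norm, thresholding and mollification the supremum norm. *)
Lemma relaxed_form_regular : regular_form (relaxed_form c').
Proof.
exists [set g | tame (re g) /\ tame (im g)]; split.
- move=> g [t1 t2]; split; last exact: tame_Cc.
  by apply/relaxed_form_dom; split; [have [] := dom_rdom H t1|have [] := dom_rdom H t2].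
- move=> f /relaxed_form_dom df e e0; have [g [t1 t2 h]] := relaxed_form_core df e0.
  by exists g.
- move=> f [[c1 c2] vf] e e0; have e2 : 0 < e / 2 by rewrite divr_gt0.
  have [u1 t1 h1] : exists2 u, tame u & forall x, `|re f x - u x| < e / 2.
    apply: (tame_uniform_dense c1) => // q /vf[K cK hK]; exists K => // x /hK.
    by apply: le_lt_trans; exact: Re_normc_le.
  have [u2 t2 h2] : exists2 u, tame u & forall x, `|im f x - u x| < e / 2.
    apply: (tame_uniform_dense c2) => // q /vf[K cK hK]; exists K => // x /hK.
    by apply: le_lt_trans; exact: Im_normc_le.
  exists (cplx u1 u2); first by split.
  move=> x; apply: (le_lt_trans (normc_le _)); rewrite [ltRHS]splitr.
  have -> : complex.Re (f x - cplx u1 u2 x) = re f x - u1 x by rewrite /re /cplx; case: (f x).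
  have -> : complex.Im (f x - cplx u1 u2 x) = im f x - u2 x by rewrite /im /cplx; case: (f x).
  exact: ltrD.
Qed.

(** At almost every point either [re f = -a] and [im f = 0], or both parts of [g] vanish. Hence real
    locality applies to all four pairs of parts, with the constant [a] for [re f] and 0 for
    [im f]. *)
Lemma relaxed_form_local : local_form (relaxed_form c').
Proof.
move=> f g a /relaxed_form_dom df /relaxed_form_dom dg fg.
have [f1 f2] := df; have [g1 g2] := dg.
have fg0 : {ae mu, forall x, (re f x + a = 0 /\ im f x = 0) \/ (re g x = 0 /\ im g x = 0)}.
  apply: filterS fg => x /eqP; rewrite mulf_eq0 !eq_complex /re /im.
  case: (f x) (g x) => [p1 p2] [r1 r2] /=; rewrite addr0.
  by case/orP => /andP[/eqP-> /eqP->]; [left|right].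
have z1 : b0 (re g) (re f) = 0.
  by apply: (relax_local nc f1 g1 (a := a)); apply: filterS fg0 => x [[-> _]|[-> _]]; rewrite ?mul0r ?mulr0.
have z2 : b0 (im g) (re f) = 0.
  by apply: (relax_local nc f1 g2 (a := a)); apply: filterS fg0 => x [[-> _]|[_ ->]]; rewrite ?mul0r ?mulr0.
have z3 : b0 (re g) (im f) = 0.
  by apply: (relax_local nc f2 g1 (a := 0)); apply: filterS fg0 => x [[_ ->]|[-> _]]; rewrite ?addr0 ?mul0r ?mulr0.
have z4 : b0 (im g) (im f) = 0.
  by apply: (relax_local nc f2 g2 (a := 0)); apply: filterS fg0 => x [[_ ->]|[_ ->]]; rewrite ?addr0 ?mul0r ?mulr0.
rewrite (polar_cform H0 df dg) (bil_sym H0 f1 g1) (bil_sym H0 f2 g2) (bil_sym H0 f2 g1) (bil_sym H0 f1 g2).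
by rewrite z1 z2 z3 z4 addr0 subr0.
Qed.

End dirichlet.

Theorem theorem1p1 (R : realType) (d : nat)
    (c : 'I_d -> 'I_d -> 'rV[R]_d -> R)
    (hd : (0 < d)%N)
    (c_Loo : forall i j, c i j \in Lfun (lebesgue_rV d) +oo%E)
    (c_sym : forall i j, {ae lebesgue_rV d, forall x, c i j x = c j i x})
    (c_pos : {ae lebesgue_rV d, forall x, forall xi : 'cV[R]_d,
        0 <= (xi^T *m coeff_mx c x *m xi) ord0 ord0}) :
  let h0 := viscosity_form (elliptic_form c) in
  [/\ dirichlet_form h0, regular_form h0 & local_form h0].
Proof.
have [c' nc cc'] := nice_coef_exists c_Loo c_sym c_pos.
have mc i j : measurable_fun setT (c i j) by have [] := Linfty_bounded (c_Loo i j).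
rewrite /= (viscosityE nc mc cc').
split; [exact: relaxed_form_dirichlet|exact: relaxed_form_regular|exact: relaxed_form_local].
Qed.
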